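(* Let $K$ be a symmetric and compact subset of $\mathbb{T}\setminus\{1,-1\}$. Assume that (i) $\mathbf{a}\in\mathcal{D}'(K)$ is an even distribution with smooth part $a\in C^\infty(\mathbb{T}\setminus K)$; (ii) $\mathbf{a}_+\in\mathcal{G}\mathcal{D}_+'(K)$ is a distribution with smooth part $a_+\in C^\infty(\mathbb{T}\setminus K)$; (iii) $a(t)=a_+(t)\tilde{a}_+(t)$ for all $t\in\mathbb{T}\setminus K$, where $\tilde a_+(t)=a_+(t^{-1})$; (iv) $\varrho_0<0$ and $\varrho<0$ are real numbers; (v) $\mathbf{a}$ effects $\mathcal{R}$-convergence with respect to $[\mathbf{a}_+,\tilde{\mathbf{a}}_+]$ and $(\varrho_0,\varrho,\varrho)$. Then $$\frac{\det T_{2N}(\mathbf{a}\boldsymbol{\sigma})}{\det T_{2N}(\mathbf{a})}=\frac{a_+(1)}{a_+(-1)}+O\bigl(N^{\max\{\varrho_0,\varrho\}}\bigr)\qquad\text{as }N\to\infty .$$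
   Context: Distributions. $\mathbb{T}$ is the unit circle, $\mathcal{D}=C^\infty(\mathbb{T})$, $\mathcal{D}'$ is the space of distributions on $\mathbb{T}$. Fourier coefficients: $\mathbf{a}_n=\mathbf{a}(\chi_{-n})$, $\chi_n(t)=t^n$. For $g\in\mathcal{D}$, $\mathbf{b}\in\mathcal{D}'$: $(g\mathbf{b})(f)=\mathbf{b}(gf)$. For compact $K\subseteq\mathbb{T}$, $C^\infty_K(\mathbb{T})$ is the set of $f\in\mathcal{D}$ vanishing on an open neighborhood of $K$; $\mathcal{D}'(K)$ is the set of $\mathbf{a}\in\mathcal{D}'$ for which there is $a\in C^\infty(\mathbb{T}\setminus K)$ (unique, called the smooth part of $\mathbf{a}$) with $\mathbf{a}(f)=\frac1{2\pi}\int_0^{2\pi}a(e^{i\theta})f(e^{i\theta})\,d\theta$ for all $f\in C^\infty_K(\mathbb{T})$. If $M,L\subseteq\mathbb{T}$ are disjoint compact sets, $\mathbf{a}\in\mathcal{D}'(M)$, $\mathbf{b}\in\mathcal{D}'(L)$ with smooth parts $a,b$, then $\mathbf{a}\mathbf{b}:=(bf_b)\mathbf{a}+(af_a)\mathbf{b}\in\mathcal{D}'(M\cup L)$ for any $f_a\in C^\infty_M(\mathbb{T})$, $f_b\in C^\infty_L(\mathbb{T})$ with $f_a+f_b=1$ (products $af_a$, $bf_b$ extended by $0$). $\tilde{\mathbf{a}}$ is the distribution with $\tilde{\mathbf{a}}_n=\mathbf{a}_{-n}$; $\mathbf{a}$ is even if $\tilde{\mathbf{a}}=\mathbf{a}$.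 $K$ is symmetric if $t\in K\Leftrightarrow t^{-1}\in K$. $\boldsymbol{\sigma}$ is the distribution with $\boldsymbol{\sigma}_n=\mathrm{sign}(n)$ ($\mathrm{sign}(0)=0$); it lies in $\mathcal{D}'(\{1\})$ with smooth part $\frac{1+t}{1-t}$. $\mathcal{D}'_+$ (resp. $\mathcal{D}'_-$) is the set of $\mathbf{a}\in\mathcal{D}'$ with $\mathbf{a}_n=0$ for all $n<0$ (resp. $n>0$); these are commutative unital algebras under the (finite-sum) convolution product of Fourier coefficients. $\mathcal{G}\mathcal{D}'_\pm$ is the group of invertible elements of $\mathcal{D}'_\pm$; $\mathcal{D}'_\pm(K)=\mathcal{D}'_\pm\cap\mathcal{D}'(K)$, and $\mathcal{G}\mathcal{D}'_\pm(K)$ is the group of invertible elements of $\mathcal{D}'_\pm(K)$. Operators. For $\mu\in\mathbb{R}$, $\ell^2_\mu$ is the Hilbert space of complex sequences $\{x_n\}_{n\ge0}$ with $\bigl(\sum_{n\ge 0}(1+n)^{2\mu}|x_n|^2\bigr)^{1/2}<\infty$. $T(\mathbf{a})=(\mathbf{a}_{j-k})_{j,k=0}^\infty$, $H(\mathbf{a})=(\mathbf{a}_{j+k+1})_{j,k=0}^\infty$; these are bounded from $\ell^2_{\mu_1}$ to $\ell^2_{\mu_2}$ for $\mu_1$ sufficiently large and $\mu_2$ sufficiently small. $P_N(x_0,x_1,\dots)=(x_0,\dots,x_{N-1},0,\dots)$, $W_N(x_0,x_1,\dots)=(x_{N-1},\dots,x_0,0,\dots)$. $T_N(\mathbf{a})=P_NT(\mathbf{a})P_N$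 is identified with the matrix $(\mathbf{a}_{j-k})_{j,k=0}^{N-1}$, and $T_N^{-1}(\mathbf{a})$ is its inverse on the image of $P_N$. For Hilbert spaces $H_1,H_2$ and $\varrho\in\mathbb{R}$, $\mathcal{O}(\varrho)$ denotes any sequence of bounded operators $C_N:H_1\to H_2$ (defined for all sufficiently large $N$) with $\|C_N\|=O(N^\varrho)$ as $N\to\infty$. $\mathcal{O}(\varrho_0,\varrho_1,\varrho_2)$ denotes any sequence of $2\times2$ block operators of the form $\begin{pmatrix}\mathcal{O}(\varrho_0)&\mathcal{O}(\varrho_1)\\ \mathcal{O}(\varrho_2)&\mathcal{O}(\varrho_0)\end{pmatrix}$. $\mathcal{R}$-convergence. If $T_N(\mathbf{a})$ is invertible for all sufficiently large $N$, put $$R_N(\mathbf{a})=\begin{pmatrix} T_N^{-1}(\mathbf{a}) & T_N^{-1}(\mathbf{a})W_N \\ T_N^{-1}(\tilde{\mathbf{a}})W_N & T_N^{-1}(\tilde{\mathbf{a}})\end{pmatrix},$$ $$RH_N(\mathbf{a})=\begin{pmatrix} T_N^{-1}(\mathbf{a})P_NH(\mathbf{a}) & T_N^{-1}(\mathbf{a})W_NH(\tilde{\mathbf{a}}) \\ T_N^{-1}(\tilde{\mathbf{a}})W_NH(\mathbf{a}) & T_N^{-1}(\tilde{\mathbf{a}})P_NH(\tilde{\mathbf{a}})\end{pmatrix},$$ $$HR_N(\mathbf{a})=\begin{pmatrix} H(\tilde{\mathbf{a}})P_NT_N^{-1}(\mathbf{a}) & H(\tilde{\mathbf{a}})W_NT_N^{-1}(\tilde{\mathbf{a}})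 \\ H(\mathbf{a})W_NT_N^{-1}(\mathbf{a}) & H(\mathbf{a})P_NT_N^{-1}(\tilde{\mathbf{a}})\end{pmatrix},$$ $$HRH_N(\mathbf{a})=\begin{pmatrix} H(\tilde{\mathbf{a}})P_NT_N^{-1}(\mathbf{a})P_NH(\mathbf{a}) & H(\tilde{\mathbf{a}})P_NT_N^{-1}(\mathbf{a})W_NH(\tilde{\mathbf{a}}) \\ H(\mathbf{a})P_NT_N^{-1}(\tilde{\mathbf{a}})W_NH(\mathbf{a}) & H(\mathbf{a})P_NT_N^{-1}(\tilde{\mathbf{a}})P_NH(\tilde{\mathbf{a}})\end{pmatrix}-\begin{pmatrix} T(\tilde{\mathbf{a}}) & H(\tilde{\mathbf{a}}\chi_{-N}) \\ H(\mathbf{a}\chi_{-N}) & T(\mathbf{a})\end{pmatrix}.$$ Let $\mathbf{a}\in\mathcal{D}'$, $\mathbf{a}_+\in\mathcal{G}\mathcal{D}'_+$, $\mathbf{a}_-\in\mathcal{G}\mathcal{D}'_-$, $\varrho_0,\varrho_1,\varrho_2\in\mathbb{R}$. One says that $\mathbf{a}$ effects $\mathcal{R}$-convergence with respect to $[\mathbf{a}_+,\mathbf{a}_-]$ and $(\varrho_0,\varrho_1,\varrho_2)$ if $T_N(\mathbf{a})$ is invertible for all sufficiently large $N$ and there exist $\mu_1\ge0$, $\mu_2\le0$ such that, as operators from $\ell^2_{\mu_1}\oplus\ell^2_{\mu_1}$ into $\ell^2_{\mu_2}\oplus\ell^2_{\mu_2}$, $$R_N(\mathbf{a})=\mathrm{diag}\bigl(T(\mathbf{a}_+^{-1})T(\mathbf{a}_-^{-1}),\,T(\tilde{\mathbf{a}}_-^{-1})T(\tilde{\mathbf{a}}_+^{-1})\bigr)+\mathcal{O}(\varrho_0,\varrho_1,\varrho_2),$$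 $$RH_N(\mathbf{a})=\mathrm{diag}\bigl(T(\mathbf{a}_+^{-1})H(\mathbf{a}_+),\,T(\tilde{\mathbf{a}}_-^{-1})H(\tilde{\mathbf{a}}_-)\bigr)+\mathcal{O}(\varrho_0,\varrho_1,\varrho_2),$$ $$HR_N(\mathbf{a})=\mathrm{diag}\bigl(H(\tilde{\mathbf{a}}_-)T(\mathbf{a}_-^{-1}),\,H(\mathbf{a}_+)T(\tilde{\mathbf{a}}_+^{-1})\bigr)+\mathcal{O}(\varrho_0,\varrho_1,\varrho_2),$$ $$HRH_N(\mathbf{a})=-\mathrm{diag}\bigl(T(\tilde{\mathbf{a}}_-)T(\tilde{\mathbf{a}}_+),\,T(\mathbf{a}_+)T(\mathbf{a}_-)\bigr)+\mathcal{O}(\varrho_0,\varrho_1,\varrho_2).$$ *)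

(* Defs.v *)
From HB Require Import structures.
From mathcomp Require Import all_boot all_order all_algebra.
From mathcomp Require Import complex.
From mathcomp Require Import all_classical all_reals all_analysis.
From mathcomp Require Import ring lra.

Set Implicit Arguments.
Unset Strict Implicit.
Unset Printing Implicit Defensive.

Import Order.TTheory GRing.Theory Num.Theory numFieldNormedType.Exports.

Local Open Scope classical_set_scope.
Local Open Scope complex_scope.
Local Open Scope ring_scope.

(* In ring_scope these library notations denote derivatives of polynomials. *)
Local Notation "u ^` ( n )" := (derive1n n u) : ring_scope.
Local Notation "u ^` ()" := (derive1 u) : ring_scope.

HB.instance Definition _ (R : realType) := NormedModule.copy R[i] R[i]^o.

Definition circle (R : realType) : Type := {t : R[i] | `|t| == 1}.

HB.instance Definition _ (R : realType) :=
  SubChoice.copy (circle R) {t : R[i] | `|t| == 1}.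
HB.instance Definition _ (R : realType) :=
  Topological.copy (circle R) (initial_topology (val : circle R -> R[i])).

Section Circle.
Context {R : realType}.
Implicit Types t : circle R.

Lemma cis_subproof (theta : R) : `|cos theta +i* sin theta| == 1.
Proof. by rewrite normc_def /= cos2Dsin2 sqrtr1. Qed.

Local Notation in_circle := (@exist R[i] (fun z => `|z| == 1) _).

Definition cis (theta : R) : circle R := in_circle (cis_subproof theta).

Lemma circle1_subproof : `|1 : R[i]| == 1. Proof. by rewrite normr1. Qed.

Definition circle1 : circle R := in_circle circle1_subproof.

Lemma circleN_subproof t : `|- val t| == 1.
Proof. by rewrite normrN (valP t). Qed.

Definition circleN t : circle R := in_circle (circleN_subproof t).

Lemma circle_neq0 t : val t != 0.
Proof. by rewrite -normr_eq0 (eqP (valP t)) oner_eq0. Qed.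

Lemma circleV_subproof t : `|(val t)^-1| == 1.
Proof. by rewrite normfV (eqP (valP t)) invr1. Qed.

Definition circleV t : circle R := in_circle (circleV_subproof t).

Lemma circleV_cis theta : circleV (cis theta) = cis (- theta).
Proof.
apply: val_inj; rewrite /= cosN sinN.
have h : (cos theta +i* sin theta) * (cos theta +i* - sin theta) = 1.
  apply/eqP; rewrite eq_complex /= !mulrN opprK -!expr2 cos2Dsin2 eqxx /=.
  by rewrite mulrC addrC subrr.
apply: (mulfI (circle_neq0 (cis theta))).
by rewrite h mulfV// circle_neq0.
Qed.

End Circle.

HB.instance Definition _ (R : realType) := isPointed.Build (circle R) circle1.

Section RealSmooth.
Context {R : realType}.
Implicit Types u v : R -> R.

Definition cinf u := forall (n : nat) x, derivable u^`(n) x 1.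

Lemma derive1nSr u n : u^`(n.+1) = u^`()^`(n).
Proof. by rewrite /derive1n iterSr. Qed.

Lemma cinf_derivable u x : cinf u -> derivable u x 1.
Proof. by move=> /(_ 0%N x). Qed.

Lemma cinf_derive1 u : cinf u -> cinf u^`().
Proof. by move=> cu n x; have := cu n.+1 x; rewrite derive1nSr. Qed.

Lemma cinf_derive1n u n : cinf u -> cinf u^`(n).
Proof. move=> cu; elim: n => [|n IH]; first exact: cu.
rewrite derive1nS; exact: cinf_derive1. Qed.

Lemma cinf_continuous u : cinf u -> continuous u.
Proof.
move=> cu x; apply: differentiable_continuous; apply/derivable1_diffP.
exact: cinf_derivable.
Qed.

Lemma derive1_add u v : (forall x, derivable u x 1) ->
  (forall x, derivable v x 1) -> (u \+ v)^`() = u^`() \+ v^`().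
Proof.
move=> cu cv; apply/funext => x; rewrite [RHS]/= !derive1E.
exact: deriveD (cu x) (cv x).
Qed.

Lemma derive1_mul u v : (forall x, derivable u x 1) ->
  (forall x, derivable v x 1) -> (u \* v)^`() = (u^`() \* v) \+ (u \* v^`()).
Proof.
move=> cu cv; apply/funext => x; rewrite [RHS]/= !derive1E.
rewrite [LHS](deriveM (cu x) (cv x)).
by rewrite addrC /GRing.scale /= [v x * _]mulrC.
Qed.

Lemma derive1_opp_arg u : (forall x, derivable u x 1) ->
  (u \o -%R)^`() = \- (u^`() \o -%R).
Proof.
move=> cu; apply/funext => x; rewrite [LHS](derive1_comp _ (cu _)); last first.
  exact: derivable_opp.
have -> : (-%R : R -> R)^`() x = -1 by rewrite (derive1N (@derivable_id _ _ _ _)) derive1_id.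
exact: mulrN1.
Qed.

Lemma derive1_shift u (c : R) : (u \o +%R c)^`() = u^`() \o +%R c.
Proof.
apply/funext => x; rewrite /derive1 /=.
by under eq_fun do rewrite addrCA.
Qed.

Let cn (n : nat) u := forall k x, (k <= n)%N -> derivable u^`(k) x 1.

Let cnS n u : cn n.+1 u <-> (forall x, derivable u x 1) /\ cn n u^`().
Proof.
split=> [h|[h1 h2] [|k] x kn//]; last by rewrite derive1nSr; exact: h2.
by split=> [x|k x kn]; [exact: (h 0%N)|rewrite -derive1nSr; exact: h].
Qed.

Let cnW n u : cn n.+1 u -> cn n u.
Proof. by move=> h k x kn; apply: h; exact: leqW. Qed.

Let cnD n u v : cn n u -> cn n v -> cn n (u \+ v).
Proof.
elim: n u v => [|n IH] u v.
  move=> cu cv [|//] x _; apply: derivableD; [exact: (cu 0%N)|exact: (cv 0%N)].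
move=> /cnS[du cu] /cnS[dv cv]; apply/cnS; split=> [x|]; first exact: derivableD (du x) (dv x).
by rewrite (derive1_add du dv); exact: IH.
Qed.

Let cnM n u v : cn n u -> cn n v -> cn n (u \* v).
Proof.
elim: n u v => [|n IH] u v.
  move=> cu cv [|//] x _; apply: derivableM; [exact: (cu 0%N)|exact: (cv 0%N)].
move=> cu' cv'; move: (cu') (cv') => /cnS[du cu] /cnS[dv cv]; apply/cnS.
split=> [x|]; first exact: derivableM (du x) (dv x).
rewrite (derive1_mul du dv).
by apply: cnD; apply: IH; [exact: cu|exact: cnW|exact: cnW|exact: cv].
Qed.

Lemma cinfD u v : cinf u -> cinf v -> cinf (u \+ v).
Proof. by move=> cu cv n x; apply: (cnD (n := n)). Qed.

Lemma cinfM u v : cinf u -> cinf v -> cinf (u \* v).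
Proof. by move=> cu cv n x; apply: (cnM (n := n)). Qed.

Lemma cinf_cst c : cinf (cst c : R -> R).
Proof.
move=> n x; suff [d ->] : exists d, (cst c : R -> R)^`(n) = cst d by [].
elim: n => [|n [d IH]]; first by exists c.
by exists 0; rewrite derive1nS IH; apply/funext => y; rewrite derive1_cst.
Qed.

Lemma cinfN u : cinf u -> cinf (\- u).
Proof.
move=> cu; have -> : \- u = cst (-1) \* u by apply/funext => x /=; rewrite mulN1r.
by apply: cinfM; [exact: cinf_cst|exact: cu].
Qed.

Lemma derive1n_add u v n : cinf u -> cinf v ->
  (u \+ v)^`(n) = u^`(n) \+ v^`(n).
Proof.
elim: n u v => [//|n IH] u v cu cv; rewrite !derive1nSr.
rewrite (derive1_add (fun x => @cinf_derivable u x cu)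
  (fun x => @cinf_derivable v x cv)).
exact: IH (cinf_derive1 cu) (cinf_derive1 cv).
Qed.

Lemma derive1n_opp u n : cinf u -> (\- u)^`(n) = \- u^`(n).
Proof.
elim: n u => [//|n IH] u cu; rewrite !derive1nSr -IH; last exact: cinf_derive1.
congr (_^`(n)); apply/funext => x.
by rewrite [LHS]derive1E (deriveN (cinf_derivable cu)) -derive1E.
Qed.

Lemma cinf_oppr u : cinf u -> cinf (u \o -%R).
Proof.
move=> cu n; elim: n u cu => [|n IH] u cu x.
  apply/derivable1_diffP; apply: differentiable_comp.
    exact/derivable1_diffP/derivable_opp.
  exact/derivable1_diffP/cinf_derivable.
rewrite derive1nSr (derive1_opp_arg (fun y => @cinf_derivable u y cu)).
exact: IH (cinfN (cinf_derive1 cu)) x.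
Qed.

Lemma derive1n_oppr_normr u n x : cinf u ->
  `|(u \o -%R)^`(n) x| = `|u^`(n) (- x)|.
Proof.
elim: n u => [//|n IH] u cu; rewrite !derive1nSr.
rewrite (derive1_opp_arg (fun y => @cinf_derivable u y cu)).
rewrite (IH (\- u^`()) (cinfN (cinf_derive1 cu))).
by rewrite (derive1n_opp _ (cinf_derive1 cu)) normrN.
Qed.

Lemma derive1n_mul_bound u v (m : nat) (A B x : R) : cinf u -> cinf v ->
  (forall k, (k <= m)%N -> `|u^`(k) x| <= A) ->
  (forall k, (k <= m)%N -> `|v^`(k) x| <= B) ->
  `|(u \* v)^`(m) x| <= 2 ^+ m * A * B.
Proof.
elim: m u v => [|m IH] u v cu cv hu hv.
  by rewrite expr0 mul1r /= normrM ler_pM//; [exact: (hu 0%N)|exact: (hv 0%N)].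
rewrite derive1nSr (derive1_mul (fun y => @cinf_derivable u y cu)
  (fun y => @cinf_derivable v y cv)).
have cu' := cinf_derive1 cu; have cv' := cinf_derive1 cv.
rewrite (derive1n_add _ (cinfM cu' cv) (cinfM cu cv')).
apply: (le_trans (ler_normD _ _)); rewrite exprS.
have -> : 2 * 2 ^+ m * A * B = 2 ^+ m * A * B + 2 ^+ m * A * B by ring.
apply: lerD.
  apply: (IH _ _ cu' cv) => k km; first by rewrite -derive1nSr; exact: hu.
  by apply: hv; exact: leqW.
apply: (IH _ _ cu cv') => k km; last by rewrite -derive1nSr; exact: hv.
by apply: hu; exact: leqW.
Qed.

Lemma cinf_periodic_bounded u (T : R) (n : nat) : 0 < T -> cinf u ->
  u \o +%R T = u -> exists M, forall x, `|u^`(n) x| <= M.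
Proof.
move=> T0 cu pu.
have {pu} : u^`(n) \o +%R T = u^`(n).
  elim: n u pu {cu} => [//|n IH] u pu; rewrite derive1nSr; apply: IH.
  by rewrite -derive1_shift pu.
have {cu} := cinf_continuous (@cinf_derive1n _ n cu).
move: (u^`(n)) => {u}w cw pw.
have [c _ hc] : exists2 c, c \in `[0, T] & forall t, t \in `[0, T] -> `|w t| <= `|w c|.
  apply: EVT_max; first exact: ltW.
  apply: continuous_subspaceT => x; apply: continuous_comp; [exact: cw|].
  exact: norm_continuous.
exists `|w c| => x.
have pwn (k : nat) y : w (y + k%:R * T) = w y.
  elim: k => [|k IH]; first by rewrite mul0r addr0.
  by rewrite -IH -[in RHS]pw /= -natr1; congr w; ring.
have pwz (k : int) y : w (y + k%:~R * T) = w y.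
  case: k => k; first exact: pwn.
  by rewrite NegzE mulrNz mulNr -pmulrn -(pwn k.+1 (y - _)) subrK.
pose k := Num.floor (x / T).
have := pwz (- k) x; rewrite mulrNz mulNr => <-; apply: hc.
rewrite in_itv /= subr_ge0 lerBlDr -ler_pdivlMr// floor_le /=.
have := floorD1_gt (x / T); rewrite ltr_pdivrMr// intrD => /ltW.
by rewrite mulrDl mul1r addrC.
Qed.

Lemma cinf_cos_sin (a b : R) : cinf (fun x => a * cos x + b * sin x).
Proof.
have dc (x : R) : derivable (@cos R) x 1 by case: (is_derive_cos x) => h _; exact: h.
have ds (x : R) : derivable (@sin R) x 1 by case: (is_derive_sin x) => h _; exact: h.
have dac c (x : R) : derivable (fun x => c * cos x) x 1.
  exact: derivableM (derivable_cst _ _ _) (dc x).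
have das c (x : R) : derivable (fun x => c * sin x) x 1.
  exact: derivableM (derivable_cst _ _ _) (ds x).
move=> n; elim: n a b => [|n IH] a b x; first exact: derivableD (dac a x) (das b x).
rewrite derive1nSr.
suff -> : (fun x => a * cos x + b * sin x)^`() = (fun x => b * cos x + - a * sin x).
  exact: IH.
rewrite [LHS](derive1_add (dac a) (das b)); apply/funext => y /=.
rewrite (derive1Ml _ (dc y)) (derive1Ml _ (ds y)) !derive1E.
have [_ ->] := is_derive_cos y; have [_ ->] := is_derive_sin y.
by rewrite mulrN mulNr addrC.
Qed.

Lemma cinf_cos : cinf (@cos R).
Proof.
have -> : @cos R = (fun x => 1 * cos x + 0 * sin x).
  by apply/funext => x; rewrite mul1r mul0r addr0.
exact: cinf_cos_sin.
Qed.

Lemma cinf_sin : cinf (@sin R).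
Proof.
have -> : @sin R = (fun x => 0 * cos x + 1 * sin x).
  by apply/funext => x; rewrite mul1r mul0r add0r.
exact: cinf_cos_sin.
Qed.

End RealSmooth.

(* A function on the circle is differentiated with respect to the angle, its
   real and imaginary parts separately. *)

Definition re_on {R : realType} (f : circle R -> R[i]) (theta : R) : R :=
  complex.Re (f (cis theta)).
Definition im_on {R : realType} (f : circle R -> R[i]) (theta : R) : R :=
  complex.Im (f (cis theta)).

(* Meant for open [U]; the values of [f] outside [U] are then irrelevant. *)
Definition smooth_on {R : realType} (U : set (circle R)) (f : circle R -> R[i])
    : Prop :=
  forall (n : nat) (theta : R), U (cis theta) ->
    derivable (re_on f)^`(n) theta 1 /\ derivable (im_on f)^`(n) theta 1.

Definition smooth {R : realType} : {pred circle R -> R[i]} :=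
  fun f => `[< smooth_on setT f >].

Section SmoothClosed.
Context {R : realType}.
Implicit Types f g : circle R -> R[i].

Lemma smoothP f : reflect (cinf (re_on f) /\ cinf (im_on f)) (f \in smooth).
Proof.
apply: (iffP (asboolP _)) => [h|[h1 h2] n x _].
  by split=> n x; have [h1 h2] := h n x I; [exact: h1|exact: h2].
by split; [exact: h1|exact: h2].
Qed.

Lemma re_onD f g : re_on (f + g) = re_on f \+ re_on g.
Proof.
apply/funext => x; rewrite /re_on /im_on -[(f + g) _]/(f _ + g _) /=.
by case: (f _) (g _) => [a b] [c d].
Qed.

Lemma im_onD f g : im_on (f + g) = im_on f \+ im_on g.
Proof.
apply/funext => x; rewrite /re_on /im_on -[(f + g) _]/(f _ + g _) /=.
by case: (f _) (g _) => [a b] [c d].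
Qed.

Lemma re_onM f g :
  re_on (f * g) = (re_on f \* re_on g) \+ (\- (im_on f \* im_on g)).
Proof.
apply/funext => x; rewrite /re_on /im_on -[(f * g) _]/(f _ * g _) /=.
by case: (f _) (g _) => [a b] [c d].
Qed.

Lemma im_onM f g :
  im_on (f * g) = (re_on f \* im_on g) \+ (im_on f \* re_on g).
Proof.
apply/funext => x; rewrite /re_on /im_on -[(f * g) _]/(f _ * g _) /=.
by case: (f _) (g _) => [a b] [c d].
Qed.

Lemma smooth_cst (c : R[i]) : (cst c : circle R -> R[i]) \in smooth.
Proof.
apply/smoothP; split.
  exact: (@cinf_cst _ (complex.Re c)).
exact: (@cinf_cst _ (complex.Im c)).
Qed.

Lemma smoothD f g : f \in smooth -> g \in smooth -> f + g \in smooth.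
Proof.
move=> /smoothP[f1 f2] /smoothP[g1 g2]; apply/smoothP.
by rewrite re_onD im_onD; split; apply: cinfD.
Qed.

Lemma smoothM f g : f \in smooth -> g \in smooth -> f * g \in smooth.
Proof.
move=> /smoothP[f1 f2] /smoothP[g1 g2]; apply/smoothP.
rewrite re_onM im_onM; split; apply: cinfD.
- exact: cinfM f1 g1.
- exact/cinfN/(cinfM f2 g2).
- exact: cinfM f1 g2.
- exact: cinfM f2 g1.
Qed.

Lemma smooth_scale (c : R[i]) f : f \in smooth -> c *: f \in smooth.
Proof. exact: smoothM (smooth_cst c). Qed.

Lemma smooth_subring : subring_closed (@smooth R).
Proof.
split; first exact: smooth_cst.
  move=> f g sf sg; have -> : f - g = f + (-1) *: g by rewrite scaleN1r.
  exact: smoothD sf (smooth_scale (-1) sg).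
exact: smoothM.
Qed.

Lemma smooth_subsemimod : subsemimod_closed (@smooth R).
Proof.
split; first by split; [exact: (smooth_cst 0)|exact: smoothD].
exact: smooth_scale.
Qed.

HB.instance Definition _ :=
  GRing.isSubringClosed.Build _ (@smooth R) smooth_subring.
HB.instance Definition _ :=
  GRing.isSubmodClosed.Build _ _ (@smooth R) smooth_subsemimod.

End SmoothClosed.

Section SmoothFun.
Context (R : realType).

Record smoothfun := SmoothFun {
  smoothfun_val :> circle R -> R[i];
  smoothfunP : smoothfun_val \in smooth }.

HB.instance Definition _ := [isSub of smoothfun for smoothfun_val].
HB.instance Definition _ := [Choice of smoothfun by <:].
HB.instance Definition _ := [SubChoice_isSubComNzRing of smoothfun by <:].
HB.instance Definition _ := [SubZmodule_isSubLmodule of smoothfun by <:].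

End SmoothFun.

Section SmoothOps.
Context {R : realType}.
Implicit Types f g : smoothfun R.

Lemma smooth_flip (f : circle R -> R[i]) :
  f \in smooth -> (fun t => f (circleV t)) \in smooth.
Proof.
move=> /smoothP[h1 h2]; apply/smoothP; split.
  have -> : re_on (fun t => f (circleV t)) = re_on f \o -%R.
    by apply/funext => x; rewrite /re_on circleV_cis.
  exact: cinf_oppr.
have -> : im_on (fun t => f (circleV t)) = im_on f \o -%R.
  by apply/funext => x; rewrite /im_on circleV_cis.
exact: cinf_oppr.
Qed.

Lemma smoothX (f : circle R -> R[i]) (n : nat) :
  f \in smooth -> (fun t => f t ^+ n) \in smooth.
Proof.
move=> sf; elim: n => [|n IH]; first exact: (smooth_cst 1).
have -> : (fun t => f t ^+ n.+1) = f * (fun t => f t ^+ n).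
  by apply/funext => t; rewrite exprS.
exact: smoothM sf IH.
Qed.

Lemma smooth_char (n : int) :
  (fun t : circle R => val t ^ n : R[i]) \in smooth.
Proof.
have s1 : (fun t : circle R => val t) \in smooth.
  apply/smoothP; split; [exact: cinf_cos|exact: cinf_sin].
case: n => n; first exact: smoothX n s1.
have -> : (fun t : circle R => val t ^ Negz n : R[i]) =
    (fun t => (val (circleV t)) ^+ n.+1).
  by apply/funext => t; rewrite [RHS]exprVn.
exact: smoothX n.+1 (smooth_flip s1).
Qed.

Definition char (n : int) : smoothfun R := SmoothFun (smooth_char n).

Lemma charD (m n : int) : char (m + n) = char m * char n.
Proof.
apply: val_inj; apply/funext => t.
exact: expfzDr (circle_neq0 t).
Qed.

Definition flip f : smoothfun R := SmoothFun (smooth_flip (smoothfunP f)).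

End SmoothOps.

Section Distributions.
Context (R : realType).
Implicit Types f g : smoothfun R.

Definition deriv_bounded (m : nat) (B : R) f : Prop :=
  forall (k : nat) (theta : R), (k <= m)%N ->
    `|(re_on f)^`(k) theta| <= B /\ `|(im_on f)^`(k) theta| <= B.

(* Continuity for the usual Frechet topology of [smoothfun R], given by the
   suprema of the derivatives. *)
Definition dist_continuous (a : smoothfun R -> R[i]) : Prop :=
  exists (m : nat) (c : R), forall f (B : R),
    deriv_bounded m B f -> Normc.normc (a f) <= c * B.

Record distr := Distr {
  distr_val :> {scalar smoothfun R};
  distr_continuous : dist_continuous distr_val }.

Lemma smoothfun_bounded m g : exists B, deriv_bounded m B g.
Proof.
have /smoothP[g1 g2] := smoothfunP g.
have T0 : 0 < pi + pi :> R by apply: addr_gt0; exact: pi_gt0.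
have cisT (x : R) : cis (pi + pi + x) = cis x.
  by apply: val_inj; rewrite /= addrC addrA !cosDpi !sinDpi !opprK.
have p1 : re_on g \o +%R (pi + pi) = re_on g.
  by apply/funext => x; rewrite /re_on /= cisT.
have p2 : im_on g \o +%R (pi + pi) = im_on g.
  by apply/funext => x; rewrite /im_on /= cisT.
elim: m => [|m [B IH]].
  have [A hA] := cinf_periodic_bounded 0 T0 g1 p1.
  have [B hB] := cinf_periodic_bounded 0 T0 g2 p2.
  exists (Num.max A B) => k x; rewrite leqn0 => /eqP ->.
  by split; [apply: le_trans (hA x) _|apply: le_trans (hB x) _];
    rewrite le_max lexx ?orbT.
have [A' hA] := cinf_periodic_bounded m.+1 T0 g1 p1.
have [B' hB] := cinf_periodic_bounded m.+1 T0 g2 p2.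
exists (Num.max B (Num.max A' B')) => k x.
rewrite leq_eqVlt => /orP[/eqP ->|km].
  by split; [apply: le_trans (hA x) _|apply: le_trans (hB x) _];
    rewrite !le_max lexx !orbT.
have [h1 h2] := IH k x km.
by split; [apply: le_trans h1 _|apply: le_trans h2 _]; rewrite le_max lexx.
Qed.

Lemma deriv_boundedM m (A B : R) g f : deriv_bounded m A g ->
  deriv_bounded m B f -> deriv_bounded m (2 * 2 ^+ m * A * B) (g * f).
Proof.
move=> hg hf k x km.
have /smoothP[g1 g2] := smoothfunP g; have /smoothP[f1 f2] := smoothfunP f.
have A0 : 0 <= A by apply: le_trans (hg 0%N x (leq0n m)).1.
have B0 : 0 <= B by apply: le_trans (hf 0%N x (leq0n m)).1.
have km2 : 2 ^+ k * A * B + 2 ^+ k * A * B <= 2 * 2 ^+ m * A * B.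
  have -> : 2 * 2 ^+ m * A * B = 2 ^+ m * A * B + 2 ^+ m * A * B by ring.
  have h : 2 ^+ k * A * B <= 2 ^+ m * A * B.
    rewrite ler_wpM2r// ler_wpM2r// ler_weXn2l//.
    by rewrite ler1n.
  exact: (lerD h h).
have mulb (u v : R -> R) : cinf u -> cinf v ->
    (forall j, (j <= m)%N -> `|u^`(j) x| <= A) ->
    (forall j, (j <= m)%N -> `|v^`(j) x| <= B) ->
    `|(u \* v)^`(k) x| <= 2 ^+ k * A * B.
  move=> cu cv hu hv; apply: (derive1n_mul_bound cu cv) => j jk.
    exact: hu (leq_trans jk km).
  exact: hv (leq_trans jk km).
have gr j (jm : (j <= m)%N) := (hg j x jm).1.
have gi j (jm : (j <= m)%N) := (hg j x jm).2.
have fr j (jm : (j <= m)%N) := (hf j x jm).1.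
have fi j (jm : (j <= m)%N) := (hf j x jm).2.
rewrite re_onM im_onM; split; apply: le_trans km2.
  rewrite (derive1n_add _ (cinfM g1 f1) (cinfN (cinfM g2 f2))).
  rewrite (derive1n_opp _ (cinfM g2 f2)).
  apply: (le_trans (ler_normD _ _)); rewrite normrN.
  exact: lerD (mulb _ _ g1 f1 gr fr) (mulb _ _ g2 f2 gi fi).
rewrite (derive1n_add _ (cinfM g1 f2) (cinfM g2 f1)).
apply: (le_trans (ler_normD _ _)).
exact: lerD (mulb _ _ g1 f2 gr fi) (mulb _ _ g2 f1 gi fr).
Qed.

Lemma deriv_bounded_flip m (B : R) f :
  deriv_bounded m B f -> deriv_bounded m B (flip f).
Proof.
move=> hf k x km; have /smoothP[f1 f2] := smoothfunP f.
have -> : re_on (flip f) = re_on f \o -%R.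
  by apply/funext => y; rewrite /re_on /= circleV_cis.
have -> : im_on (flip f) = im_on f \o -%R.
  by apply/funext => y; rewrite /im_on /= circleV_cis.
rewrite (derive1n_oppr_normr _ _ f1) (derive1n_oppr_normr _ _ f2).
exact: hf.
Qed.

Section Mul.
Context (g : smoothfun R) (b : distr).

Definition dmul_val (f : smoothfun R) : R[i] := b (g * f).

Lemma dmul_is_linear : scalar dmul_val.
Proof.
move=> c u v; rewrite /dmul_val mulrDr linearD /=; congr (_ + _).
have -> : g * (c *: u) = c *: (g * u).
  by apply: val_inj; apply/funext => t; exact: (mulrCA (g t) c (u t)).
exact: linearZ.
Qed.

HB.instance Definition _ :=
  GRing.isLinear.Build R[i] (smoothfun R) R[i] *%R dmul_val dmul_is_linear.

Lemma dmul_continuous : dist_continuous dmul_val.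
Proof.
have [m [c hc]] := distr_continuous b.
have [A hA] := smoothfun_bounded m g.
exists m, (c * (2 * 2 ^+ m * A)) => f B hB.
by rewrite -mulrA; exact: hc (deriv_boundedM hA hB).
Qed.

Definition dmul : distr := Distr dmul_continuous.

End Mul.

Section Tilde.
Context (a : distr).

Definition dtilde_val (f : smoothfun R) : R[i] := a (flip f).

Lemma dtilde_is_linear : scalar dtilde_val.
Proof.
move=> c u v; rewrite /dtilde_val.
have -> : flip (c *: u + v) = c *: flip u + flip v by exact: val_inj.
by rewrite linearD linearZ.
Qed.

HB.instance Definition _ :=
  GRing.isLinear.Build R[i] (smoothfun R) R[i] *%R dtilde_val dtilde_is_linear.

Lemma dtilde_continuous : dist_continuous dtilde_val.
Proof.
have [m [c hc]] := distr_continuous a.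
by exists m, c => f B hB; exact: hc (deriv_bounded_flip hB).
Qed.

Definition dtilde : distr := Distr dtilde_continuous.

End Tilde.

Definition fcoef (a : distr) (n : int) : R[i] := a (char (- n)).

Lemma fcoef_tilde (a : distr) (n : int) : fcoef (dtilde a) n = fcoef a (- n).
Proof.
congr (a _); apply: val_inj; apply/funext => t /=.
by rewrite exprz_inv.
Qed.

Lemma fcoef_dmul_char (m : int) (a : distr) (n : int) :
  fcoef (dmul (char m) a) n = fcoef a (n - m).
Proof. by rewrite /fcoef /= /dmul_val -charD opprB. Qed.

End Distributions.

Section SmoothPart.
Context (R : realType).
Implicit Types (K L : set (circle R)) (a b : distr R).

Definition mean (h : circle R -> R[i]) : R[i] :=
  ((2 * pi)^-1)%:C *
  (\int[lebesgue_measure]_(theta in `[0, 2 * pi]) re_on h theta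
   +i* \int[lebesgue_measure]_(theta in `[0, 2 * pi]) im_on h theta).

Definition vanishes_near K (f : smoothfun R) : Prop :=
  exists U : set (circle R),
    [/\ open U, K `<=` U & forall t, U t -> f t = 0].

Definition smooth_part K a (s : circle R -> R[i]) : Prop :=
  smooth_on (~` K) s /\
  forall f, vanishes_near K f -> a f = mean (fun t => s t * f t).

Definition smooth_off K a : Prop := exists s, smooth_part K a s.

(* [c] is the product of [a] in D'(K) and [b] in D'(L), K and L disjoint.
   Since [fb] vanishes near [L], [sb t * fb t] is 0 on [L] whatever the values
   of [sb] there; likewise for [sa t * fa t]. *)
Definition dist_product K L a b (c : distr R) : Prop :=
  exists (sa sb : circle R -> R[i]) (fa fb u v : smoothfun R),
    [/\ smooth_part K a sa /\ smooth_part L b sb,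
        vanishes_near K fa /\ vanishes_near L fb,
        fa + fb = 1,
        (forall t, u t = sb t * fb t) /\ (forall t, v t = sa t * fa t) &
        forall f, c f = dmul u a f + dmul v b f].

Definition dist_even a : Prop := forall f, dtilde a f = a f.

Definition is_sigma (s : distr R) : Prop :=
  forall n : int, fcoef s n = (Num.sg n)%:~R.

Definition dist_plus a : Prop := forall n : int, n < 0 -> fcoef a n = 0.
Definition dist_minus a : Prop := forall n : int, 0 < n -> fcoef a n = 0.

Definition plus_inverse a b : Prop :=
  [/\ dist_plus a, dist_plus b &
      forall n : nat,
        \sum_(k < n.+1) fcoef a k%:Z * fcoef b (n%:Z - k%:Z) = (n == 0)%:R].

Definition minus_inverse a b : Prop :=
  [/\ dist_minus a, dist_minus b &
      forall n : nat,
        \sum_(k < n.+1) fcoef a (- k%:Z) * fcoef b (k%:Z - n%:Z) = (n == 0)%:R].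

Definition unit_plus_off K a : Prop :=
  smooth_off K a /\ exists2 b, smooth_off K b & plus_inverse a b.

End SmoothPart.

Section Operators.
Context (R : realType).
Implicit Types (mu rho : R) (a : distr R) (N : nat).

(* An operator is given by its infinite matrix. *)
Definition imx := nat -> nat -> R[i].
Implicit Types A B : imx.

(* In the products used below, only finitely many terms are nonzero. *)
Definition imx_mul A B : imx :=
  fun j k => limn (series (fun l => A j l * B l k)).

Local Notation "A ** B" := (imx_mul A B) (at level 40, left associativity).

Definition l2norm mu (x : nat -> R[i]) : \bar R :=
  ((\sum_(0 <= n <oo) ((1 + n%:R) `^ (2 * mu) * Normc.normc (x n) ^+ 2)%:E)
    `^ 2^-1)%E.

Definition op_bounded mu1 mu2 (M : R) A : Prop :=
  forall x, (l2norm mu1 x < +oo)%E ->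
    exists2 y : nat -> R[i],
      forall j, series (fun k => A j k * x k) @ \oo --> y j &
      (l2norm mu2 y <= M%:E * l2norm mu1 x)%E.

Definition op_bigO mu1 mu2 rho (C : nat -> imx) : Prop :=
  exists M : R, \forall N \near \oo,
    op_bounded mu1 mu2 (M * N%:R `^ rho) (C N).

Record op2 := Op2 { ul : imx; ur : imx; dl : imx; dr : imx }.

Definition op2_diag A B : op2 := Op2 A 0 0 B.
Definition op2_opp (X : op2) : op2 :=
  Op2 (- ul X) (- ur X) (- dl X) (- dr X).
Definition op2_sub (X Y : op2) : op2 :=
  Op2 (ul X - ul Y) (ur X - ur Y) (dl X - dl Y) (dr X - dr Y).

Definition op2_bigO mu1 mu2 rho0 rho1 rho2 (C : nat -> op2) : Prop :=
  [/\ op_bigO mu1 mu2 rho0 (ul \o C), op_bigO mu1 mu2 rho1 (ur \o C),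
      op_bigO mu1 mu2 rho2 (dl \o C) & op_bigO mu1 mu2 rho0 (dr \o C)].

Definition toeplitz a : imx := fun j k => fcoef a (j%:Z - k%:Z).
Definition hankel a : imx := fun j k => fcoef a (j + k).+1%:Z.

Definition projP N : imx := fun j k => ((j < N)%N && (j == k))%:R.
Definition flipW N : imx := fun j k => ((j + k).+1 == N)%:R.

Definition toeplitz_mx N a : 'M[R[i]]_N :=
  \matrix_(j, k) fcoef a (j%:Z - k%:Z).

(* An N x N matrix as an operator on the image of [projP N]. *)
Definition imx_of_mx N (A : 'M[R[i]]_N) : imx := fun j k =>
  if insub j is Some j' then if insub k is Some k' then A j' k' else 0 else 0.

Definition toeplitz_inv N a : imx := imx_of_mx (invmx (toeplitz_mx N a)).

Local Notation T := toeplitz.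
Local Notation H := hankel.
Local Notation P := projP.
Local Notation W := flipW.
Local Notation Tinv := toeplitz_inv.
Local Notation tl := dtilde.

Definition R_N a N : op2 :=
  Op2 (Tinv N a)              (Tinv N a ** W N)
      (Tinv N (tl a) ** W N)  (Tinv N (tl a)).

Definition RH_N a N : op2 :=
  Op2 (Tinv N a ** P N ** H a)       (Tinv N a ** W N ** H (tl a))
      (Tinv N (tl a) ** W N ** H a)  (Tinv N (tl a) ** P N ** H (tl a)).

Definition HR_N a N : op2 :=
  Op2 (H (tl a) ** P N ** Tinv N a)  (H (tl a) ** W N ** Tinv N (tl a))
      (H a ** W N ** Tinv N a)       (H a ** P N ** Tinv N (tl a)).

Definition HRH_N a N : op2 :=
  op2_sub
    (Op2 (H (tl a) ** P N ** Tinv N a ** P N ** H a)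
         (H (tl a) ** P N ** Tinv N a ** W N ** H (tl a))
         (H a ** P N ** Tinv N (tl a) ** W N ** H a)
         (H a ** P N ** Tinv N (tl a) ** P N ** H (tl a)))
    (Op2 (T (tl a))                      (H (dmul (char (- N%:Z)) (tl a)))
         (H (dmul (char (- N%:Z)) a))    (T a)).

(* [api] and [ami] are the inverses of [ap] in D'_+ and of [am] in D'_-; the
   conditions depend only on their Fourier coefficients, which are determined.
   [tl api] is the inverse of [tl ap], and [tl ami] that of [tl am]. *)
Definition R_convergence a (ap am : distr R) rho0 rho1 rho2 : Prop :=
  exists api ami : distr R,
  [/\ plus_inverse ap api, minus_inverse am ami,
      \forall N \near \oo, toeplitz_mx N a \in unitmx &
  exists mu1 mu2 : R,
  [/\ 0 <= mu1, mu2 <= 0 &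
  let near_diag (X : nat -> op2) (D : op2) :=
    op2_bigO mu1 mu2 rho0 rho1 rho2 (fun N => op2_sub (X N) D) in
  [/\ near_diag (R_N a) (op2_diag (T api ** T ami) (T (tl ami) ** T (tl api))),
      near_diag (RH_N a) (op2_diag (T api ** H ap) (T (tl ami) ** H (tl am))),
      near_diag (HR_N a) (op2_diag (H (tl am) ** T ami) (H ap ** T (tl api))) &
      near_diag (HRH_N a)
        (op2_opp (op2_diag (T (tl am) ** T (tl ap)) (T ap ** T am)))]]].

End Operators.

(* Main.v *)
Require Import Defs.
From HB Require Import structures.
From mathcomp Require Import all_boot all_order all_algebra.
From mathcomp Require Import complex.
From mathcomp Require Import all_classical all_reals all_analysis.
From mathcomp Require Import ring lra zify.

(** Write b = a_+(-1), and let A, B be the N x N Toeplitz matrices of a and of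
a sigma, N even. Since sigma (1 - t) = 1 + t, the coefficients of a sigma
satisfy b_k - b_(k-1) = a_k + a_(k-1), so B is, up to unit triangular factors, a
rank one perturbation of A:
  det B / det A = 1 - <w, A^-1 v>,  v_j = (-1)^j,  w_k = sum of a_i over |i| <= k.
Multiplying by cutoffs psi, psi2 equal to 1 at 1 and at -1 and vanishing near K,
one writes w and A v - b^2 v, up to multiples of v or of the vector of ones and
up to errors beyond all orders, through A, the Hankel matrix H(a), T(a_+)^t and
rapidly decreasing vectors (the tails of the Fourier series of psi, psi a_+, ...).
An algebraic identity then turns <w, A^-1 v> into an explicit main term plus
pairings of rapidly decreasing vectors with H A^-1 H, H A^-1, A^-1 H and A^-1,
possibly with a flip in between; R-convergence, read off entrywise, says that
these are what they would be if A^-1 were T(a_+^-1) T(a_-^-1). The main term is an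
alternating sum, evaluated by Fourier inversion at 1 and at -1. *)

Set Implicit Arguments.
Unset Strict Implicit.
Unset Printing Implicit Defensive.

Import Order.TTheory GRing.Theory Num.Theory numFieldNormedType.Exports.

Local Open Scope classical_set_scope.
Local Open Scope ring_scope.

Local Notation "u ^` ( n )" := (derive1n n u) : ring_scope.
Local Notation "u ^` ()" := (derive1 u) : ring_scope.

(** * Smooth functions and cutoffs *)

(** The obstacle is that neither v nor w decays, while R-convergence controls A^-1 only between
    weighted spaces, hence entrywise only up to polynomial factors in the indices. So <w, A^-1 v> is
    never estimated directly: the non-decaying vectors are traded, by an exact identity, for tails
    of Fourier series, against which any polynomial loss in the indices is harmless. With b_1 =
    a_+(1), the vector w is 2 x + b_1^2 times the vector of ones, where x holds half of the
    symmetric partial sums of a, recentred by their regularized limit. The flip commutes with A,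
    fixes the ones and, the size being even, negates v; so the ones contribute nothing. The main
    term is (b_1 - b)/2 up to small errors, and 1 + (2/b)(b_1 - b)/2 = b_1/b. The recurrence
    determines the coefficients of a sigma only up to an additive constant. It is fixed by parity: a
    sigma tested on an even cutoff at 1 gives 0, and the same number is the coefficient of index
    0. *)

Section LocalSmooth.
Context {R : realType}.
Implicit Types (u v : R -> R) (U : set R).

(* [n.+1] derivatives on [U]. *)
Fixpoint Cn (n : nat) U u : Prop :=
  (forall x, U x -> derivable u x 1) /\
  (if n is n'.+1 then Cn n' U u^`() else True).

Lemma CnP U u : (forall n, Cn n U u) <->
  (forall n x, U x -> derivable u^`(n) x 1).
Proof.
split=> [+ n|+ n]; elim: n u => [|n IH] u h.
- by case: (h 0%N).
- rewrite derive1nSr; apply: IH => m; by case: (h m.+1).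
- by split=> // x Ux; exact: (h 0%N).
- split=> [x Ux|]; first exact: (h 0%N).
  by apply: IH => m x Ux; rewrite -derive1nSr; exact: h.
Qed.

Lemma Cn_derivable n U u x : Cn n U u -> U x -> derivable u x 1.
Proof. by case: n => [|n] [h _]; exact: h. Qed.

Lemma eq_on_near U u v x : open U -> {in U, u =1 v} -> U x ->
  \near x, u x = v x.
Proof.
move=> oU uv Ux; have := open_nbhs_nbhs (conj oU Ux).
by apply: filterS => y Uy; apply: uv; rewrite inE.
Qed.

Lemma eq_on_derive1 U u v : open U -> {in U, u =1 v} -> {in U, u^`() =1 v^`()}.
Proof.
move=> oU uv x; rewrite inE => Ux; rewrite !derive1E; apply: near_eq_derive.
exact: eq_on_near Ux.
Qed.

Lemma eq_Cn n U u v : open U -> {in U, u =1 v} -> Cn n U u -> Cn n U v.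
Proof.
move=> oU; have eqd u' v' : {in U, u' =1 v'} -> (forall x, U x -> derivable u' x 1) ->
    forall x, U x -> derivable v' x 1.
  move=> uv du x Ux; apply: near_eq_derivable (du x Ux).
  exact: eq_on_near oU uv Ux.
elim: n u v => [|n IH] u v uv [du cu].
  by split; [exact: eqd uv du|exact: I].
split; first exact: eqd uv du.
apply: IH cu; exact: eq_on_derive1.
Qed.

Lemma CnW n U u : Cn n.+1 U u -> Cn n U u.
Proof.
elim: n u => [|n IH] u [du cu]; split.
- exact: du.
- exact: I.
- exact: du.
- exact: IH cu.
Qed.

Lemma Cn_cst n U (c : R) : Cn n U (cst c).
Proof. by apply: (CnP _ _).2 => m x _; exact: cinf_cst. Qed.

Lemma CnD n U u v : open U -> Cn n U u -> Cn n U v -> Cn n U (u \+ v).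
Proof.
move=> oU; elim: n u v => [|n IH] u v cu cv.
  by split=> // x Ux; apply: derivableD; [exact: Cn_derivable cu Ux|exact: Cn_derivable cv Ux].
split=> [x Ux|]; first by apply: derivableD; [exact: Cn_derivable cu Ux|exact: Cn_derivable cv Ux].
apply: (@eq_Cn n U (u^`() \+ v^`())) => //; last by apply: IH; [case: cu|case: cv].
move=> x; rewrite inE => Ux; rewrite /= !derive1E [RHS]deriveD//.
  exact: Cn_derivable cu Ux.
exact: Cn_derivable cv Ux.
Qed.

Lemma CnM n U u v : open U -> Cn n U u -> Cn n U v -> Cn n U (u \* v).
Proof.
move=> oU; elim: n u v => [|n IH] u v cu cv.
  by split=> // x Ux; apply: derivableM; [exact: Cn_derivable cu Ux|exact: Cn_derivable cv Ux].
split=> [x Ux|]; first by apply: derivableM; [exact: Cn_derivable cu Ux|exact: Cn_derivable cv Ux].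
apply: (@eq_Cn n U ((u^`() \* v) \+ (u \* v^`()))) => //.
  move=> x; rewrite inE => Ux; rewrite /= !derive1E [RHS](deriveM (Cn_derivable cu Ux) (Cn_derivable cv Ux)).
  by rewrite addrC /GRing.scale /= [v x * _]mulrC.
apply: CnD => //; apply: IH; [by case: cu|exact: CnW|exact: CnW|by case: cv].
Qed.

Lemma Cn_comp n u v : Cn n setT u -> Cn n setT v -> Cn n setT (u \o v).
Proof.
elim: n u v => [|n IH] u v cu cv.
  split=> // x _; apply/derivable1_diffP; apply: differentiable_comp.
    exact/derivable1_diffP/(Cn_derivable cv).
  exact/derivable1_diffP/(Cn_derivable cu).
have du x : derivable u x 1 by exact: Cn_derivable cu _.
have dv x : derivable v x 1 by exact: Cn_derivable cv _.
split=> [x _|].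
  by apply/derivable1_diffP; apply: differentiable_comp; exact/derivable1_diffP.
have -> : (u \o v)^`() = (u^`() \o v) \* v^`().
  by apply/funext => x; rewrite /= derive1_comp.
apply: CnM; [exact: openT|apply: IH; [by case: cu|exact: CnW]|by case: cv].
Qed.

Lemma cinf_comp u v : cinf u -> cinf v -> cinf (u \o v).
Proof.
move=> cu cv n x; apply: ((CnP setT _).1 _) => // m.
by apply: Cn_comp; apply: (CnP _ _).2 => k y _; [exact: cu|exact: cv].
Qed.

End LocalSmooth.

(** * A smooth function that is flat at the origin *)

Section FlatExp.
Context {R : realType}.

(* The functions x^(-m) exp(-1/x) are closed, up to linear combinations, under
   differentiation, with value 0 for x <= 0. *)
Definition flat_exp (m : nat) (x : R) : R :=
  if 0 < x then x^-1 ^+ m * expR (- x^-1) else 0.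

(** Quadratic smallness at 0 is what makes the derivative there exist and vanish. The constant comes
    from exp y >= (1 + y/q)^q >= (y/q)^q with q = m + 2 and y = 1/x. *)
Lemma flat_exp_le m (x : R) : `|flat_exp m x| <= (m.+2)%:R ^+ m.+2 * x ^+ 2.
Proof.
rewrite /flat_exp; case: ifPn => [x0|_]; last first.
  by rewrite normr0; apply: mulr_ge0; [exact: exprn_ge0|exact: sqr_ge0].
have ex0 : 0 < expR (- x^-1) by exact: expR_gt0.
have xi0 : 0 < x^-1 by rewrite invr_gt0.
rewrite ger0_norm; last by rewrite mulr_ge0 ?exprn_ge0// ltW.
rewrite expRN.
have k0 : 0 < (m.+2)%:R :> R by [].
have h : (x^-1 / m.+2%:R) ^+ m.+2 <= expR x^-1.
  have -> : expR x^-1 = expR (x^-1 / m.+2%:R) ^+ m.+2.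
    by rewrite -expRM_natl; congr expR; rewrite mulrC divfK ?pnatr_eq0.
  rewrite lerXn2r ?nnegrE ?expR_ge0//; first by rewrite divr_ge0// ltW.
  apply: le_trans (expR_ge1Dx _); rewrite lerDr//.
rewrite ler_pdivrMr ?expR_gt0//.
apply: (le_trans _ (ler_wpM2l _ h)); last by rewrite mulr_ge0 ?exprn_ge0// ltW.
rewrite expr_div_n !exprVn.
rewrite -[m.+2 in X in _ <= _ * (X / _)]addn2 exprD le_eqVlt; apply/orP; left; apply/eqP.
field; rewrite ?expf_neq0 ?pnatr_eq0 ?gt_eqF//.
Qed.

Lemma flat_exp_derive m (x : R) :
  is_derive x 1 (flat_exp m) (flat_exp m.+2 x + (- m%:R) * flat_exp m.+1 x).
Proof.
case: (ltgtP x 0) => x0.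
- rewrite {2 3}/flat_exp !(ltNge 0 x) (ltW x0)/= mulr0 addr0.
  apply: (@near_eq_is_derive _ _ _ (cst 0)).
    near=> y; rewrite /flat_exp ifN// -leNgt; apply: ltW.
    by near: y; exact: lt_nbhsl.
- have xn0 : x != 0 by rewrite gt_eqF.
  rewrite {2 3}/flat_exp x0.
  apply: (@near_eq_is_derive _ _ _ (fun y : R => y^-1 ^+ m * expR (- y^-1))).
    near=> y; rewrite /flat_exp ifT//.
    by near: y; exact: lt_nbhsr.
  pose f : R -> R := fun y => y^-1.
  have dV : is_derive x 1 f (- (x ^- 2) *: 1).
    exact: (is_deriveV xn0 (is_derive_id x 1)).
  have -> : (fun y : R => y^-1 ^+ m * expR (- y^-1)) = (f ^+ m) * (expR \o (- f)).
    by apply/funext => y; rewrite -[RHS]/((f ^+ m) y * expR (- f y)) /f exprfctE.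
  have dE := is_derive1_comp (is_derive_expR ((- f) x)) (is_deriveN dV).
  apply: (is_derive_eq (is_deriveM (is_deriveX m dV) dE)).
  rewrite /GRing.scale /= -[(- f) x]/(- x^-1) exprfctE /f !mulr1 -!exprVn.
  case: m => [|m] /=; rewrite ?expr0 ?mulr0n; first by ring.
  by rewrite !exprS; ring.
- rewrite x0 {2 3}/flat_exp ltxx mulr0 addr0.
  have cv : (fun h : R => h^-1 *: (flat_exp m (h *: 1 + 0) - flat_exp m 0)) @ 0^' --> (0 : R).
    apply/cvgr0Pnorm_le => e e0.
    pose M : R := m.+2%:R ^+ m.+2.
    have M0 : 0 < M by rewrite exprn_gt0.
    near=> h.
    have h0 : h != 0 by near: h; exact: nbhs_dnbhs_neq.
    rewrite /GRing.scale /= addr0 mulr1 {2}/flat_exp ltxx subr0 normrM normfV.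
    rewrite ler_pdivrMl ?normr_gt0//.
    apply: (le_trans (flat_exp_le m h)); rewrite -/M -[h ^+ 2]ger0_norm ?sqr_ge0//.
    rewrite normrX expr2 mulrA mulrC ler_wpM2l// mulrC -ler_pdivlMr//.
    near: h; apply: dnbhs0_le; exact: divr_gt0.
  by apply: DeriveDef; [apply/cvg_ex; exists 0|exact: cvg_lim cv].
Unshelve. all: by end_near. Qed.

Lemma Cn_flat_exp n m : Cn n setT (flat_exp m).
Proof.
elim: n m => [|n IH] m.
  by split=> // x _; case: (flat_exp_derive m x).
split=> [x _|]; first by case: (flat_exp_derive m x).
have -> : (flat_exp m)^`() = flat_exp m.+2 \+ (cst (- m%:R) \* flat_exp m.+1).
  by apply/funext => x; rewrite derive1E; case: (flat_exp_derive m x).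
apply: CnD; [exact: openT|exact: IH|apply: CnM; [exact: openT|exact: Cn_cst|exact: IH]].
Qed.

Lemma cinf_flat_exp : cinf (flat_exp 0).
Proof. move=> n x; apply: ((CnP setT _).1 _) => // m; exact: Cn_flat_exp. Qed.

End FlatExp.

(** * The real-valued modulus on complex numbers *)

Section ComplexNorm.
Context {R : rcfType}.
Implicit Types (z w : R[i]).
Local Notation nc := (@Normc.normc R).

Lemma normcE' z : `|z| = (nc z)%:C%C.
Proof. by case: z. Qed.

Lemma ncM z w : nc (z * w) = nc z * nc w.
Proof. exact: Normc.normcM. Qed.

Lemma nc0 : nc 0 = 0. Proof. exact: Normc.normc0. Qed.

Lemma nc1 : nc 1 = 1. Proof. exact: Normc.normc1. Qed.

Lemma ncN z : nc (- z) = nc z. Proof. exact: normcN. Qed.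

Lemma ncV z : nc z^-1 = (nc z)^-1. Proof. exact: Normc.normcV. Qed.

Lemma ncX z n : nc (z ^+ n) = nc z ^+ n.
Proof. by elim: n => [|n IH]; rewrite ?expr0 ?nc1// !exprS ncM IH. Qed.

Lemma nc_ge0 z : 0 <= nc z.
Proof. by case: z => a b /=; exact: sqrtr_ge0. Qed.

Lemma ncD z w : nc (z + w) <= nc z + nc w. Proof. exact: le_normcD. Qed.

Lemma ncB z w : nc (z - w) <= nc z + nc w.
Proof. by apply: le_trans (ncD _ _) _; rewrite ncN. Qed.

Lemma nc_eq0 z : nc z = 0 -> z = 0. Proof. exact: Normc.eq0_normc. Qed.

Lemma nc_sum (I : Type) (r : seq I) (P : pred I) (F : I -> R[i]) :
  nc (\sum_(i <- r | P i) F i) <= \sum_(i <- r | P i) nc (F i).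
Proof.
elim/big_rec2: _ => [|i y1 y2 _ h]; first by rewrite nc0.
by apply: le_trans (ncD _ _) _; rewrite lerD2l.
Qed.

Lemma nc_real (x : R) : nc (x%:C%C) = `|x|.
Proof. by rewrite /= expr0n/= addr0 sqrtr_sqr. Qed.

Lemma nc_nat n : nc n%:R = n%:R.
Proof. by rewrite -(rmorph_nat (real_complex R)) nc_real ger0_norm. Qed.

Lemma nc_le_ReIm z : nc z <= `|complex.Re z| + `|complex.Im z|.
Proof.
case: z => a b /=; rewrite -[leRHS]ger0_norm ?addr_ge0// -[leRHS]sqrtr_sqr ler_wsqrtr//.
rewrite sqrrD !real_normK ?num_real// lerD2r lerDl mulrn_wge0// mulr_ge0//.
Qed.

Lemma Re_le_nc z : `|complex.Re z| <= nc z.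
Proof. by case: z => a b /=; rewrite -[leLHS]sqrtr_sqr ler_wsqrtr// lerDl sqr_ge0. Qed.

Lemma Im_le_nc z : `|complex.Im z| <= nc z.
Proof. by case: z => a b /=; rewrite -[leLHS]sqrtr_sqr ler_wsqrtr// lerDr sqr_ge0. Qed.

End ComplexNorm.

(** * Topology of the circle *)

Section CircleFacts.
Context {R : realType}.
Implicit Types (t : circle R) (U K : set (circle R)).
Local Notation nc := (@Normc.normc R).

Lemma nc_circle t : nc (val t) = 1.
Proof.
have /eqP := valP t; rewrite normcE' => h.
by have := congr1 (@complex.Re R) h.
Qed.

Lemma cisD (x y : R) : val (cis (x + y)) = val (cis x) * val (cis y).
Proof.
by rewrite /= cosD sinD; apply/eqP; rewrite eq_complex /= eqxx andTb addrC.
Qed.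

Lemma cis_surj t : exists x, cis x = t.
Proof.
have := nc_circle t; case: t => -[a b] h /= h1.
have {}h1 : a ^+ 2 + b ^+ 2 = 1.
  by rewrite -[LHS]sqr_sqrtr ?addr_ge0 ?sqr_ge0// h1 expr1n.
have a1 : -1 <= a <= 1.
  rewrite -ler_norml -[leRHS](@sqrtr1 R) -sqrtr_sqr ler_wsqrtr//.
  by rewrite -h1 lerDl sqr_ge0.
have b2 : b ^+ 2 = sin (acos a) ^+ 2 by rewrite sin2cos2 acosK// -h1 [a ^+ 2 + _]addrC addrK.
have /orP[/eqP bE|/eqP bE] : (b == sin (acos a)) || (b == - sin (acos a)).
- by rewrite -eqf_sqr b2.
- by exists (acos a); apply: val_inj; rewrite /= acosK// -bE.
- by exists (- acos a); apply: val_inj; rewrite /= cosN sinN acosK// -bE.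
Qed.

Lemma open_circleP U t : open U -> U t ->
  exists2 r : R, 0 < r & forall t', nc (val t - val t') < r -> U t'.
Proof.
move=> [B oB <-] /= Bt.
have /nbhs_ballP[e /= e0 he] : nbhs (val t) B by apply: open_nbhs_nbhs.
(* Balls in [R[i]] have radii in [R[i]]; positivity forces such a radius to be real. *)
have er : e = (complex.Re e)%:C%C.
  by move: e0; case: e {he} => x y; rewrite /= ltcE /= => /andP[/eqP -> _].
have r0 : 0 < complex.Re e by move: e0; rewrite {1}er ltcR.
exists (complex.Re e) => // t' h; apply: he.
by rewrite /ball /= /ball_ normcE' er ltcR.
Qed.

Lemma near_cis U (x : R) : open U -> U (cis x) -> \near x, U (cis x).
Proof.
move=> oU Ux; have [r r0 hr] := open_circleP oU Ux.
have r2 : 0 < r / 2 by exact: divr_gt0.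
have hc := @cvgr_dist_lt _ _ _ _ _ _ _ (@continuous_cos R x) _ r2.
have hs := @cvgr_dist_lt _ _ _ _ _ _ _ (@continuous_sin R x) _ r2.
near=> y; apply: hr; apply: le_lt_trans (nc_le_ReIm _) _ => /=.
by rewrite (splitr r) ltrD//; [near: y; exact: hc|near: y; exact: hs].
Unshelve. all: by end_near. Qed.

Lemma open_cis U : open U -> open [set x : R | U (cis x)].
Proof. by move=> oU; rewrite openE => x Ux; exact: near_cis. Qed.

Lemma hausdorff_circle : hausdorff_space (circle R).
Proof.
rewrite open_hausdorff => t t' tt'.
have d0 : 0 < nc (val t - val t') / 2.
  rewrite divr_gt0// lt_def nc_ge0 andbT; apply: contra tt' => /eqP/nc_eq0/eqP.
  by rewrite subr_eq0 => /eqP/val_inj ->.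
pose e := (nc (val t - val t') / 2)%:C%C.
have e0 : 0 < e by rewrite ltcR.
exists ([set u | ball (val t) e (val u)], [set u | ball (val t') e (val u)]).
  by split; rewrite inE; exact: ballxx.
split.
- by exists (ball (val t) e); [exact: ball_open|exact: erefl].
- by exists (ball (val t') e); [exact: ball_open|exact: erefl].
- apply/eqP; rewrite -subset0 => u [] /=; rewrite /ball /= /ball_ !normcE' !ltcR => h1 h2.
  have := ncB (val t - val u) (val t' - val u).
  rewrite opprB addrA subrK => /le_lt_trans/(_ (ltrD h1 h2)).
  by rewrite -splitr ltxx.
Qed.

Lemma open_setC_compact K : compact K -> open (~` K).
Proof.
move=> cK; apply: closed_openC; apply: compact_closed cK.
exact: hausdorff_circle.
Qed.

Lemma open_Re_gt (c e : R) : open [set t : circle R | e * complex.Re (val t) < c].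
Proof.
exists [set z : R[i] | e * complex.Re z < c] => //.
rewrite openE => z /= zc.
apply/nbhs_ballP.
have r0 : 0 < (c - e * complex.Re z) / (1 + `|e|).
  by rewrite divr_gt0 ?subr_gt0// ltr_pwDl.
exists ((c - e * complex.Re z) / (1 + `|e|))%:C%C; first by rewrite /= ltcR.
move=> w; rewrite /ball /= /ball_ normcE' ltcR => h.
have h1 : 1 + `|e| > 0 by rewrite ltr_pwDl.
move: h; rewrite ltr_pdivlMr// => h.
have h2 : `|e * (complex.Re w - complex.Re z)| <= `|e| * nc (z - w).
  rewrite normrM ler_wpM2l// -ncN opprB.
  by apply: le_trans (Re_le_nc _); case: (w) (z) => ? ? [].
have := ler_norm (e * (complex.Re w - complex.Re z)).
have := nc_ge0 (z - w).
nra.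
Qed.

End CircleFacts.

(** * Cutoff functions *)

Section SmoothOff.
Context {R : realType}.
Implicit Types (t : circle R) (U K : set (circle R)) (f : smoothfun R).

(** The values of [s] on [K] are arbitrary. Two open sets cover the circle: one on which [f], hence
    the product, is 0, and the complement of [K], on which [s] is smooth. *)
Lemma smooth_off_mul K (s : circle R -> R[i]) f : open (~` K) ->
  smooth_on (~` K) s -> vanishes_near K f ->
  exists u : smoothfun R, forall t, u t = s t * f t.
Proof.
move=> oK ss [V [oV KV fV]].
suff h : (fun t => s t * f t) \in smooth by exists (SmoothFun h).
pose U1 := [set x : R | V (cis x)]; pose U2 := [set x : R | (~` K) (cis x)].
have oU1 : open U1 by exact: open_cis.
have oU2 : open U2 by exact: open_cis.
have U12 x : U1 x \/ U2 x.
  by have [Kx|nKx] := pselect (K (cis x)); [left; exact: KV|right].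
have /smoothP[f1 f2] := smoothfunP f.
have cf1 n : Cn n U2 (re_on f) by apply: (CnP _ _).2 => m x _; exact: f1.
have cf2 n : Cn n U2 (im_on f) by apply: (CnP _ _).2 => m x _; exact: f2.
have cs1 n : Cn n U2 (re_on s) by apply: (CnP _ _).2 => m x Ux; case: (ss m x Ux).
have cs2 n : Cn n U2 (im_on s).
  by apply: (CnP _ _).2 => m x Ux; case: (ss m x Ux).
have key (g : R -> R) : {in U1, g =1 cst 0} -> (forall n, Cn n U2 g) -> cinf g.
  move=> g0 g2 n x; case: (U12 x) => Ux; last exact: ((CnP _ _).1 g2).
  apply: ((CnP U1 _).1 _) => // m; apply: (eq_Cn oU1 _ (Cn_cst m U1 0)).
  by move=> y /g0 ->.
apply/smoothP; split.
- have -> : re_on (fun t => s t * f t) =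
      (re_on s \* re_on f) \+ (cst (-1) \* (im_on s \* im_on f)).
    apply/funext => x; rewrite /re_on /im_on /=; case: (s _) (f _) => [a b] [c d] /=.
    by rewrite mulN1r.
  apply: key => [x|n].
    by rewrite inE /U1 /= /re_on /im_on => /fV -> /=; rewrite !mulr0 addr0.
  apply: CnD; [exact: oU2|by apply: CnM|apply: CnM; [exact: oU2|exact: Cn_cst|by apply: CnM]].
- have -> : im_on (fun t => s t * f t) =
      (re_on s \* im_on f) \+ (im_on s \* re_on f).
    by apply/funext => x; rewrite /re_on /im_on /=; case: (s _) (f _) => [a b] [c d].
  apply: key => [x|n].
    by rewrite inE /U1 /= /re_on /im_on => /fV -> /=; rewrite !mulr0 addr0.
  by apply: CnD; [exact: oU2|apply: CnM|apply: CnM].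
Qed.

Lemma smooth_Re (u : R -> R) : cinf u ->
  (fun t : circle R => (u (complex.Re (val t)))%:C%C) \in smooth.
Proof.
move=> cu; apply/smoothP; split.
  exact: (cinf_comp cu (@cinf_cos R)).
exact: (@cinf_cst R 0).
Qed.

(* The bump is a function of Re t, supported in a half-plane e * Re t > c. *)
Lemma exists_bump K (e : R) : open (~` K) -> e = 1 \/ e = -1 ->
  (forall t, val t = e%:C%C -> ~ K t) ->
  exists psi : smoothfun R,
    [/\ vanishes_near K psi, forall t, psi (circleV t) = psi t,
        forall t, val t = e%:C%C -> psi t = 1 &
        forall t, val t = (- e)%:C%C -> psi t = 0].
Proof.
move=> oK e1 nKe.
have ee : e * e = 1 by case: e1 => ->; rewrite ?mulrNN mulr1.
have [te te_e] : exists t : circle R, val t = e%:C%C.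
  by case: e1 => ->; [exists circle1|exists (circleN circle1); rewrite rmorphN].
have [r r0 hr] := open_circleP oK (nKe _ te_e).
(* On the circle |t - e|^2 = 2 - 2 e Re t, so e Re t >= c gives |t - e|^2 <= r^2/2 < r^2 and keeps t
   off [K]. The minimum with 1 ensures c >= 0, so that the bump vanishes at -e. *)
pose c := 1 - Num.min 1 (r ^+ 2 / 4).
have m0 : 0 < Num.min 1 (r ^+ 2 / 4) by rewrite lt_min ltr01 divr_gt0// exprn_gt0.
have m1 : Num.min 1 (r ^+ 2 / 4) <= 1 by rewrite ge_min lexx.
have m2 : Num.min 1 (r ^+ 2 / 4) <= r ^+ 2 / 4 by rewrite ge_min lexx orbT.
have c1 : c < 1 by rewrite ltrBlDr ltrDl.
have c0 : 0 <= c by rewrite subr_ge0.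
have Kc t : K t -> e * complex.Re (val t) < c.
  move=> Kt; rewrite ltNge; apply/negP => h.
  apply: (hr t) Kt; rewrite te_e.
  have nt := nc_circle t; case: (val t) h nt => a b /= h nt.
  rewrite sub0r sqrrN.
  have ab : a ^+ 2 + b ^+ 2 = 1.
    by rewrite -[LHS]sqr_sqrtr ?addr_ge0 ?sqr_ge0// nt expr1n.
  have -> : (e - a) ^+ 2 + b ^+ 2 = 2 - 2 * (e * a).
    have -> : b ^+ 2 = 1 - a ^+ 2 by rewrite -ab addrAC subrr add0r.
    have -> : (e - a) ^+ 2 + (1 - a ^+ 2) = e * e + 1 - 2 * (e * a) by ring.
    by rewrite ee.
  rewrite -[r]ger0_norm ?ltW// -sqrtr_sqr ltr_sqrt ?exprn_gt0//.
  have r2 : 0 < r ^+ 2 by rewrite exprn_gt0.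
  by move: h m2 r2; rewrite /c; clear; lra.
pose u (x : R) : R := (flat_exp 0 (1 - c))^-1 * flat_exp 0 (e * x - c).
have cu : cinf u.
  have -> : u = cst (flat_exp 0 (1 - c))^-1 \*
      (flat_exp 0 \o ((cst e \* id) \+ cst (- c))) by [].
  apply: cinfM; [exact: cinf_cst|apply: cinf_comp; [exact: cinf_flat_exp|]].
  apply: cinfD; [apply: cinfM; [exact: cinf_cst|]|exact: cinf_cst].
  have -> : (id : R -> R) = (fun x => x) by [].
  case=> [|n] x; first exact: derivable_id.
  rewrite derive1nSr; have -> : (fun x : R => x)^`() = cst 1.
    by apply/funext => y; exact: derive1_id.
  exact: cinf_cst.
have u0 x : e * x <= c -> u x = 0.
  by move=> xc; rewrite /u {2}/flat_exp ifN ?mulr0// -leNgt subr_le0.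
exists (SmoothFun (smooth_Re cu)); split.
- exists [set t | e * complex.Re (val t) < c]; split; [exact: open_Re_gt|exact: Kc|].
  by move=> t /= h; rewrite u0// ltW.
- move=> t /=; suff -> : complex.Re (val t)^-1 = complex.Re (val t) by [].
  have [x <-] := cis_surj t.
  by rewrite -[(val (cis x))^-1]/(val (circleV (cis x))) circleV_cis /= cosN.
- move=> t /= ->; rewrite /u /= ee mulVf// /flat_exp subr_gt0 c1 expr0 mul1r.
  by rewrite gt_eqF// expR_gt0.
- move=> t /= ->; rewrite /= u0// mulrN ee.
  by apply: le_trans c0; rewrite oppr_le0.
Qed.

End SmoothOff.

(** * Fourier series on the circle *)

Section PeriodAverage.
Context {R : realType}.
Implicit Types (u v : R -> R).
Notation mu := (@lebesgue_measure R).

Definition ravg u : R := (2 * pi)^-1 * \int[mu]_(x in `[0, 2 * pi]) u x.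

Let pi2_gt0 : 0 < 2 * pi :> R. Proof. by rewrite mulr_gt0// pi_gt0. Qed.

Let int_cont u : cinf u -> mu.-integrable `[0, 2 * pi] (EFin \o u).
Proof.
move=> cu; apply: continuous_compact_integrable; first exact: segment_compact.
apply: continuous_subspaceT => x; exact: cinf_continuous.
Qed.

Lemma ravgD u v : cinf u -> cinf v -> ravg (u \+ v) = ravg u + ravg v.
Proof.
move=> cu cv; rewrite /ravg RintegralD; first by rewrite mulrDr.
- exact: measurable_itv.
- exact: int_cont.
- exact: int_cont.
Qed.

Lemma ravgZ c u : cinf u -> ravg (fun x => c * u x) = c * ravg u.
Proof.
move=> cu; rewrite /ravg RintegralZl; first by rewrite mulrCA.
- exact: measurable_itv.
- exact: int_cont.
Qed.

Lemma ravg_le u v : cinf u -> cinf v -> (forall x, u x <= v x) ->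
  ravg u <= ravg v.
Proof.
move=> cu cv uv; rewrite /ravg ler_wpM2l ?invr_ge0 ?(ltW pi2_gt0)//.
apply: le_Rintegral.
- exact: measurable_itv.
- exact: int_cont.
- exact: int_cont.
- by move=> x _; exact: uv.
Qed.

Lemma ravg_cst c : ravg (cst c) = c.
Proof.
rewrite /ravg Rintegral_cst; last exact: measurable_itv.
have := @lebesgue_measure_itv R (Interval (BLeft 0) (BRight (2 * pi))).
rewrite /= lte_fin pi2_gt0 oppr0 adde0 => -> /=.
by rewrite mulrC mulfK// gt_eqF.
Qed.

Lemma ravg_derive1 u : cinf u -> u (2 * pi) = u 0 -> ravg u^`() = 0.
Proof.
move=> cu per; rewrite /ravg /Rintegral.
rewrite (@continuous_FTC2 R u^`() u 0 (2 * pi)) ?per ?subee ?mulr0//.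
- by apply: continuous_subspaceT => x; exact/cinf_continuous/cinf_derive1.
- split.
  + by move=> x _; exact: cinf_derivable.
  + by apply: cvg_at_right_filter; exact: cinf_continuous.
  + by apply: cvg_at_left_filter; exact: cinf_continuous.
Qed.

End PeriodAverage.

(** * Differentiation with respect to the angle *)

Section AngularDerivative.
Context {R : realType}.
Implicit Types (t : circle R) (f g : smoothfun R).
Local Notation C := R[i].

Lemma smoothfun_eq f g : re_on f = re_on g -> im_on f = im_on g -> f = g.
Proof.
move=> h1 h2; apply: val_inj; apply/funext => t; have [x <-] := cis_surj t.
have := congr1 (fun F => F x) h1; have := congr1 (fun F => F x) h2.
by rewrite /re_on /im_on /=; case: (f _) (g _) => [a b] [c d] /= -> ->.
Qed.

Lemma cinf_re f : cinf (re_on f).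
Proof. by have /smoothP[] := smoothfunP f. Qed.
Arguments cinf_re : clear implicits.

Lemma cinf_im f : cinf (im_on f).
Proof. by have /smoothP[] := smoothfunP f. Qed.
Arguments cinf_im : clear implicits.

Lemma derive1n_shift (u : R -> R) c n : (u \o +%R c)^`(n) = u^`(n) \o +%R c.
Proof.
elim: n u => [//|n IH] u; by rewrite !derive1nSr derive1_shift IH.
Qed.

Lemma re_on_derive_cis f n x y : cis x = cis y ->
  (re_on f)^`(n) x = (re_on f)^`(n) y.
Proof.
move=> xy; have h : re_on f \o +%R x = re_on f \o +%R y.
  apply/funext => h; rewrite /= /re_on; congr (complex.Re (f _)).
  by apply: val_inj; rewrite !cisD xy.
have := congr1 (fun F => F^`(n) 0) h.
by rewrite !derive1n_shift /= !addr0.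
Qed.

Lemma im_on_derive_cis f n x y : cis x = cis y ->
  (im_on f)^`(n) x = (im_on f)^`(n) y.
Proof.
move=> xy; have h : im_on f \o +%R x = im_on f \o +%R y.
  apply/funext => h; rewrite /= /im_on; congr (complex.Im (f _)).
  by apply: val_inj; rewrite !cisD xy.
have := congr1 (fun F => F^`(n) 0) h.
by rewrite !derive1n_shift /= !addr0.
Qed.

(* The angle is chosen arbitrarily; by periodicity it does not matter. *)
Definition dangle_val f t : C :=
  let x := sval (cid (cis_surj t)) in ((re_on f)^`() x +i* (im_on f)^`() x)%C.

Lemma re_dangle_val f : re_on (dangle_val f) = (re_on f)^`().
Proof.
apply/funext => x; rewrite {1}/re_on /dangle_val /=.
by apply: (@re_on_derive_cis f 1); case: (cid _) => y /= ->.
Qed.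

Lemma im_dangle_val f : im_on (dangle_val f) = (im_on f)^`().
Proof.
apply/funext => x; rewrite {1}/im_on /dangle_val /=.
by apply: (@im_on_derive_cis f 1); case: (cid _) => y /= ->.
Qed.

Lemma dangle_smooth f : dangle_val f \in smooth.
Proof.
apply/smoothP; rewrite re_dangle_val im_dangle_val.
by split; apply: cinf_derive1; [exact: cinf_re|exact: cinf_im].
Qed.

Definition dangle f : smoothfun R := SmoothFun (dangle_smooth f).

Lemma re_dangle f : re_on (dangle f) = (re_on f)^`().
Proof. exact: re_dangle_val. Qed.

Lemma im_dangle f : im_on (dangle f) = (im_on f)^`().
Proof. exact: im_dangle_val. Qed.

Lemma re_iter_dangle f n : re_on (iter n dangle f) = (re_on f)^`(n).
Proof. by elim: n => [//|n IH]; rewrite iterS re_dangle IH -derive1nS. Qed.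

Lemma im_iter_dangle f n : im_on (iter n dangle f) = (im_on f)^`(n).
Proof. by elim: n => [//|n IH]; rewrite iterS im_dangle IH -derive1nS. Qed.

Let dr f x : derivable (re_on f) x 1. Proof. exact/cinf_derivable/cinf_re. Qed.
Let di f x : derivable (im_on f) x 1. Proof. exact/cinf_derivable/cinf_im. Qed.

Lemma dangleD f g : dangle (f + g) = dangle f + dangle g.
Proof.
apply: smoothfun_eq.
  rewrite re_dangle -[smoothfun_val (dangle f + dangle g)]/(val (dangle f) + val (dangle g)).
  rewrite re_onD !re_dangle -[smoothfun_val (f + g)]/(val f + val g) re_onD.
  by apply: derive1_add; [exact: dr f|exact: dr g].
rewrite im_dangle -[smoothfun_val (dangle f + dangle g)]/(val (dangle f) + val (dangle g)).
rewrite im_onD !im_dangle -[smoothfun_val (f + g)]/(val f + val g) im_onD.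
by apply: derive1_add; [exact: di f|exact: di g].
Qed.

Lemma dangleM f g : dangle (f * g) = dangle f * g + f * dangle g.
Proof.
have hm (u v : R -> R) : cinf u -> cinf v ->
    (u \* v)^`(1) = (u^`() \* v) \+ (u \* v^`()).
  by move=> cu cv; apply: derive1_mul => x; exact: cinf_derivable.
have eE : smoothfun_val (dangle f * g + f * dangle g) =
  val (dangle f) * val g + val f * val (dangle g) by [].
have mE : smoothfun_val (f * g) = val f * val g by [].
apply: smoothfun_eq.
  rewrite re_dangle eE mE re_onD !re_onM !re_dangle !im_dangle.
  have cr : cinf (re_on f \* re_on g) by apply: cinfM; exact: cinf_re.
  have ci : cinf (im_on f \* im_on g) by apply: cinfM; exact: cinf_im.
  have cni : cinf (\- (im_on f \* im_on g)) by exact: cinfN.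
  rewrite [LHS](derive1n_add 1 cr cni) (derive1n_opp 1 ci).
  rewrite (hm _ _ (cinf_re f) (cinf_re g)) (hm _ _ (cinf_im f) (cinf_im g)).
  by apply/funext => x /=; ring.
rewrite im_dangle eE mE im_onD !im_onM !re_dangle !im_dangle.
have c1 : cinf (re_on f \* im_on g) by apply: cinfM; [exact: cinf_re|exact: cinf_im].
have c2 : cinf (im_on f \* re_on g) by apply: cinfM; [exact: cinf_im|exact: cinf_re].
rewrite [LHS](derive1n_add 1 c1 c2).
rewrite (hm _ _ (cinf_re f) (cinf_im g)) (hm _ _ (cinf_im f) (cinf_re g)).
by apply/funext => x /=; ring.
Qed.

Lemma dangle_cst (c : C) : dangle (c *: (1 : smoothfun R)) = 0.
Proof.
pose k : smoothfun R := c *: (1 : smoothfun R).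
have kE t : k t = c by exact: (mulr1 c).
have re1 : re_on k = cst (complex.Re c) by apply/funext => x; rewrite /re_on kE.
have im1 : im_on k = cst (complex.Im c) by apply/funext => x; rewrite /im_on kE.
rewrite -/k.
have val0 : smoothfun_val (0 : smoothfun R) = cst 0 by exact: erefl.
have d0 (a : R) : (cst a : R -> R)^`() = cst 0.
  by apply/funext => x; rewrite derive1_cst.
apply: smoothfun_eq.
  apply: (etrans (re_dangle _)).
  apply: (etrans (congr1 (fun u : R -> R => u^`()) re1)).
  apply: (etrans (d0 _)).
  exact: esym (congr1 (@re_on R) val0).
apply: (etrans (im_dangle _)).
apply: (etrans (congr1 (fun u : R -> R => u^`()) im1)).
apply: (etrans (d0 _)).
exact: esym (congr1 (@im_on R) val0).
Qed.

Lemma dangle1 : dangle 1 = 0.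
Proof. by rewrite -[1](scale1r (1 : smoothfun R)) dangle_cst. Qed.

Lemma scale_smoothE (c : C) f : c *: f = (c *: (1 : smoothfun R)) * f.
Proof.
by apply: val_inj; apply/funext => t; rewrite -[LHS]/(c * f t) -[RHS]/(c * 1 * f t) mulr1.
Qed.

Lemma scale_mulAl (c : C) f g : c *: f * g = c *: (f * g).
Proof.
apply: val_inj; apply/funext => t.
by rewrite -[LHS]/(c * f t * g t) -[RHS]/(c * (f t * g t)) mulrA.
Qed.

Lemma scale_mulAr (c : C) f g : f * (c *: g) = c *: (f * g).
Proof. by rewrite mulrC scale_mulAl mulrC. Qed.

Lemma dangleZ (c : C) f : dangle (c *: f) = c *: dangle f.
Proof.
by rewrite scale_smoothE dangleM dangle_cst mul0r add0r -scale_smoothE.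
Qed.

Lemma char0 : char 0 = (1 : smoothfun R).
Proof. by apply: val_inj; apply/funext => t; rewrite /= expr0z. Qed.

Lemma dangle_char (m : int) : dangle (char m) = ('i%C * m%:~R) *: char m.
Proof.
have h1 : dangle (char 1) = 'i%C *: char 1.
  apply: smoothfun_eq.
    rewrite re_dangle -[re_on _]/(@cos R).
    apply/funext => x; rewrite derive1E; case: (is_derive_cos x) => _ ->.
    by rewrite /re_on -[val _ _]/('i%C * val (cis x)) /= mul0r mul1r sub0r.
  rewrite im_dangle -[im_on _]/(@sin R).
  apply/funext => x; rewrite derive1E; case: (is_derive_sin x) => _ ->.
  by rewrite /im_on -[val _ _]/('i%C * val (cis x)) /= mul0r mul1r add0r.
have hn (n : nat) : dangle (char n%:Z) = ('i%C * n%:R) *: char n%:Z.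
  elim: n => [|n IH]; first by rewrite char0 dangle1 mulr0 scale0r.
  rewrite -[n.+1]addn1 PoszD charD dangleM IH h1 scale_mulAl scale_mulAr -scalerDl.
  by rewrite natrD mulrDr mulr1.
case: m => n; first by rewrite hn.
rewrite NegzE; set N := n.+1.
(* Negative exponents are obtained by differentiating this product. *)
have e : char N%:Z * char (- N%:Z) = 1 :> smoothfun R by rewrite -charD subrr char0.
have := congr1 dangle e; rewrite dangleM dangle1 hn => h.
have {h} := congr1 (fun z => char (- N%:Z) * z) h.
rewrite mulr0 mulrDr mulrA scale_mulAr scale_mulAl mulrA [char (- _) * char _]mulrC e mul1r.
rewrite mul1r => /eqP; rewrite addr_eq0 => /eqP h.
by rewrite -[LHS]opprK -h -scaleNr mulrNz mulrN.
Qed.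

End AngularDerivative.

Arguments cinf_re {R} f n x.
Arguments cinf_im {R} f n x.

(** * Means and Fourier coefficients *)

Section Mean.
Context {R : realType}.
Implicit Types (t : circle R) (f g : smoothfun R) (m : int).
Local Notation C := R[i].
Local Notation nc := (@Normc.normc R).

Lemma meanE (h : circle R -> C) :
  mean h = (ravg (re_on h) +i* ravg (im_on h))%C.
Proof.
rewrite /mean /ravg; apply/eqP; rewrite eq_complex /= !mul0r subr0 addr0.
by rewrite !eqxx.
Qed.

Lemma re_on_addf f g : re_on (f + g) = re_on f \+ re_on g.
Proof. exact: re_onD. Qed.

Lemma im_on_addf f g : im_on (f + g) = im_on f \+ im_on g.
Proof. exact: im_onD. Qed.

Lemma re_on_scale (c : C) f x :
  re_on (c *: f) x = complex.Re c * re_on f x - complex.Im c * im_on f x.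
Proof.
rewrite /re_on /im_on -[smoothfun_val (c *: f) _]/(c * f (cis x)).
by case: c (f _) => [a b] [d e].
Qed.

Lemma im_on_scale (c : C) f x :
  im_on (c *: f) x = complex.Re c * im_on f x + complex.Im c * re_on f x.
Proof.
rewrite /re_on /im_on -[smoothfun_val (c *: f) _]/(c * f (cis x)).
by case: c (f _) => [a b] [d e].
Qed.

Definition smean f : C := mean f.

Lemma smeanD f g : smean (f + g) = smean f + smean g.
Proof.
rewrite /smean !meanE re_on_addf im_on_addf.
by rewrite (ravgD (cinf_re f) (cinf_re g)) (ravgD (cinf_im f) (cinf_im g)).
Qed.

Lemma smeanZ (c : C) f : smean (c *: f) = c * smean f.
Proof.
have cZ (a : R) (u : R -> R) : cinf u -> cinf (fun x => a * u x).
  by move=> cu; apply: (cinfM (@cinf_cst R a) cu).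
have cr := cinf_re f; have ci := cinf_im f.
have h1 : re_on (c *: f) = (fun x => complex.Re c * re_on f x) \+
    (fun x => - complex.Im c * im_on f x).
  by apply/funext => x; rewrite re_on_scale /= mulNr.
have h2 : im_on (c *: f) = (fun x => complex.Re c * im_on f x) \+
    (fun x => complex.Im c * re_on f x).
  by apply/funext => x; rewrite im_on_scale.
rewrite /smean !meanE h1 h2.
rewrite (ravgD (cZ _ _ cr) (cZ _ _ ci)) (ravgD (cZ _ _ ci) (cZ _ _ cr)).
rewrite !(ravgZ _ cr) !(ravgZ _ ci).
by case: c {h1 h2} => a b /=; rewrite mulNr.
Qed.

Lemma smean_is_linear : scalar smean.
Proof. by move=> c f g; rewrite smeanD smeanZ. Qed.

HB.instance Definition _ :=
  GRing.isLinear.Build C (smoothfun R) C *%R smean smean_is_linear.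

(** Real and imaginary parts are dominated separately by one real average, which avoids a triangle
    inequality for complex integrals at the price of the factor 2. *)
Lemma smean_dominated f g :
  (forall x, `|re_on f x| <= re_on g x /\ `|im_on f x| <= re_on g x) ->
  nc (smean f) <= 2 * complex.Re (smean g).
Proof.
move=> h; rewrite /smean !meanE /=.
have avg_le (u v : R -> R) : cinf u -> cinf v -> (forall x, `|u x| <= v x) ->
    `|ravg u| <= ravg v.
  move=> cu cv uv; rewrite ler_norml; apply/andP; split.
    have -> : - ravg v = ravg (fun x => -1 * v x) by rewrite (ravgZ _ cv) mulN1r.
    apply: (ravg_le (cinfM (@cinf_cst R (-1)) cv) cu) => x /=.
    by rewrite mulN1r; have := uv x; rewrite ler_norml => /andP[].
  by apply: (ravg_le cu cv) => x; exact: le_trans (ler_norm _) (uv x).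
apply: le_trans (nc_le_ReIm (_ +i* _)%C) _ => /=; rewrite mulr_natl mulr2n.
apply: lerD.
  by apply: (avg_le _ _ (cinf_re f) (cinf_re g)) => x; case: (h x).
by apply: (avg_le _ _ (cinf_im f) (cinf_re g)) => x; case: (h x).
Qed.

Lemma scale1E (c : C) t : (c *: (1 : smoothfun R)) t = c.
Proof. exact: (mulr1 c). Qed.

Lemma smean_cst (c : C) : smean (c *: (1 : smoothfun R)) = c.
Proof.
have re1 : re_on (c *: (1 : smoothfun R)) = cst (complex.Re c).
  by apply/funext => x; rewrite /re_on scale1E.
have im1 : im_on (c *: (1 : smoothfun R)) = cst (complex.Im c).
  by apply/funext => x; rewrite /im_on scale1E.
by rewrite /smean meanE re1 im1 !ravg_cst; case: c {re1 im1}.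
Qed.

Lemma smean1 : smean 1 = 1.
Proof. by rewrite -[1 in LHS](scale1r (1 : smoothfun R)) smean_cst. Qed.

Lemma smean_le f (B : R) : (forall t, nc (f t) <= B) -> nc (smean f) <= 2 * B.
Proof.
move=> h; rewrite -[B in leRHS]/(complex.Re B%:C%C) -(smean_cst B%:C%C).
have rE x : re_on (B%:C%C *: (1 : smoothfun R)) x = B by rewrite /re_on scale1E.
apply: smean_dominated => x; rewrite rE; split.
  exact: le_trans (Re_le_nc _) (h _).
exact: le_trans (Im_le_nc _) (h _).
Qed.

Lemma smean_dangle f : smean (dangle f) = 0.
Proof.
have per : cis (2 * pi) = cis 0 :> circle R.
  apply: val_inj => /=; rewrite mulr_natl mulr2n cosDpi sinDpi.
  by rewrite cospi sinpi cos0 sin0 opprK oppr0.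
rewrite /smean meanE re_dangle im_dangle.
have h1 : re_on f (2 * pi) = re_on f 0 by rewrite /re_on per.
have h2 : im_on f (2 * pi) = im_on f 0 by rewrite /im_on per.
by rewrite (ravg_derive1 (cinf_re f) h1) (ravg_derive1 (cinf_im f) h2).
Qed.

Lemma nc_int m : nc m%:~R = (`|m|%N)%:R :> R.
Proof. by case: m => n; rewrite ?NegzE ?mulrNz ?ncN nc_nat. Qed.

Lemma i_neq0 : 'i%C != 0 :> C.
Proof. by rewrite eq_complex /= eqxx oner_eq0. Qed.

Lemma smean_char m : smean (char m) = (m == 0)%:R.
Proof.
have [->|m0] := eqVneq m 0; first by rewrite char0 smean1.
have := smean_dangle (char m); rewrite dangle_char smeanZ => /eqP.
rewrite mulf_eq0 => /orP[|/eqP //].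
by rewrite mulf_eq0 (negPf i_neq0) intr_eq0 (negPf m0).
Qed.

Definition fc f m : C := smean (f * char (- m)).

(** Integration by parts: the derivative of [f * char (- m)] has mean 0. *)
Lemma fc_dangle f m : fc (dangle f) m = 'i%C * m%:~R * fc f m.
Proof.
have := smean_dangle (f * char (- m)).
rewrite dangleM dangle_char smeanD scale_mulAr smeanZ -/(fc f m) -/(fc _ m).
by move/eqP; rewrite addr_eq0 => /eqP ->; rewrite mulrNz mulrN mulNr opprK.
Qed.

Lemma smooth_nc_bounded f : exists2 B : R, 0 <= B & forall t, nc (f t) <= B.
Proof.
have [B hB] := smoothfun_bounded 0 f.
have B0 : 0 <= B by have [h _] := hB 0%N 0 isT; exact: le_trans h.
exists (B + B); first exact: addr_ge0.
move=> t; have [x <-] := cis_surj t; have [h1 h2] := hB 0%N x isT.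
by apply: le_trans (nc_le_ReIm _) _; exact: lerD.
Qed.

Lemma nc_char m t : nc (char m t) = 1.
Proof.
rewrite /=; case: m => n; first by rewrite -exprnP ncX nc_circle expr1n.
by rewrite NegzE -exprnN ncV ncX nc_circle expr1n invr1.
Qed.

(** One more factor |m| + 1 costs one angular derivative: |m| times a coefficient of [f] is, in
    modulus, a coefficient of [dangle f]. *)
Lemma fc_decay f (q : nat) : exists2 B : R, 0 <= B &
  forall m, nc (fc f m) * (`|m|%N.+1)%:R ^+ q <= B.
Proof.
elim: q f => [|q IH] f.
  have [B B0 hB] := smooth_nc_bounded f.
  exists (2 * B); first by rewrite mulr_ge0.
  move=> m; rewrite expr0 mulr1; apply: smean_le => t.
  by rewrite -[smoothfun_val _ _]/(f t * char (- m) t) ncM nc_char mulr1.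
have [B1 B10 h1] := IH f; have [B2 B20 h2] := IH (dangle f).
exists (B1 + B2); first exact: addr_ge0.
move=> m; rewrite exprSr -[_.+1 in X in _ * (_ * X)]addn1 natrD mulrA mulrDr mulr1 addrC.
apply: lerD => //; apply: le_trans (h2 m); rewrite fc_dangle.
move: (fc f m) => z; rewrite !ncM nc_int.
have -> : nc 'i%C = 1 :> R by rewrite /= expr0n /= add0r expr1n sqrtr1.
by rewrite mul1r mulrC mulrA.
Qed.

Lemma fcD f g m : fc (f + g) m = fc f m + fc g m.
Proof. by rewrite /fc mulrDl smeanD. Qed.

Lemma fcZ (c : C) f m : fc (c *: f) m = c * fc f m.
Proof. by rewrite /fc scale_mulAl smeanZ. Qed.

Lemma fc_char k m : fc (char k) m = (k == m)%:R.
Proof. by rewrite /fc -charD smean_char subr_eq0. Qed.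

End Mean.

#[global] Opaque smean fc.

(** * Symmetric partial sums and their Cesaro sums *)

Section SymmetricSums.
Context {R : realType}.
Local Notation C := R[i].
Local Notation nc := (@Normc.normc R).
Implicit Types (f g : int -> C).

Definition zsum n f : C := f 0 + \sum_(i < n) (f i.+1%:Z + f (- i.+1%:Z)).

Lemma zsum0 f : zsum 0 f = f 0.
Proof. by rewrite /zsum big_ord0 addr0. Qed.

Lemma zsumS n f : zsum n.+1 f = zsum n f + (f n.+1%:Z + f (- n.+1%:Z)).
Proof. by rewrite /zsum big_ord_recr /= addrA. Qed.

Lemma eq_zsum n f g : f =1 g -> zsum n f = zsum n g.
Proof. by move=> fg; rewrite /zsum fg; congr (_ + _); apply: eq_bigr => i _; rewrite !fg. Qed.

Lemma zsumD n f g : zsum n (fun m => f m + g m) = zsum n f + zsum n g.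
Proof. by elim: n => [|n IH]; rewrite ?zsum0// !zsumS IH; ring. Qed.

Lemma zsumMr n f (c : C) : zsum n (fun m => f m * c) = zsum n f * c.
Proof. by elim: n => [|n IH]; rewrite ?zsum0// !zsumS IH; ring. Qed.

Lemma zsumMl n f (c : C) : zsum n (fun m => c * f m) = c * zsum n f.
Proof. by elim: n => [|n IH]; rewrite ?zsum0// !zsumS IH; ring. Qed.

Lemma nc_zsum n f (B : R) : (forall m, (`|m| <= n)%N -> nc (f m) <= B) ->
  nc (zsum n f) <= n.*2.+1%:R * B.
Proof.
elim: n => [|n IH] h; first by rewrite zsum0 mul1r h.
rewrite zsumS; apply: le_trans (ncD _ _) _.
have -> : n.+1.*2.+1%:R * B = n.*2.+1%:R * B + (B + B).
  by rewrite doubleS -addn2 natrD; ring.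
apply: lerD; first by apply: IH => m mn; apply: h; exact: leqW.
by apply: le_trans (ncD _ _) _; apply: lerD; apply: h; rewrite ?abszN.
Qed.

(** Two of the q + 2 powers bound the term of index i + 1 by 1/(i+1) - 1/(i+2), which telescopes to
    at most 1/(n+1); the others contribute (n+1)^-q. *)
Lemma zsum_tail f q (B : R) n k :
  (forall m, nc (f m) * (`|m|%N.+1)%:R ^+ q.+2 <= B) ->
  nc (zsum (n + k) f - zsum n f) <= 2 * B / n.+1%:R ^+ q.+1.
Proof.
move=> h; have B0 : 0 <= B.
  by apply: le_trans (h 0); rewrite mulr_ge0 ?nc_ge0 ?exprn_ge0.
have N0 i : 0 < i.+1%:R :> R by [].
have fb m i : (n <= i)%N -> `|m|%N = i.+1 ->
    nc (f m) <= B / n.+1%:R ^+ q * (i.+1%:R^-1 - i.+2%:R^-1).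
  move=> ni mi; have := h m; rewrite mi -ler_pdivlMr; last exact: exprn_gt0.
  move=> /le_trans; apply.
  have -> : i.+1%:R^-1 - i.+2%:R^-1 = (i.+1%:R * i.+2%:R)^-1 :> R.
    have -> : i.+2%:R = i.+1%:R + 1 :> R by rewrite -natr1.
    by field; rewrite !gt_eqF// -natr1 ltr_wpDl.
  rewrite -mulrA -invfM ler_wpM2l// lef_pV2 ?posrE; last 2 first.
    by apply: exprn_gt0.
    by rewrite !mulr_gt0 ?exprn_gt0.
  have -> : i.+2%:R ^+ q.+2 = i.+2%:R ^+ q * (i.+2%:R * i.+2%:R) :> R.
    by rewrite !exprS; ring.
  apply: ler_pM; rewrite ?exprn_ge0 ?mulr_ge0//.
    by rewrite lerXn2r ?nnegrE// ler_nat; lia.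
  by rewrite ler_wpM2r// ler_nat.
have key : nc (zsum (n + k) f - zsum n f) <=
    2 * B / n.+1%:R ^+ q * (n.+1%:R^-1 - (n + k).+1%:R^-1).
  elim: k => [|k IH]; first by rewrite addn0 !subrr nc0 mulr0.
  rewrite addnS zsumS addrAC; apply: le_trans (ncD _ _) _.
  have -> : n.+1%:R^-1 - (n + k).+2%:R^-1 = (n.+1%:R^-1 - (n + k).+1%:R^-1) +
     ((n + k).+1%:R^-1 - (n + k).+2%:R^-1) :> R by ring.
  rewrite mulrDr; apply: lerD => //; apply: le_trans (ncD _ _) _.
  rewrite -mulrA -mulrA mulr_natl mulr2n mulrA.
  by apply: lerD; apply: fb; rewrite ?leq_addr ?abszN.
apply: le_trans key _.
have -> : 2 * B / n.+1%:R ^+ q.+1 = 2 * B / n.+1%:R ^+ q * n.+1%:R^-1.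
  by rewrite exprSr invfM [_^-1 * _^-1]mulrC [n.+1%:R^-1 * _]mulrC mulrA.
apply: ler_wpM2l; first by rewrite divr_ge0 ?mulr_ge0 ?exprn_ge0.
by rewrite lerBlDr lerDl invr_ge0.
Qed.

(** Going from M to M + 1 adds a last row and a last column, which together form the symmetric sum
    of order M. This is how the mean against a Fejer kernel becomes a sum of partial sums. *)
Lemma cesaro_double_sum f (M : nat) :
  \sum_(j < M) \sum_(l < M) f (l%:Z - j%:Z) = \sum_(m < M) zsum m f.
Proof.
elim: M => [|M IH]; first by rewrite !big_ord0.
rewrite [RHS]big_ord_recr /= -IH big_ord_recr /=.
under eq_bigr => j _ do rewrite big_ord_recr /=.
rewrite big_split /= -addrA; congr (_ + _).
rewrite big_ord_recr /= subrr /zsum addrC -addrA addrC -addrA; congr (_ + _).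
rewrite big_split /=; congr (_ + _).
  rewrite (reindex_inj rev_ord_inj) /=; apply: eq_bigr => i _; congr (f _).
  by have := ltn_ord i; lia.
rewrite (reindex_inj rev_ord_inj) /=; apply: eq_bigr => i _; congr (f _).
by have := ltn_ord i; lia.
Qed.

End SymmetricSums.

(** * Squared distance to a point of the circle *)

Section Fejer.
Context {R : realType}.
Implicit Types (t : circle R) (f g : smoothfun R) (m : int).
Local Notation C := R[i].
Local Notation nc := (@Normc.normc R).

Lemma circle_ratio t0 t : exists2 x : R, `|x| <= pi &
  forall x0, cis x0 = t0 -> cis (x0 + x) = t.
Proof.
have [x0 <-] := cis_surj t0; have [y <-] := cis_surj t.
have cosle : -1 <= cos (y - x0) <= 1 by rewrite cos_geN1 cos_le1.
have [x xpi [cx sx]] : exists2 x : R, `|x| <= pi &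
    cos x = cos (y - x0) /\ sin x = sin (y - x0).
  pose a := acos (cos (y - x0)).
  have a0 : 0 <= a by apply: acos_ge0.
  have api : a <= pi by apply: acos_lepi.
  have ca : cos a = cos (y - x0) by rewrite acosK.
  have /orP[/eqP bE|/eqP bE] : (sin (y - x0) == sin a) || (sin (y - x0) == - sin a).
  - by rewrite -eqf_sqr !sin2cos2 ca.
  - by exists a; rewrite ?ger0_norm// ca bE.
  - by exists (- a); rewrite ?normrN ?ger0_norm// cosN sinN ca bE.
exists x => // x1 x1E; apply: val_inj.
rewrite cisD x1E -cisD.
have -> : y = x0 + (y - x0) by rewrite addrC subrK.
by rewrite 2!cisD; congr (_ * _); rewrite /= cx sx.
Qed.

(** On the circle this is |t - t0|^2, written as a trigonometric polynomial in t. *)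
Definition dist2 t0 : smoothfun R :=
  (char 1 - val t0 *: (1 : smoothfun R)) * (char (-1) - (val t0)^-1 *: (1 : smoothfun R)).

Lemma dist2E x0 x : dist2 (cis x0) (cis (x0 + x)) = (2 - 2 * cos x)%:C%C.
Proof.
have vE t : dist2 (cis x0) t = (val t - val (cis x0)) * ((val t)^-1 - (val (cis x0))^-1).
  by rewrite -[LHS]/((_ - _ * 1) * (_ - _ * 1)) !mulr1.
rewrite vE.
have -> : (val (cis (x0 + x)))^-1 = val (cis (- (x0 + x))).
  by rewrite -[LHS]/(val (circleV _)) circleV_cis.
have -> : (val (cis x0))^-1 = val (cis (- x0)).
  by rewrite -[LHS]/(val (circleV _)) circleV_cis.
have c1 y : val (cis y) * val (cis (- y)) = 1 :> C.
  by rewrite -cisD subrr; apply/eqP; rewrite eq_complex /= cos0 sin0 !eqxx.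
have c2 : val (cis (x0 + x)) * val (cis (- x0)) = val (cis x) :> C.
  by rewrite -cisD addrAC subrr add0r.
have c3 : val (cis x0) * val (cis (- (x0 + x))) = val (cis (- x)) :> C.
  by rewrite -cisD opprD addrA subrr add0r.
transitivity (val (cis (x0 + x)) * val (cis (- (x0 + x))) -
  val (cis (x0 + x)) * val (cis (- x0)) - val (cis x0) * val (cis (- (x0 + x))) +
  val (cis x0) * val (cis (- x0))).
  by ring.
rewrite !c1 c2 c3; apply/eqP; rewrite eq_complex /= cosN sinN.
by apply/andP; split; apply/eqP; ring.
Qed.

Lemma dist2_def t0 : dist2 t0 =
  (char 1 - val t0 *: (1 : smoothfun R)) * (char (-1) - (val t0)^-1 *: (1 : smoothfun R)).
Proof. exact: erefl. Qed.

Opaque dist2.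

(** Near t0 continuity gives the bound e; away from t0 the squared distance is bounded below, and a
    multiple of it dominates the supremum of |f|. *)
Lemma smooth_dist2_bound f t0 (e : R) : f t0 = 0 -> 0 < e ->
  exists2 B : R, 0 <= B &
    forall t, nc (f t) <= e + B * complex.Re (dist2 t0 t).
Proof.
have [x0 <-] := cis_surj t0 => f0 e0.
have e2 : 0 < e / 2 by exact: divr_gt0.
have cr := @cvgr_dist_lt _ _ _ _ _ _ _ (@cinf_continuous _ _ (cinf_re f) x0) _ e2.
have ci := @cvgr_dist_lt _ _ _ _ _ _ _ (@cinf_continuous _ _ (cinf_im f) x0) _ e2.
have : \near x0, nc (f (cis x0)) <= e.
  near=> x; apply: le_trans (nc_le_ReIm _) _; rewrite (splitr e); apply: lerD.
    have : `|re_on f x0 - re_on f x| < e / 2 by near: x; exact: cr.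
    by rewrite {1}/re_on f0 /= sub0r normrN => /ltW.
  have : `|im_on f x0 - im_on f x| < e / 2 by near: x; exact: ci.
  by rewrite {1}/im_on f0 /= sub0r normrN => /ltW.
move=> /nbhs_ballP[d /= d0 hd].
have [B B0 hB] := smooth_nc_bounded f.
(* The radius is capped at pi because 2 - 2 cos is monotone only on [0, pi]. *)
pose d1 := Num.min d pi.
have d10 : 0 < d1 by rewrite lt_min d0 pi_gt0.
have d1pi : d1 <= pi by rewrite ge_min lexx orbT.
have d1d : d1 <= d by rewrite ge_min lexx.
have w0 : 0 < 2 - 2 * cos d1.
  rewrite -{1}[2]mulr1 -mulrBr mulr_gt0// subr_gt0 -(@cos0 R) ltr_cos//.
    by rewrite in_itv /= lexx pi_ge0.
  by rewrite in_itv /= (ltW d10).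
exists (B / (2 - 2 * cos d1)); first by rewrite divr_ge0// ltW.
move=> t; have [x xpi /(_ x0 erefl) <-] := circle_ratio (cis x0) t.
rewrite dist2E /=.
have w1 : 0 <= 2 - 2 * cos x by rewrite subr_ge0 -[leRHS]mulr1 ler_wpM2l// cos_le1.
have [xd|dx] := ltP `|x| d1.
  apply: (@le_trans _ _ e).
    by apply: hd; rewrite /ball /= opprD addNKr normrN; exact: lt_le_trans d1d.
  by rewrite lerDl mulr_ge0// divr_ge0// ltW.
apply: le_trans (hB _) _; rewrite -[leLHS]add0r; apply: lerD; first exact: ltW.
rewrite mulrAC ler_pdivlMr//; apply: ler_wpM2l => //.
rewrite lerB// ler_wpM2l//.
have -> : cos x = cos `|x| by case: (ger0P x) => _ //; rewrite cosN.
move: dx; rewrite le_eqVlt => /orP[/eqP -> //|dx].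
have i1 : d1 \in `[0, pi] by rewrite in_itv /= (ltW d10).
have i2 : `|x| \in `[0, pi] by rewrite in_itv /= normr_ge0.
by rewrite ltW// ltr_cos.
Unshelve. all: by end_near. Qed.

End Fejer.

(** * Fejer kernels and Fourier inversion with a rate *)

Section Inversion.
Context {R : realType}.
Implicit Types (t : circle R) (f g : smoothfun R) (m : int).
Local Notation C := R[i].
Local Notation nc := (@Normc.normc R).

Lemma smooth_mulE f g t : (f * g) t = f t * g t. Proof. exact: erefl. Qed.

Lemma smooth_addE f g t : (f + g) t = f t + g t. Proof. exact: erefl. Qed.

Lemma smooth_oppE f t : (- f) t = - f t. Proof. exact: erefl. Qed.

Lemma smooth_scaleE (c : C) f t : (c *: f) t = c * f t. Proof. exact: erefl. Qed.

Lemma smooth_oneE t : (1 : smoothfun R) t = 1. Proof. exact: erefl. Qed.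

Lemma charE m t : char m t = val t ^ m. Proof. exact: erefl. Qed.

Lemma smooth_sumE n (F : 'I_n -> smoothfun R) t :
  (\sum_(i < n) F i) t = \sum_(i < n) F i t.
Proof.
elim: n F => [|n IH] F; first by rewrite !big_ord0.
by rewrite !big_ord_recl smooth_addE IH.
Qed.

Lemma smeanB f g : smean (f - g) = smean f - smean g.
Proof. exact: linearB. Qed.

Lemma conj_circle t m : ((val t) ^ m)^*%C = (val t) ^ (- m).
Proof.
have h : (val t)^*%C = (val t)^-1.
  apply: (mulfI (circle_neq0 t)); rewrite mulfV ?circle_neq0// -sqr_normc.
  by rewrite (eqP (valP t)) expr1n.
by rewrite -exprz_inv -h; case: m => n; rewrite ?NegzE ?fmorphV rmorphXn.
Qed.

(* The Fejer kernel at t0 is the square modulus of [fejP] divided by [M]. *)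
Definition fejP t0 (M : nat) : smoothfun R :=
  \sum_(j < M) (val t0 ^ (- j%:Z)) *: char j%:Z.
Definition fejQ t0 (M : nat) : smoothfun R :=
  \sum_(j < M) (val t0 ^ j%:Z) *: char (- j%:Z).

Lemma fejPQE t0 M t : (fejP t0 M * fejQ t0 M) t = (nc (fejP t0 M t) ^+ 2)%:C%C.
Proof.
rewrite smooth_mulE rmorphXn /= -normcE' sqr_normc; congr (_ * _).
rewrite !smooth_sumE rmorph_sum; apply: eq_bigr => j _.
rewrite -[RHS]/((val t0 ^ (- j%:Z) * val t ^ j%:Z)^*%C) rmorphM /=.
by rewrite !conj_circle opprK.
Qed.

Lemma smean_fej f t0 M : smean (f * (fejP t0 M * fejQ t0 M)) =
  \sum_(m < M) zsum m (fun k => fc f k * val t0 ^ k).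
Proof.
rewrite -cesaro_double_sum /fejP /fejQ mulr_suml mulr_sumr linear_sum /=.
apply: eq_bigr => j _; rewrite mulr_sumr mulr_sumr linear_sum /=.
apply: eq_bigr => l _; rewrite scale_mulAl !scale_mulAr smeanZ smeanZ -charD.
have -> : char (j%:Z - l%:Z) = char (- (l%:Z - j%:Z)) :> smoothfun R by rewrite opprB.
rewrite -/(fc _ _) mulrA -expfzDr ?circle_neq0// mulrC; congr (_ * _ ^ _).
by rewrite addrC.
Qed.

Lemma geometric_telescope (z w : C) M : z != 0 ->
  (w - z) * (\sum_(j < M) z ^- j * w ^+ j) = z * (z ^- M * w ^+ M - 1).
Proof.
move=> z0; elim: M => [|M IH].
  by rewrite big_ord0 mulr0 !expr0 invr1 mulr1 subrr mulr0.
by rewrite big_ord_recr mulrDr IH !exprS; field; rewrite z0 expf_neq0.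
Qed.

Lemma fejP_telescope t0 M : (char 1 - val t0 *: (1 : smoothfun R)) * fejP t0 M =
  val t0 *: ((val t0 ^ (- M%:Z)) *: char M%:Z - 1).
Proof.
apply: val_inj; apply/funext => t.
rewrite -[LHS]/((val t ^ 1 - val t0 * 1) * fejP t0 M t) mulr1.
rewrite -[RHS]/(val t0 * (val t0 ^ (- M%:Z) * val t ^ M%:Z - 1)) smooth_sumE.
rewrite -exprnN -(geometric_telescope _ _ (circle_neq0 t0)); congr (_ * _).
by apply: eq_bigr => j _; rewrite smooth_scaleE charE -exprnN.
Qed.

Lemma fejQ_telescope t0 M : (char (-1) - (val t0)^-1 *: (1 : smoothfun R)) * fejQ t0 M =
  (val t0)^-1 *: ((val t0 ^ M%:Z) *: char (- M%:Z) - 1).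
Proof.
have z0 : (val t0)^-1 != 0 by rewrite invr_eq0 circle_neq0.
apply: val_inj; apply/funext => t.
rewrite -[LHS]/((val t ^ (-1) - (val t0)^-1 * 1) * fejQ t0 M t) mulr1.
rewrite -[RHS]/((val t0)^-1 * (val t0 ^ M%:Z * val t ^ (- M%:Z) - 1)) smooth_sumE.
have eP (n : nat) : val t0 ^ n%:Z * val t ^ (- n%:Z) = (val t0)^-1 ^- n * (val t)^-1 ^+ n.
  by rewrite -exprnP -exprnN !exprVn invrK.
rewrite eP exprN1 -(geometric_telescope _ _ z0); congr (_ * _).
by apply: eq_bigr => j _; rewrite smooth_scaleE charE eP.
Qed.

(** Multiplied by |t - t0|^2, the unnormalized kernel of order n = M + 1 collapses to |(t/t0)^n -
    1|^2, of mean 2 for every such n, while the kernel itself has mean n. This expresses its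
    concentration at t0. *)
Lemma smean_fej_dist2 t0 M : smean (dist2 t0 * (fejP t0 M.+1 * fejQ t0 M.+1)) = 2.
Proof.
have t00 := circle_neq0 t0.
rewrite dist2_def mulrACA fejP_telescope fejQ_telescope scale_mulAl scale_mulAr.
rewrite scalerA mulfV// scale1r mulrBl !mulrBr !mul1r !mulr1.
rewrite scale_mulAl scale_mulAr scalerA -expfzDr// -charD addNr subrr expr0z scale1r char0.
rewrite !smeanB !smeanZ !smean_char smean1 /=.
by rewrite !mulr0 subr0 sub0r opprK.
Qed.

Lemma zsum_fc1 t0 M :
  \sum_(m < M) zsum m (fun k => fc 1 k * val t0 ^ k) = M%:R :> C.
Proof.
rewrite (eq_bigr (fun=> 1)) ?sumr_const ?card_ord// => m _.
have f1 k : fc 1 k = (0 == k)%:R :> C by rewrite -char0 fc_char.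
rewrite /zsum f1 eqxx expr0z mul1r big1 ?addr0// => i _; rewrite !f1.
have -> : (0 == i.+1%:Z) = false by [].
have -> : (0 == - i.+1%:Z) = false by [].
by rewrite !mul0r addr0.
Qed.

Lemma smean_fej_le f t0 M (e B : R) : 0 <= B ->
  (forall t, nc (f t) <= e + B * complex.Re (dist2 t0 t)) ->
  nc (smean (f * (fejP t0 M.+1 * fejQ t0 M.+1))) <= 2 * (e * M.+1%:R + 2 * B).
Proof.
move=> B0 h; set PQ := fejP _ _ * _.
pose g := (e%:C%C *: (1 : smoothfun R) + B%:C%C *: dist2 t0) * PQ.
have gm : smean g = (e * M.+1%:R + 2 * B)%:C%C.
  have PQm : smean PQ = M.+1%:R.
    by rewrite -[PQ]mul1r smean_fej zsum_fc1.
  rewrite /g mulrDl smeanD !scale_mulAl !smeanZ mul1r PQm smean_fej_dist2.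
  by rewrite rmorphD !rmorphM !rmorph_nat [2 * _]mulrC.
have -> : e * M.+1%:R + 2 * B = complex.Re (smean g) by rewrite gm.
apply: smean_dominated => x.
have PQx := fejPQE t0 M.+1 (cis x).
set r := nc _ ^+ 2 in PQx; have r0 : 0 <= r by rewrite sqr_ge0.
have gE : re_on g x = (e + B * complex.Re (dist2 t0 (cis x))) * r.
  rewrite /re_on /g smooth_mulE PQx smooth_addE !smooth_scaleE smooth_oneE mulr1.
  by case: (dist2 t0 (cis x)) => a b /=; rewrite !mul0r !mulr0 !subr0.
have fr : re_on (f * PQ) x = re_on f x * r.
  by rewrite /re_on smooth_mulE PQx; case: (f _) => a b /=; rewrite mulr0 subr0.
have fi : im_on (f * PQ) x = im_on f x * r.
  by rewrite /im_on smooth_mulE PQx; case: (f _) => a b /=; rewrite mulr0 add0r.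
have nr (y r' : R) : 0 <= r' -> `|y * r'| = `|y| * r'.
  by move=> r'0; rewrite normrM (ger0_norm r'0).
rewrite gE fr fi (nr _ _ r0) (nr _ _ r0); split; apply: ler_wpM2r => //.
  exact: le_trans (Re_le_nc _) (h _).
exact: le_trans (Im_le_nc _) (h _).
Qed.

Lemma sum_indicator_le (M n : nat) (b : R) : 0 <= b ->
  \sum_(m < M) (if (m < n)%N then b else 0) <= n%:R * b.
Proof.
move=> b0; apply: (@le_trans _ _ ((minn M n)%:R * b)); last first.
  by rewrite ler_wpM2r// ler_nat geq_minr.
elim: M => [|M IH]; first by rewrite big_ord0 min0n mul0r.
rewrite big_ord_recr /=; case: ltnP => Mn.
  have -> : minn M.+1 n = (minn M n).+1 by lia.
  by rewrite -natr1 mulrDl mul1r lerD2r.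
by rewrite addr0; have -> : minn M.+1 n = minn M n by lia.
Qed.

(** The partial sums of order at least n all lie within E of the one of order n, and their Cesaro
    means tend to f(t0) by concentration of the kernel. Letting the order M of the means grow
    removes both the kernel error and the contribution of the first n partial sums. *)
Lemma fourier_rate f (q : nat) (B : R) t0 (n : nat) :
  (forall m, nc (fc f m) * (`|m|%N.+1)%:R ^+ q.+2 <= B) ->
  nc (f t0 - zsum n (fun m => fc f m * val t0 ^ m)) <= 2 * B / n.+1%:R ^+ q.+1.
Proof.
move=> hB; set c := fun m => _.
have B0 : 0 <= B.
  by apply: le_trans (hB 0); rewrite mulr_ge0 ?nc_ge0 ?exprn_ge0.
have hc m : nc (c m) * (`|m|%N.+1)%:R ^+ q.+2 <= B.
  by rewrite ncM -charE nc_char mulr1.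
set E := 2 * B / _.
have E0 : 0 <= E by rewrite divr_ge0 ?mulr_ge0 ?exprn_ge0.
apply/ler_addgt0Pr => d d0.
pose g := f t0 *: (1 : smoothfun R) - f.
have g0 : g t0 = 0.
  by rewrite smooth_addE smooth_oppE smooth_scaleE smooth_oneE mulr1 subrr.
have d4 : 0 < d / 4 by exact: divr_gt0.
have [D D0 hD] := smooth_dist2_bound g0 d4.
(* [T] collects what is to be divided by M: the kernel term and the n early partial sums. M makes
   this at most d/2; the other d/2 is twice the d/4 allowed near t0. *)
pose T := 4 * D + n%:R * (2 * B).
have T0 : 0 <= T by rewrite addr_ge0 ?mulr_ge0.
pose M := Num.bound (T / (d / 2)).
have hM : T <= d / 2 * M.+1%:R.
  rewrite mulrC -ler_pdivrMr ?divr_gt0//; apply: le_trans (ltW (archi_boundP _)) _.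
    by rewrite divr_ge0// ltW// divr_gt0.
  by rewrite ler_nat leqnSn.
have M0 : 0 < M.+1%:R :> R by [].
have := smean_fej_le M D0 hD.
rewrite mulrBl smeanB scale_mulAl smeanZ !smean_fej.
rewrite (zsum_fc1 t0 M.+1).
move=> h1; have {}h1 : nc (f t0 * M.+1%:R - \sum_(m < M.+1) zsum m c) <=
  2 * (d / 4 * M.+1%:R + 2 * D) by exact: h1.
have h2 : nc (\sum_(m < M.+1) (zsum m c - zsum n c)) <= M.+1%:R * E + n%:R * (2 * B).
  apply: le_trans (nc_sum _ _ _) _.
  apply: (@le_trans _ _ (\sum_(m < M.+1) (E + if (m < n)%N then 2 * B else 0))).
    apply: ler_sum => m _; case: ltnP => mn.
      rewrite -ncN opprB -[n](subnKC (ltnW mn)).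
      apply: le_trans (zsum_tail _ _ hc) _; apply: ler_wpDl => //.
      rewrite ler_pdivrMr ?exprn_gt0// ler_peMr ?mulr_ge0//.
      by rewrite exprn_ege1// ler1n.
    rewrite addr0 -[m in zsum m c](subnKC mn).
    exact: zsum_tail.
  rewrite big_split /=; apply: lerD; last exact/sum_indicator_le/mulr_ge0.
  by rewrite sumr_const card_ord [leRHS]mulr_natl.
rewrite sumrB sumr_const card_ord in h2.
have h3 : nc (M.+1%:R * (f t0 - zsum n c)) <= M.+1%:R * (E + d).
  have -> : M.+1%:R * (f t0 - zsum n c) = (f t0 * M.+1%:R - \sum_(m < M.+1) zsum m c) +
     (\sum_(m < M.+1) zsum m c - zsum n c *+ M.+1).
    by rewrite addrA subrK mulrBr mulrC mulr_natl.
  apply: le_trans (ncD _ _) _; apply: le_trans (lerD h1 h2) _.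
  move: hM; rewrite /T; nra.
by move: h3; rewrite ncM nc_nat ler_pM2l.
Qed.

End Inversion.

(** * Distributions tested on Fourier series *)

Section FourierSeries.
Context {R : realType}.
Implicit Types (t : circle R) (f g : smoothfun R) (m k : int) (a b : distr R).
Local Notation C := R[i].
Local Notation nc := (@Normc.normc R).

Lemma le0_of_decay (x B : R) : (forall n : nat, x <= B / n.+1%:R) -> x <= 0.
Proof.
move=> h; rewrite leNgt; apply/negP => x0.
have B0 : 0 <= B.
  by have := le_trans (ltW x0) (h 0%N); rewrite divr1.
have := h (Num.bound (B / x)); rewrite ler_pdivlMr// mulrC -ler_pdivlMr//.
have := archi_boundP (divr_ge0 B0 (ltW x0)).
rewrite -natr1; set b := _%:R; lra.
Qed.

(** The inversion rate is applied to the difference with B = 0. *)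
Lemma fc_inj f g : fc f =1 fc g -> f = g.
Proof.
move=> fg; apply/eqP; rewrite -subr_eq0; apply/eqP.
have h0 m : fc (f - g) m = 0.
  by rewrite -scaleN1r fcD fcZ mulN1r fg subrr.
apply: val_inj; apply/funext => t.
have h m : nc (fc (f - g) m) * (`|m|%N.+1)%:R ^+ 2 <= 0 by rewrite h0 nc0 mul0r.
have := fourier_rate t 0 h; rewrite zsum0 h0 mul0r subr0 mulr0 mul0r => h1.
by apply: nc_eq0; apply/eqP; rewrite eq_le h1 nc_ge0.
Qed.

Definition fsum n f : smoothfun R := fc f 0 *: char 0 +
  \sum_(i < n) (fc f i.+1%:Z *: char i.+1%:Z + fc f (- i.+1%:Z) *: char (- i.+1%:Z)).

Lemma fsum0 f : fsum 0 f = fc f 0 *: char 0.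
Proof. by rewrite /fsum big_ord0 addr0. Qed.

Lemma fsumS n f : fsum n.+1 f = fsum n f +
  (fc f n.+1%:Z *: char n.+1%:Z + fc f (- n.+1%:Z) *: char (- n.+1%:Z)).
Proof. by rewrite /fsum big_ord_recr /= addrA. Qed.

Lemma fsumE n f t : fsum n f t = zsum n (fun m => fc f m * val t ^ m).
Proof.
elim: n => [|n IH]; first by rewrite fsum0 zsum0 smooth_scaleE.
by rewrite fsumS zsumS smooth_addE IH smooth_addE !smooth_scaleE !charE.
Qed.

Lemma dangle_fsum n f : dangle (fsum n f) = fsum n (dangle f).
Proof.
have h m : dangle (fc f m *: char m) = fc (dangle f) m *: char m.
  by rewrite dangleZ dangle_char scalerA fc_dangle mulrC.
elim: n => [|n IH]; first by rewrite !fsum0 h.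
by rewrite !fsumS dangleD IH dangleD !h.
Qed.

Lemma dangleB f g : dangle (f - g) = dangle f - dangle g.
Proof. by rewrite -scaleN1r dangleD dangleZ scaleN1r. Qed.

(** Truncation of the Fourier series commutes with [dangle], so each derivative of the remainder is
    the remainder of a derivative. *)
Lemma fsum_rate f (M q : nat) : exists2 B : R, 0 <= B &
  forall n, deriv_bounded M (B / n.+1%:R ^+ q) (f - fsum n f).
Proof.
have h1 g : exists2 B : R, 0 <= B &
    forall n t, nc (g t - fsum n g t) <= B / n.+1%:R ^+ q.
  have [B B0 hB] := fc_decay g q.+2.
  exists (2 * B); first exact: mulr_ge0.
  move=> n t; rewrite fsumE; apply: le_trans (fourier_rate t n hB) _.
  rewrite ler_wpM2l ?mulr_ge0// lef_pV2 ?posrE ?exprn_gt0//.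
  by rewrite exprS ler_peMl ?exprn_ge0// ler1n.
have it i n : iter i dangle (f - fsum n f) = iter i dangle f - fsum n (iter i dangle f).
  elim: i => [|i IH]; first exact: erefl.
  apply: (etrans (congr1 dangle IH)); rewrite dangleB dangle_fsum; exact: erefl.
have bnd i : exists2 B : R, 0 <= B & forall n x,
    `|(re_on (f - fsum n f))^`(i) x| <= B / n.+1%:R ^+ q /\
    `|(im_on (f - fsum n f))^`(i) x| <= B / n.+1%:R ^+ q.
  have [B B0 hB] := h1 (iter i dangle f); exists B => // n x.
  rewrite -re_iter_dangle -im_iter_dangle it.
  by split; [apply: le_trans (Re_le_nc _) _|apply: le_trans (Im_le_nc _) _]; exact: hB.
have mono (B1 B2 : R) n : B1 <= B2 -> B1 / n.+1%:R ^+ q <= B2 / n.+1%:R ^+ q.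
  by move=> h; rewrite ler_wpM2r// invr_ge0 exprn_ge0.
elim: M => [|M [B1 B10 hB1]].
  have [B B0 hB] := bnd 0%N; exists B => // n i x; rewrite leqn0 => /eqP ->.
  exact: hB.
have [B2 B20 hB2] := bnd M.+1.
exists (B1 + B2); first exact: addr_ge0.
move=> n i x; rewrite leq_eqVlt => /orP[/eqP ->|iM].
  have [u v] := hB2 n x.
  by split; [apply: le_trans u _|apply: le_trans v _]; apply: mono; rewrite lerDr.
have [u v] := hB1 n i x iM.
by split; [apply: le_trans u _|apply: le_trans v _]; apply: mono; rewrite lerDl.
Qed.

Lemma deriv_bounded_char M k : deriv_bounded M ((`|k|%N.+1)%:R ^+ M) (char k : smoothfun R).
Proof.
have it i : iter i dangle (char k) = ('i%C * k%:~R) ^+ i *: char k :> smoothfun R.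
  elim: i => [|i IH]; first by rewrite expr0 scale1r.
  by rewrite iterS IH dangleZ dangle_char scalerA -exprSr.
have ni : nc 'i%C = 1 :> R by rewrite /= expr0n /= add0r expr1n sqrtr1.
have h i t : (i <= M)%N -> nc ((iter i dangle (char k)) t) <= (`|k|%N.+1)%:R ^+ M.
  move=> iM; rewrite it smooth_scaleE ncM nc_char mulr1 ncX ncM ni mul1r nc_int.
  apply: (@le_trans _ _ ((`|k|%N.+1)%:R ^+ i)).
    by rewrite lerXn2r ?nnegrE// ler_nat.
  by rewrite ler_weXn2l// ler1n.
move=> i x iM; rewrite -re_iter_dangle -im_iter_dangle; split.
  exact: le_trans (Re_le_nc _) (h _ _ iM).
exact: le_trans (Im_le_nc _) (h _ _ iM).
Qed.

Lemma distr_fsum a n f k :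
  a (fsum n f * char (- k)) = zsum n (fun m => fc f m * fcoef a (k - m)).
Proof.
have h m : a ((fc f m *: char m) * char (- k)) = fc f m * fcoef a (k - m).
  rewrite scale_mulAl linearZ /= -charD /fcoef; congr (_ * a (char _)).
  by rewrite opprB.
elim: n => [|n IH]; first by rewrite fsum0 zsum0 h.
by rewrite fsumS zsumS mulrDl linearD IH mulrDl linearD /= !h.
Qed.

Lemma distr_normE a : exists M : nat, exists2 c : R, 0 <= c &
  forall f (B : R), deriv_bounded M B f -> nc (a f) <= c * B.
Proof.
have [M [c hc]] := distr_continuous a.
exists M, `|c| => // f B hB; apply: le_trans (hc f B hB) _.
apply: ler_wpM2r; last exact: ler_norm.
by have [h _] := hB 0%N 0 isT; exact: le_trans h.
Qed.

Lemma fcoef_moderate a : exists p : nat, exists2 B : R, 0 <= B &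
  forall k, nc (fcoef a k) <= B * (`|k|%N.+1)%:R ^+ p.
Proof.
have [M [c c0 hc]] := distr_normE a; exists M, c => // k.
by apply: hc; rewrite -abszN; exact: deriv_bounded_char.
Qed.

(** The exponent p is the order of the distribution and comes from the derivatives of [char (- k)].
    Since q is chosen after p, the error is beyond all orders as long as k stays O(n). *)
Lemma distr_convolution a f : exists p : nat, forall q : nat, exists2 B : R, 0 <= B &
  forall n k, nc (a (f * char (- k)) - zsum n (fun m => fc f m * fcoef a (k - m)))
    <= B * (`|k|%N.+1)%:R ^+ p / n.+1%:R ^+ q.
Proof.
have [M [c c0 hc]] := distr_normE a; exists M => q.
have [B B0 hB] := fsum_rate f M q.
exists (c * (2 * 2 ^+ M * B)); first by rewrite !mulr_ge0// exprn_ge0.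
move=> n k; rewrite -distr_fsum.
have -> : a (f * char (- k)) - a (fsum n f * char (- k)) =
    a ((f - fsum n f) * char (- k)) by rewrite mulrBl linearB.
apply: le_trans (hc _ _ (deriv_boundedM (hB n) (deriv_bounded_char (- k)))) _.
by rewrite abszN le_eqVlt; apply/orP; left; apply/eqP; ring.
Qed.

Lemma distr_ext a b : fcoef a =1 fcoef b -> forall f, a f = b f.
Proof.
move=> ab f.
have [p /(_ 1%N)[B B0 hB]] := distr_convolution a f.
have [p' /(_ 1%N)[B' B'0 hB']] := distr_convolution b f.
have e0 : f * char (- 0) = f by rewrite oppr0 char0 mulr1.
apply/eqP; rewrite -subr_eq0; apply/eqP/nc_eq0/eqP.
rewrite eq_le nc_ge0 andbT; apply: (@le0_of_decay _ (B + B')) => n.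
have h1 := hB n 0; have h2 := hB' n 0.
rewrite e0 expr1 absz0 expr1n mulr1 in h1; rewrite e0 expr1 absz0 expr1n mulr1 in h2.
rewrite mulrDl; apply: le_trans (lerD h1 h2).
rewrite -[X in _ <= _ + X]ncN opprB; apply: le_trans (ncD _ _).
rewrite (@eq_zsum _ n (fun m => fc f m * fcoef b (0 - m)) (fun m => fc f m * fcoef a (0 - m))).
  by rewrite addrA subrK.
by move=> m; rewrite ab.
Qed.

Lemma smean_continuous : dist_continuous (@smean R).
Proof.
exists 0%N, 4 => f B hB.
have -> : 4 * B = 2 * (B + B) by ring.
apply: smean_le => t; have [x <-] := cis_surj t; have [h1 h2] := hB 0%N x isT.
by apply: le_trans (nc_le_ReIm _) _; exact: lerD.
Qed.

Definition mean_distr : distr R := Distr smean_continuous.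

Lemma mean_distrE f : mean_distr f = smean f. Proof. exact: erefl. Qed.

Lemma fcoef_mean k : fcoef mean_distr k = (k == 0)%:R.
Proof. by rewrite /fcoef mean_distrE smean_char oppr_eq0. Qed.

(** The mean is a distribution with even Fourier coefficients, so no change of variables in the
    integral is needed. *)
Lemma smean_flip f : smean (flip f) = smean f.
Proof.
have := @distr_ext (dtilde mean_distr) mean_distr _ f; apply => k.
by rewrite fcoef_tilde !fcoef_mean oppr_eq0.
Qed.

Lemma flipM f g : flip (f * g) = flip f * flip g. Proof. exact: val_inj. Qed.

Lemma flip_char k : flip (char k) = char (- k) :> smoothfun R.
Proof. by apply: val_inj; apply/funext => t /=; rewrite exprz_inv. Qed.

Lemma flipK f : flip (flip f) = f.
Proof.
apply: val_inj; apply/funext => t /=; congr (smoothfun_val f _).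
by apply: val_inj; rewrite /= invrK.
Qed.

Lemma fc_flip f k : fc (flip f) k = fc f (- k).
Proof.
have fcE g j : fc g j = smean (g * char (- j)) by exact: erefl.
by rewrite !fcE -smean_flip flipM flipK flip_char.
Qed.

End FourierSeries.

(** * Local data of the distributions *)

Section SmoothParts.
Context {R : realType}.
Implicit Types (t : circle R) (f g psi u : smoothfun R) (k m : int) (a b : distr R).
Implicit Types (K : set (circle R)) (s : circle R -> R[i]).

Lemma vanishes_nearM K f g : vanishes_near K f -> vanishes_near K (f * g).
Proof.
move=> [U [oU KU h]]; exists U; split; [exact: oU|exact: KU|].
by move=> t /h f0; rewrite smooth_mulE f0 mul0r.
Qed.

Lemma smeanE f : smean f = mean f. Proof. exact: erefl. Qed.

Lemma fcE f k : fc f k = smean (f * char (- k)). Proof. exact: erefl. Qed.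

Lemma smooth_part_mul K a s f u g : smooth_part K a s -> vanishes_near K f ->
  (forall t, u t = s t * f t) -> a (f * g) = smean (u * g).
Proof.
move=> [_ h] vf uE; rewrite (h _ (vanishes_nearM g vf)) smeanE; congr (mean _).
by apply/funext => t; rewrite !smooth_mulE uE mulrA.
Qed.

Lemma smooth_part_fc K a s f u k : smooth_part K a s -> vanishes_near K f ->
  (forall t, u t = s t * f t) -> a (f * char (- k)) = fc u k.
Proof. by move=> sa vf uE; rewrite (smooth_part_mul _ sa vf uE). Qed.

Lemma flip_evenP f : (forall t, f (circleV t) = f t) -> flip f = f.
Proof. by move=> h; apply: val_inj; apply/funext => t; exact: h. Qed.

Lemma circleVK t : circleV (circleV t) = t.
Proof. by apply: val_inj; rewrite /= invrK. Qed.

(** The last identity is the factorization of a multiplied by [psi]. It makes sense because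
    [flip beta] also vanishes near [K]: evenness of [psi] lets the flip pass from [ap] to [beta]. *)
Lemma factor_local_data K a ap s sp psi : open (~` K) ->
  (forall t, K t <-> K (circleV t)) ->
  smooth_part K a s -> smooth_part K ap sp ->
  (forall t, ~ K t -> s t = sp t * sp (circleV t)) ->
  vanishes_near K psi -> flip psi = psi ->
  exists alpha beta : smoothfun R,
  [/\ forall t, alpha t = s t * psi t, forall t, beta t = sp t * psi t,
      flip alpha = alpha &
   [/\ forall k, a (psi * char (- k)) = fc alpha k,
      forall k, ap (psi * char (- k)) = fc beta k &
      forall k, dtilde ap (beta * char (- k)) = fc alpha k]].
Proof.
move=> oK symK sa sap ssp vpsi epsi.
have [alpha alphaE] := smooth_off_mul oK sa.1 vpsi.
have [beta betaE] := smooth_off_mul oK sap.1 vpsi.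
have psiV t : psi (circleV t) = psi t by rewrite -[in RHS]epsi.
have psi0 t : K t -> psi t = 0 by have [U [_ KU h]] := vpsi => /KU/h.
have alpha_even : flip alpha = alpha.
  apply: flip_evenP => t; rewrite !alphaE psiV.
  have [Kt|nKt] := pselect (K t); first by rewrite psi0// !mulr0.
  have nKt' : ~ K (circleV t) by rewrite -symK.
  by rewrite (ssp _ nKt) (ssp _ nKt') circleVK [sp t * _]mulrC.
exists alpha, beta; split => //; split=> k.
- exact: smooth_part_fc sa vpsi alphaE.
- exact: smooth_part_fc sap vpsi betaE.
- have -> : dtilde ap (beta * char (- k)) = ap (flip beta * char (- (- k))).
    by rewrite -[LHS]/(ap (flip _)) flipM flip_char.
  rewrite -[RHS](congr1 (fun h => fc h k) alpha_even) fc_flip.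
  apply: (smooth_part_fc _ sap).
    have [U [oU KU h]] := vpsi; exists U; split; [exact: oU|exact: KU|].
    by move=> t /h pt; rewrite -[LHS]/(beta (circleV t)) betaE psiV pt mulr0.
  move=> t; rewrite -[flip beta t]/(beta (circleV t)) betaE alphaE psiV mulrA.
  have [Kt|nKt] := pselect (K t); first by rewrite psi0// !mulr0.
  by rewrite ssp.
Qed.

Lemma sigma_1B (s : distr R) f : is_sigma s ->
  s ((1 - char 1) * f) = smean ((1 + char 1) * f).
Proof.
move=> hs.
have := @distr_ext _ (dmul (1 - char 1) s) (dmul (1 + char 1) (@mean_distr R)) _ f.
apply => k.
rewrite -[LHS]/(s ((1 - char 1) * char (- k))) -[RHS]/(smean ((1 + char 1) * char (- k))).
rewrite mulrBl mulrDl !mul1r -charD linearB smeanD !smean_char /=.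
have -> : char (1 - k) = char (- (k - 1)) :> smoothfun R by rewrite opprB.
rewrite -!/(fcoef _ _) !hs oppr_eq0 subr_eq0.
have [->|k0] := eqVneq k 0; first by rewrite sgr0 !sub0r sgrN sgr1 opprK addr0.
rewrite [1 == k]eq_sym; have [->|k1] := eqVneq k 1; first by rewrite subrr sgr0 sgr1 subr0 add0r.
rewrite addr0; have -> : Num.sg (k - 1) = Num.sg k :> int by lia.
by rewrite subrr.
Qed.

Lemma sigma_flip (s : distr R) f : is_sigma s -> s (flip f) = - s f.
Proof.
move=> hs; have := @distr_ext _ (dtilde s) (dmul ((-1) *: (1 : smoothfun R)) s) _ f.
rewrite -[dtilde s f]/(s (flip f)) -[dmul _ _ _]/(s (_ * f)) scale_mulAl mul1r.
have sN g : s ((-1) *: g) = - s g by rewrite scaleN1r linearN.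
rewrite sN; apply => k.
rewrite fcoef_tilde -[RHS]/(s (_ * char (- k))) scale_mulAl mul1r sN.
by rewrite -/(fcoef _ _) !hs sgrN rmorphN.
Qed.

End SmoothParts.

(** * The product of a with sigma *)

Section SigmaProduct.
Context {R : realType}.
Implicit Types (t : circle R) (f g psi u : smoothfun R) (k m : int).
Local Notation C := R[i].
Local Notation nc := (@Normc.normc R).
Context (K : set (circle R)) (a sigma c : distr R) (s : circle R -> C).
Context (sa : smooth_part K a s) (hs : is_sigma sigma)
  (hc : dist_product K [set circle1] a sigma c).

Lemma sigma_product_1B f : c ((1 - char 1) * f) = a ((1 + char 1) * f).
Proof.
have [s1 [s2 [fa [fb [u [v [[ha hb] [va vb] fab [uE vE] cE]]]]]]] := hc.
(* Here [u] is the smooth part of sigma times [fb], so this is (1 - t) sigma = 1 + t localized by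
   [fb]. *)
have u1 : u * (1 - char 1) = (1 + char 1) * fb.
  apply: fc_inj => k; rewrite !fcE -mulrA -(smooth_part_mul _ hb vb uE).
  by rewrite mulrCA sigma_1B// mulrA.
rewrite cE -[dmul u a _]/(a (u * _)) -[dmul v sigma _]/(sigma (v * _)).
rewrite mulrA u1 mulrCA sigma_1B// [_ * (v * f)]mulrCA -(smooth_part_mul _ ha va vE).
rewrite -linearD /= mulrCA -mulrA -mulrDr; congr (a (_ * _)).
by rewrite -mulrDl addrC fab mul1r.
Qed.

Lemma sigma_product_rec k :
  fcoef c k - fcoef c (k - 1) = fcoef a k + fcoef a (k - 1).
Proof.
have := sigma_product_1B (char (- k)).
rewrite mulrBl mulrDl !mul1r -charD linearB linearD /=.
by have -> : char (1 - k) = char (- (k - 1)) :> smoothfun R by rewrite opprB.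
Qed.

(** On such a [psi] the product is sigma evaluated at the smooth function s psi; sigma is odd and s
    psi is even. *)
Lemma sigma_product_even_off psi : open (~` K) -> vanishes_near K psi ->
  (forall u, (forall t, u t = s t * psi t) -> flip u = u) -> c psi = 0.
Proof.
move=> oK vpsi aeven.
have [s1 [s2 [fa [fb [u [v [[ha hb] [va vb] fab [uE vE] cE]]]]]]] := hc.
have [al alE] := smooth_off_mul oK sa.1 vpsi.
have [al1 al1E] := smooth_off_mul oK ha.1 vpsi.
have all : al1 = al.
  apply: fc_inj => k.
  by rewrite -(smooth_part_fc _ ha vpsi al1E) -(smooth_part_fc _ sa vpsi alE).
rewrite cE -[dmul u a _]/(a (u * _)) -[dmul v sigma _]/(sigma (v * _)).
rewrite [u * psi]mulrC (smooth_part_mul _ sa vpsi alE) mulrC.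
rewrite -(smooth_part_mul _ hb vb uE).
have -> : v * psi = fa * al.
  apply: val_inj; apply/funext => t.
  by rewrite -all -[LHS]/(v t * psi t) -[RHS]/(fa t * al1 t) vE al1E mulrAC mulrA [fa t * _]mulrC mulrAC.
rewrite -linearD /= -mulrDl addrC fab mul1r.
have := sigma_flip al hs; rewrite (aeven _ alE) => /eqP.
by rewrite -subr_eq0 opprK -mulr2n mulrn_eq0 => /eqP.
Qed.

Context (a_even : dist_even a).

Lemma fcoef_even k : fcoef a (- k) = fcoef a k.
Proof. by rewrite -fcoef_tilde; exact: a_even. Qed.

(** By evenness of [a], the recurrence gives the coefficients of [c] the same increment from n to n
    + 1 as from -n-1 to -n. *)
Lemma sigma_product_sym (n : nat) : fcoef c n%:Z + fcoef c (- n%:Z) = fcoef c 0 *+ 2.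
Proof.
elim: n => [|n IH]; first by rewrite oppr0 mulr2n.
have h1 := sigma_product_rec n.+1%:Z; have h2 := sigma_product_rec (- n%:Z).
have e1 : n.+1%:Z - 1 = n%:Z by lia.
have e2 : - n%:Z - 1 = - n.+1%:Z by lia.
rewrite e1 in h1; rewrite e2 !fcoef_even [RHS]addrC -h1 in h2.
rewrite -IH; apply/eqP; rewrite -subr_eq0; apply/eqP.
transitivity ((fcoef c n.+1%:Z - fcoef c n%:Z) - (fcoef c (- n%:Z) - fcoef c (- n.+1%:Z))).
  by ring.
by rewrite h2 subrr.
Qed.

(** Parity gives c(psi) = 0. Expanded in Fourier coefficients, with psi even and c_m + c_-m = 2 c_0,
    the same number is psi(1) c_0 = c_0. *)
Lemma sigma_product_0 psi : open (~` K) -> vanishes_near K psi -> flip psi = psi ->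
  psi circle1 = 1 ->
  (forall u, (forall t, u t = s t * psi t) -> flip u = u) -> fcoef c 0 = 0.
Proof.
move=> oK vpsi epsi psi1 aeven.
have c0 := sigma_product_even_off oK vpsi aeven.
have [p /(_ 1%N)[B B0 hB]] := distr_convolution c psi.
have [B' B'0 hB'] := fc_decay psi 2.
have fcV m : fc psi (- m) = fc psi m by rewrite -fc_flip epsi.
have key n : zsum n (fun m => fc psi m * fcoef c (0 - m)) =
    zsum n (fun m => fc psi m) * fcoef c 0.
  elim: n => [|n IH]; first by rewrite !zsum0 oppr0.
  rewrite zsumS IH zsumS [RHS]mulrDl; congr (_ + _).
  rewrite !sub0r opprK fcV -mulrDr [X in _ * X]addrC sigma_product_sym.
  by rewrite -mulr_natr; ring.
apply/nc_eq0/eqP; rewrite eq_le nc_ge0 andbT.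
apply: (@le0_of_decay _ _ (B + 2 * B' * nc (fcoef c 0))) => n.
have h1 := hB n 0; rewrite oppr0 char0 mulr1 c0 sub0r ncN key absz0 expr1n mulr1 expr1 in h1.
have h2 := fourier_rate circle1 n hB'.
have one1 m : fc psi m * val (@circle1 R) ^ m = fc psi m by rewrite exp1rz mulr1.
rewrite psi1 (eq_zsum n one1) expr1 in h2.
have e0 : fcoef c 0 = zsum n (fun m => fc psi m) * fcoef c 0 +
   (1 - zsum n (fun m => fc psi m)) * fcoef c 0 by ring.
rewrite [in leLHS]e0.
apply: le_trans (ncD _ _) _; rewrite [X in _ + X]ncM [leRHS]mulrDl; apply: lerD; first exact: h1.
by rewrite mulrAC; apply: ler_wpM2r h2; exact: nc_ge0.
Qed.

End SigmaProduct.

(** * Asymptotics of tails and partial sums *)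

Section Negligible.
Context {R : realType}.
Local Notation C := R[i].
Local Notation nc := (@Normc.normc R).
Implicit Types (P : nat -> int -> bool) (e : nat -> int -> C) (k m : int).

Definition negl P e := forall q : nat, exists2 B : R, 0 <= B &
  forall n k, P n k -> nc (e n k) <= B / n.+1%:R ^+ q.

Definition moderate (a : int -> C) := exists p : nat, exists2 B : R, 0 <= B &
  forall k, nc (a k) <= B * (`|k|%N.+1)%:R ^+ p.

Definition rapid (f : int -> C) := forall q : nat, exists2 B : R, 0 <= B &
  forall k, nc (f k) * (`|k|%N.+1)%:R ^+ q <= B.

Lemma negl_eq P e e' : negl P e -> (forall n k, P n k -> e' n k = e n k) -> negl P e'.
Proof.
move=> h eq q; have [B B0 hB] := h q; exists B => // n k Pk.
by rewrite eq//; exact: hB.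
Qed.

Lemma negl_sub P P' e : negl P e -> (forall n k, P' n k -> P n k) -> negl P' e.
Proof.
by move=> h PP q; have [B B0 hB] := h q; exists B => // n k /PP; exact: hB.
Qed.

Lemma neglD P e e' : negl P e -> negl P e' -> negl P (fun n k => e n k + e' n k).
Proof.
move=> h h' q; have [B B0 hB] := h q; have [B' B0' hB'] := h' q.
exists (B + B'); first exact: addr_ge0.
move=> n k Pk; rewrite mulrDl; apply: le_trans (ncD _ _) _.
by apply: lerD; [exact: hB|exact: hB'].
Qed.

Lemma neglZ P e (c : C) : negl P e -> negl P (fun n k => c * e n k).
Proof.
move=> h q; have [B B0 hB] := h q.
exists (nc c * B); first by rewrite mulr_ge0 ?nc_ge0.
by move=> n k Pk; rewrite ncM -mulrA; apply: ler_wpM2l (hB _ _ Pk); exact: nc_ge0.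
Qed.

Lemma neglN P e : negl P e -> negl P (fun n k => - e n k).
Proof.
move=> h; apply: (negl_eq (neglZ (-1) h)) => n k _.
by rewrite mulN1r.
Qed.

Lemma neglB P e e' : negl P e -> negl P e' -> negl P (fun n k => e n k - e' n k).
Proof. by move=> h h'; exact: (neglD h (neglN h')). Qed.

Lemma negl_weighted_sum P P' e (w : nat -> int -> nat -> C) (j0 : int -> nat -> int) (p : nat) (D : R) :
  0 <= D ->
  (forall n k j, P n k -> (j < n)%N -> P' n (j0 k j)) ->
  (forall n k j, P n k -> (j < n)%N -> nc (w n k j) <= D * n.+1%:R ^+ p) ->
  negl P' e -> negl P (fun n k => \sum_(j < n) w n k j * e n (j0 k j)).
Proof.
move=> D0 hP hw he q; have [B B0 hB] := he (q + p + 1)%N.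
exists (D * B); first exact: mulr_ge0.
move=> n k Pk; apply: le_trans (nc_sum _ _ _) _.
have N0 : 0 < n.+1%:R :> R by [].
apply: (@le_trans _ _ (\sum_(j < n) (D * B / n.+1%:R ^+ (q + 1)))).
  apply: ler_sum => j _; rewrite ncM.
  apply: le_trans (ler_pM (nc_ge0 _) (nc_ge0 _) (hw _ _ _ Pk (ltn_ord j)) (hB _ _ (hP _ _ _ Pk (ltn_ord j)))) _.
  rewrite !exprD expr1 le_eqVlt; apply/orP; left; apply/eqP; field.
  by rewrite !gt_eqF ?exprn_gt0.
rewrite sumr_const card_ord -[leLHS]mulr_natl exprD expr1 invfM.
have -> : n%:R * (D * B * (n.+1%:R ^- q * n.+1%:R^-1)) = (D * B / n.+1%:R ^+ q) * (n%:R / n.+1%:R).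
  by ring.
apply: ler_piMr; first by rewrite divr_ge0 ?mulr_ge0 ?exprn_ge0.
by rewrite ler_pdivrMr// mul1r ler_nat.
Qed.

Definition between (lo hi : nat -> int) n k := (lo n <= k) && (k <= hi n).

(** A window has O(n) points, so negligible increments summed from a base point [k0] stay
    negligible. This reduces each asymptotic formula below to a convolution identity and one
    value. *)
Lemma negl_telescope (lo hi k0 : nat -> int) (D : nat -> int -> C) :
  (forall n, - (n.*2.+1)%:Z <= lo n) -> (forall n, hi n <= (n.*2.+1)%:Z) ->
  (forall n, between lo hi n (k0 n)) ->
  negl (fun n k => (lo n < k) && (k <= hi n)) (fun n k => D n k - D n (k - 1)) ->
  negl (between lo hi) (fun n _ => D n (k0 n)) ->
  negl (between lo hi) D.
Proof.
move=> hlo hhi hk0 hD h0 q.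
have [B B0 hB] := hD q.+1; have [B' B0' hB'] := h0 q.
(* Two points of a window are at distance at most 4n + 2 <= 6(n + 1), and the factor n + 1 is paid
   by the extra power q + 1. *)
exists (6 * B + B'); first by rewrite addr_ge0 ?mulr_ge0.
move=> n k Pk.
have N0 : 0 < n.+1%:R :> R by [].
set E := B / n.+1%:R ^+ q.+1 in hB *.
have up (d : nat) x : lo n <= x -> x + d%:Z <= hi n ->
    nc (D n (x + d%:Z) - D n x) <= d%:R * (B / n.+1%:R ^+ q.+1).
  move=> lx; elim: d => [|d IH] xh; first by rewrite addr0 subrr nc0 mul0r.
  have xd : x + d%:Z <= hi n by lia.
  have Pd : (lo n < x + d.+1%:Z) && (x + d.+1%:Z <= hi n) by lia.
  have := hB n _ Pd; have -> : x + d.+1%:Z - 1 = x + d%:Z by lia.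
  move=> h1; rewrite -natr1 mulrDl mul1r.
  have -> : D n (x + d.+1%:Z) - D n x =
    (D n (x + d%:Z) - D n x) + (D n (x + d.+1%:Z) - D n (x + d%:Z)) by ring.
  by apply: le_trans (ncD _ _) _; apply: lerD => //; exact: IH.
have dist : nc (D n k - D n (k0 n)) <= (`|k - k0 n|%N)%:R * (B / n.+1%:R ^+ q.+1).
  have /andP[l0 h0n] := hk0 n; have /andP[lk hk] := Pk.
  case: (lerP (k0 n) k) => kk.
    have kE : k = k0 n + (`|k - k0 n|%N)%:Z by lia.
    by rewrite {1}kE; apply: up => //; rewrite -kE.
  have kE : k0 n = k + (`|k - k0 n|%N)%:Z by lia.
  by rewrite -ncN opprB {1}kE; apply: up => //; rewrite -kE.
have -> : D n k = (D n k - D n (k0 n)) + D n (k0 n) by rewrite subrK.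
apply: le_trans (ncD _ _) _; rewrite mulrDl; apply: lerD; last exact: hB'.
apply: le_trans dist _.
have -> : 6 * B / n.+1%:R ^+ q = (6 * n.+1%:R) * (B / n.+1%:R ^+ q.+1).
  by rewrite exprS; field; rewrite !gt_eqF ?exprn_gt0.
apply: ler_wpM2r; first by rewrite divr_ge0 ?exprn_ge0.
rewrite -natrM ler_nat.
have /andP[l0 h0n] := hk0 n; have /andP[lk hk] := Pk.
have := hlo n; have := hhi n; lia.
Qed.

End Negligible.

(** * Discrete antiderivatives *)

Section Antiderivative.
Context {R : realType}.
Local Notation C := R[i].
Implicit Types (f : int -> C) (k m : int).

Definition antider f k : C :=
  match k with
  | Posz j => \sum_(i < j) f i.+1%:Z
  | Negz j => - \sum_(i < j.+1) f (- i%:Z)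
  end.

Lemma antider0 f : antider f 0 = 0. Proof. exact: big_ord0. Qed.

Lemma antiderB f k : antider f k - antider f (k - 1) = f k.
Proof.
case: k => [[|j]|j].
- have -> : 0%:Z - 1 = Negz 0 by [].
  by rewrite /= big_ord0 big_ord_recl big_ord0 addr0 sub0r opprK oppr0.
- have -> : j.+1%:Z - 1 = j%:Z by lia.
  by rewrite /= big_ord_recr /= addrAC subrr add0r.
- have -> : Negz j - 1 = Negz j.+1 by lia.
  rewrite /antider [in X in _ - X]big_ord_recr opprK /= addrA addNr add0r.
  by rewrite NegzE.
Qed.

Lemma antiderS f k : antider f (k + 1) = antider f k + f (k + 1).
Proof. by have := antiderB f (k + 1); rewrite addrK => <-; ring. Qed.

Lemma antider_prev f k : antider f (k - 1) = antider f k - f k.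
Proof. by rewrite -(antiderB f k); ring. Qed.

Lemma zsum_antider n f : zsum n f = antider f n%:Z - antider f (- n.+1%:Z).
Proof.
elim: n => [|n IH].
  by rewrite zsum0 antider0 -[in LHS](antiderB f 0) antider0.
have e1 : n%:Z + 1 = n.+1%:Z by lia.
have e2 : - n.+1%:Z - 1 = - n.+2%:Z by lia.
have := antiderS f n%:Z; have := antider_prev f (- n.+1%:Z).
by rewrite e1 e2 zsumS IH => -> ->; ring.
Qed.

Lemma antider_even f (n : nat) : (forall k, f (- k) = f k) ->
  zsum n f = f 0 + antider f n%:Z *+ 2.
Proof.
move=> fe; elim: n => [|n IH]; first by rewrite zsum0 antider0 mul0rn addr0.
by rewrite zsumS IH fe -[n.+1]addn1 PoszD antiderS; ring.
Qed.

(** For even f, the antiderivative plus f(0)/2 is odd under reflection about -1/2. *)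
Lemma antider_reflect f k : (forall k, f (- k) = f k) ->
  antider f (- k - 1) = - antider f k - f 0.
Proof.
move=> fe; have h (n : nat) : antider f (- n.+1%:Z) = - antider f n%:Z - f 0.
  have := antider_even n fe; rewrite zsum_antider => /eqP.
  rewrite subr_eq => /eqP e; rewrite -[RHS]opprK; apply/eqP; rewrite -subr_eq0 opprK; apply/eqP.
  transitivity (f 0 + antider f n *+ 2 + antider f (- n.+1%:Z) - antider f n%:Z); first by ring.
  by rewrite -e subrr.
case: k => n.
  have -> : - n%:Z - 1 = - n.+1%:Z by lia.
  exact: h.
have -> : - Negz n - 1 = n%:Z by lia.
by rewrite NegzE h; ring.
Qed.

(* Summation by parts, for the kernel of a Toeplitz-minus-Hankel matrix *)
Lemma toeplitz_hankel_parts (c : int -> C) (phi : nat -> C) (n : nat) k :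
  \sum_(m < n) (c (k - m%:Z) - c (k + m%:Z + 1)) * phi m -
  \sum_(m < n) (c (k - 1 - m%:Z) - c (k - 1 + m%:Z + 1)) * phi m =
  phi 0%N * c k *+ 2 -
  \sum_(m < n) (phi m - phi m.+1) * (c (k - m.+1%:Z) + c (k + m.+1%:Z)) -
  phi n * (c (k - n%:Z) + c (k + n%:Z)).
Proof.
elim: n => [|n IH].
  by rewrite !big_ord0 subr0 addr0 subr0; ring.
rewrite !big_ord_recr /= opprD addrACA IH.
have -> : k - 1 - n%:Z = k - n.+1%:Z by lia.
have -> : k - 1 + n%:Z + 1 = k + n%:Z by lia.
have -> : k + n%:Z + 1 = k + n.+1%:Z by lia.
ring.
Qed.

End Antiderivative.

(** * Tails of the localized sequences *)

Section FactorSequences.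
Context {R : realType}.
Local Notation C := R[i].
Local Notation nc := (@Normc.normc R).
Implicit Types (k m : int).

(** Wide enough for the indices up to 2n of shifted Hankel matrices, yet still O(n), so that
    polynomially growing factors do not spoil negligibility. *)
Definition full (n : nat) k := (- (n.*2.+1)%:Z <= k) && (k <= (n.*2.+1)%:Z).

Lemma negl_mul_moderate (e : nat -> C) (c : int -> C) :
  negl full (fun n _ => e n) -> moderate c -> negl full (fun n k => e n * c k).
Proof.
move=> he [pp [D D0 hD]] q.
have [B B0 hB] := he (q + pp)%N.
exists (B * D * 2 ^+ pp); first by rewrite !mulr_ge0 ?exprn_ge0.
move=> n k fk; rewrite ncM.
apply: le_trans (ler_pM (nc_ge0 _) (nc_ge0 _) (hB _ _ fk) (hD k)) _.
have : (`|k|%N.+1)%:R ^+ pp <= (2 * n.+1%:R) ^+ pp :> R.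
  rewrite lerXn2r ?nnegrE ?mulr_ge0// -natrM ler_nat.
  by move: fk; rewrite /full; lia.
move=> hk; apply: (@le_trans _ _ (B / n.+1%:R ^+ (q + pp) * (D * (2 * n.+1%:R) ^+ pp))).
  by rewrite ler_wpM2l ?divr_ge0 ?exprn_ge0// ler_wpM2l.
rewrite exprMn exprD le_eqVlt; apply/orP; left; apply/eqP; field.
by rewrite !gt_eqF ?exprn_gt0.
Qed.

(* [a], [p] are the coefficients of a and a_+, [psi] those of a cutoff equal to 1
   near the point 1, [alpha] and [beta] those of psi a and psi a_+, and b = a_+(1).
   The point -1 is reduced to this case by alternating signs, see [twist]. *)
Record factor_data (a p psi alpha beta : int -> C) (b : C) : Prop := FactorData {
  fd_aeven : forall k, a (- k) = a k;
  fd_plus : forall k, k < 0 -> p k = 0;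
  fd_psieven : forall k, psi (- k) = psi k;
  fd_alphaeven : forall k, alpha (- k) = alpha k;
  fd_amod : moderate a;
  fd_pmod : moderate p;
  fd_psirapid : rapid psi;
  fd_alpharapid : rapid alpha;
  fd_betarapid : rapid beta;
  fd_psisum : negl full (fun n _ => zsum n psi - 1);
  fd_betasum : negl full (fun n _ => zsum n beta - b);
  fd_alphasum : negl full (fun n _ => zsum n alpha - b * b);
  fd_apsi : negl full (fun n k => zsum n (fun m => psi m * a (k - m)) - alpha k);
  fd_ppsi : negl full (fun n k => zsum n (fun m => psi m * p (k - m)) - beta k);
  fd_pbeta : negl full (fun n k => zsum n (fun m => beta m * p (m - k)) - alpha k) }.

(** For k <= n this is the sum of f over k < m <= n, also when k is negative. *)
Definition tailsum (f : int -> C) (n : nat) k : C := antider f n%:Z - antider f k.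

Lemma tailsum_top f n : tailsum f n n%:Z = 0. Proof. exact: subrr. Qed.

Lemma tailsumB f n k : tailsum f n k - tailsum f n (k - 1) = - f k.
Proof. by rewrite /tailsum antider_prev; ring. Qed.

Lemma tailsum_step f n k : tailsum f n k - tailsum f n (k + 1) = f (k + 1).
Proof. by rewrite /tailsum antiderS; ring. Qed.

Lemma tailsum_bot f n : tailsum f n (- n.+1%:Z) = zsum n f.
Proof. by rewrite zsum_antider. Qed.

(** Row k of Toeplitz minus Hankel applied to the tails of [psi]; k may lie outside the matrix. *)
Definition tmh (c psi : int -> C) (n : nat) k : C :=
  \sum_(m < n) (c (k - m%:Z) - c (k + m%:Z + 1)) * tailsum psi n m%:Z.

(** Summation by parts turns the tails back into [psi]. The Hankel part supplies the other half of
    the two-sided convolution, because [psi] is even. *)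
Lemma tmhB (c psi : int -> C) n k : (forall k, psi (- k) = psi k) ->
  tmh c psi n k - tmh c psi n (k - 1) =
  zsum n psi * c k - zsum n (fun m => psi m * c (k - m)).
Proof.
move=> pe.
apply: (etrans (toeplitz_hankel_parts c (fun m : nat => tailsum psi n m%:Z) n k)).
rewrite tailsum_top mul0r subr0.
have -> : zsum n (fun m => psi m * c (k - m)) = psi 0 * c k +
    \sum_(m < n) (tailsum psi n m - tailsum psi n m.+1) * (c (k - m.+1%:Z) + c (k + m.+1%:Z)).
  rewrite /zsum subr0; congr (_ + _); apply: eq_bigr => m _.
  have -> : m.+1%:Z = m%:Z + 1 by lia.
  by rewrite tailsum_step pe opprK -mulrDr.
rewrite antider_even// /tailsum antider0 subr0; ring.
Qed.

(* The transposed triangular Toeplitz operator, on a window that also contains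
   the negative indices of the reflected sequence. *)
Definition tminus (p beta : int -> C) (n : nat) k : C :=
  \sum_(i < n.*2.+1) p (i%:Z - n.+1%:Z - k) * tailsum beta n (i%:Z - n.+1%:Z).

Lemma window_parts (p G : int -> C) (N : nat) (lo k : int) :
  \sum_(i < N) p (lo + i%:Z - k) * G (lo + i%:Z) -
  \sum_(i < N) p (lo + i%:Z - (k + 1)) * G (lo + i%:Z) =
  \sum_(i < N) p (lo + i%:Z - k) * (G (lo + i%:Z) - G (lo + i%:Z + 1)) -
  p (lo - 1 - k) * G lo + p (lo + N%:Z - 1 - k) * G (lo + N%:Z).
Proof.
elim: N => [|N IH]; first by rewrite !big_ord0 subr0 addr0; ring.
rewrite !big_ord_recr /= opprD addrACA IH.
have -> : lo + N%:Z - (k + 1) = lo + N%:Z - 1 - k by lia.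
have -> : lo + N.+1%:Z - 1 - k = lo + N%:Z - k by lia.
have -> : lo + N.+1%:Z = lo + N%:Z + 1 by lia.
ring.
Qed.

Lemma zsum_window n (g : int -> C) :
  zsum n g = \sum_(i < n.*2.+1) g (i%:Z - n%:Z).
Proof.
elim: n => [|n IH]; first by rewrite zsum0 big_ord_recl big_ord0 addr0.
rewrite zsumS IH doubleS [RHS]big_ord_recl [X in _ = _ + X]big_ord_recr /=.
rewrite [LHS]addrA [LHS]addrC; congr (_ + (_ + _)); first by congr g; lia.
  by apply: eq_bigr => i _; congr g; rewrite /bump /=; lia.
by congr g; rewrite /bump /=; lia.
Qed.

Lemma tailsum_rapid (f : int -> C) (q : nat) : rapid f ->
  exists2 B : R, 0 <= B & forall n k : nat, (k <= n)%N ->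
    nc (tailsum f n k%:Z) <= B / k.+1%:R ^+ q.
Proof.
move=> hf; have [B B0 hB] := hf q.+2.
exists (2 * B); first exact: mulr_ge0.
move=> n k kn; pose g m := if 0 < m then f m else 0.
have hg m : nc (g m) * (`|m|%N.+1)%:R ^+ q.+2 <= B.
  by rewrite /g; case: ifP => _; [exact: hB|rewrite nc0 mul0r].
have zg j : zsum j g = antider f j%:Z.
  by rewrite /zsum add0r; apply: eq_bigr => i _; rewrite /g /= addr0.
have -> : tailsum f n k%:Z = zsum (k + (n - k)) g - zsum k g.
  by rewrite subnKC// !zg.
apply: le_trans (zsum_tail _ _ hg) _.
rewrite ler_wpM2l ?mulr_ge0// lef_pV2 ?posrE ?exprn_gt0//.
by rewrite exprS ler_peMl ?exprn_ge0// ler1n.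
Qed.

Section WithData.
Context (a p psi alpha beta : int -> C) (b : C)
  (fd : factor_data a p psi alpha beta b).

Let pe := fd_psieven fd.
Let ae := fd_aeven fd.

(* Half of the symmetric partial sum of [a], minus half of its regularized
   limit a(1) = b^2. *)
Definition xseq k : C := antider a k + a 0 / 2 - b * b / 2.

(** The increments in k are those of a - psi a, whence an antiderivative of a plus a tail of alpha;
    the constant is found at k = 0. *)
Lemma toeplitz_minus_hankel_asymp :
  negl (between (fun _ => 0) (fun n => (n.*2)%:Z))
    (fun n k => tmh a psi n k - (xseq k + tailsum alpha n k)).
Proof.
apply: (@negl_telescope _ _ _ (fun _ => 0)) => [n|n|n||].
- lia.
- lia.
- by rewrite /between lexx /=; lia.
- have h1 : negl (fun (n : nat) k => (0 < k) && (k <= (n.*2)%:Z))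
      (fun n k => (zsum n psi - 1) * a k).
    by apply: negl_sub (negl_mul_moderate (fd_psisum fd) (fd_amod fd)) _ => n k /andP[k0 kn]; rewrite /full; lia.
  have h2 : negl (fun (n : nat) k => (0 < k) && (k <= (n.*2)%:Z))
      (fun n k => zsum n (fun m => psi m * a (k - m)) - alpha k).
    by apply: negl_sub (fd_apsi fd) _ => n k /andP[k0 kn]; rewrite /full; lia.
  apply: (negl_eq (neglB h1 h2)) => n k _.
  transitivity ((tmh a psi n k - tmh a psi n (k - 1)) -
     (antider a k - antider a (k - 1)) - (tailsum alpha n k - tailsum alpha n (k - 1))).
    by rewrite /xseq; ring.
  by rewrite tmhB// antiderB tailsumB; ring.
(* As a is even, row -1 is the negative of row 0, so the increment at 0 is twice the value there. *)
- have h0 n : tmh a psi n (0 - 1) = - tmh a psi n 0.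
    rewrite /tmh -sumrN; apply: eq_bigr => m _; rewrite -mulNr; congr (_ * _).
    have -> : 0 - 1 - m%:Z = - (0 + m%:Z + 1) by lia.
    have -> : 0 - 1 + m%:Z + 1 = - (0 - m%:Z) by lia.
    by rewrite !ae opprB.
  have t0 n : tmh a psi n 0 = (zsum n psi * a 0 - zsum n (fun m => psi m * a (0 - m))) / 2.
    by rewrite -tmhB// h0 opprK; field.
  pose P := between (fun _ => 0) (fun n => (n.*2)%:Z).
  have s1 : negl P (fun n _ => zsum n psi - 1).
    by apply: negl_sub (fd_psisum fd) _ => n k /andP[k0 kn]; rewrite /full; lia.
  have s2 : negl P (fun n _ => zsum n alpha - b * b).
    by apply: negl_sub (fd_alphasum fd) _ => n k /andP[k0 kn]; rewrite /full; lia.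
  have s3 : negl P (fun n _ => zsum n (fun m => psi m * a (0 - m)) - alpha 0).
    move=> q; have [B B0 hB] := fd_apsi fd q; exists B => // n k _.
    by apply: hB; rewrite /full; lia.
  apply: (negl_eq (neglB (neglB (neglZ (a 0 / 2) s1) (neglZ (1 / 2) s3)) (neglZ (1 / 2) s2))).
  move=> n k _; rewrite t0 /xseq /tailsum !antider0 (antider_even _ (fd_alphaeven fd)).
  by field.
Qed.

End WithData.
End FactorSequences.

(** * Asymptotics of the factor sequences *)

Section FactorAsymptotics.
Context {R : realType}.
Local Notation C := R[i].
Implicit Types (k m : int).
Context (a p psi alpha beta : int -> C) (b : C)
  (fd : factor_data a p psi alpha beta b).

Let pe := fd_psieven fd.
Let p0 := fd_plus fd.

Definition symrange (n : nat) k := (- n.+1%:Z <= k) && (k <= n%:Z).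

Lemma tminusB n k : - n.+1%:Z <= k ->
  tminus p beta n k - tminus p beta n (k + 1) = zsum n (fun m => beta m * p (m - (k + 1))).
Proof.
move=> kn; rewrite /tminus.
have h (i : 'I_n.*2.+1) : i%:Z - n.+1%:Z = - n.+1%:Z + i%:Z by rewrite addrC.
under eq_bigr => i _ do rewrite h.
under [X in _ - X]eq_bigr => i _ do rewrite h.
rewrite (window_parts p (tailsum beta n) n.*2.+1 (- n.+1%:Z) k).
rewrite p0; last by lia.
have -> : - n.+1%:Z + n.*2.+1%:Z = n%:Z by lia.
rewrite tailsum_top mul0r mulr0 subr0 addr0 zsum_window.
apply: eq_bigr => i _; rewrite tailsum_step mulrC; congr (beta _ * p _); lia.
Qed.

(** The increments agree up to negligible errors because beta times the flipped a_+ is alpha. At the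
    base point k = n both terms vanish, the first since p is supported on non-negative indices. *)
Lemma tminus_asymp : negl symrange (fun n k => tminus p beta n k - tailsum alpha n k).
Proof.
apply: (@negl_telescope _ (fun n => - n.+1%:Z) (fun n => n%:Z) (fun n => n%:Z)) => [n|n|n||].
- lia.
- lia.
- by rewrite /between lexx andbT; lia.
- have h : negl (fun (n : nat) k => (- n.+1%:Z < k) && (k <= n%:Z))
      (fun n k => zsum n (fun m => beta m * p (m - k)) - alpha k).
    by apply: negl_sub (fd_pbeta fd) _ => n k /andP[k0 kn]; rewrite /full; lia.
  apply: (negl_eq (neglN h)) => n k /andP[k0 kn].
  have kn' : - n.+1%:Z <= k - 1 by lia.
  have := tminusB kn'; rewrite subrK => <-.
  transitivity (tminus p beta n k - tminus p beta n (k - 1) -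
    (tailsum alpha n k - tailsum alpha n (k - 1))); first by ring.
  by rewrite tailsumB; ring.
- have h : negl (between (fun n => - n.+1%:Z) (fun n => n%:Z)) (fun n k => 0 : C).
    by move=> q; exists 0 => // n k _; rewrite nc0 mul0r.
  apply: (negl_eq h) => n k _; rewrite tailsum_top subr0 /tminus big1// => i _.
  by rewrite p0 ?mul0r//; have := ltn_ord i; lia.
Qed.

(** The sum of p over all indices up to k; [antider] starts after index 0, whence the extra
    [p 0]. *)
Definition plus_sum k : C := antider p k + p 0.

Lemma plus_sum_neg k : k < 0 -> plus_sum k = 0.
Proof.
case: k => // j _; rewrite /plus_sum /antider big_ord_recl big1 ?addr0 => [|i _].
  by rewrite oppr0 addNr.
by rewrite lift0; apply: p0; lia.
Qed.

Lemma plus_sumE (n : nat) k : 0 <= k -> k < n%:Z ->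
  \sum_(j < n) p (k - j%:Z) = plus_sum k.
Proof.
move=> k0 kn; have h N : \sum_(j < N) p (k - j%:Z) = plus_sum k - plus_sum (k - N%:Z).
  elim: N => [|N IH]; first by rewrite big_ord0 subr0 subrr.
  rewrite big_ord_recr /= IH -(antiderB p (k - N%:Z)) /plus_sum.
  have -> : k - N.+1%:Z = k - N%:Z - 1 by lia.
  ring.
by rewrite h [plus_sum (k - _)]plus_sum_neg ?subr0//; lia.
Qed.

(** The base point is k = -n-1: there the support of p annihilates [tmh] and [plus_sum], and the
    tail of beta is its full symmetric sum, close to b. *)
Lemma tmh_plus_asymp : negl symrange
  (fun n k => tmh p psi n k - (tailsum beta n k + plus_sum k - b)).
Proof.
apply: (@negl_telescope _ (fun n => - n.+1%:Z) (fun n => n%:Z) (fun n => - n.+1%:Z)) => [n|n|n||].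
- lia.
- lia.
- by rewrite /between lexx /=; lia.
- pose P (n : nat) k := (- n.+1%:Z < k) && (k <= n%:Z).
  have h1 : negl P (fun n k => (zsum n psi - 1) * p k).
    by apply: negl_sub (negl_mul_moderate (fd_psisum fd) (fd_pmod fd)) _ => n k /andP[k0 kn]; rewrite /full; lia.
  have h2 : negl P (fun n k => zsum n (fun m => psi m * p (k - m)) - beta k).
    by apply: negl_sub (fd_ppsi fd) _ => n k /andP[k0 kn]; rewrite /full; lia.
  apply: (negl_eq (neglB h1 h2)) => n k _.
  transitivity ((tmh p psi n k - tmh p psi n (k - 1)) -
     (antider p k - antider p (k - 1)) - (tailsum beta n k - tailsum beta n (k - 1))).
    by rewrite /plus_sum; ring.
  by rewrite tmhB// antiderB tailsumB; ring.
- have h : negl (between (fun n => - n.+1%:Z) (fun n => n%:Z)) (fun n _ => zsum n beta - b).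
    by apply: negl_sub (fd_betasum fd) _ => n k /andP[k0 kn]; rewrite /full; lia.
  apply: (negl_eq (neglN h)) => n k _.
  rewrite /tmh big1 ?sub0r => [|m _].
    by rewrite tailsum_bot plus_sum_neg ?addr0.
  have := ltn_ord m => mn; rewrite !p0 ?subrr ?mul0r//; lia.
Qed.

Definition tminus_psi (n : nat) k : C :=
  \sum_(m < n) p (m%:Z - k) * tailsum psi n m%:Z.

Definition range0 (n : nat) k := (0 <= k) && (k <= n%:Z).

(** Differencing produces the convolution of psi and p at -k, close to beta(-k). At k = n the left
    side vanishes and the tail of beta is a full symmetric sum. *)
Lemma tminus_psi_asymp : negl range0
  (fun n k => tminus_psi n k - (b - tailsum beta n (- k - 1))).
Proof.
apply: (@negl_telescope _ (fun n => 0) (fun n => n%:Z) (fun n => n%:Z)) => [n|n|n||].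
- lia.
- lia.
- by rewrite /between lexx andbT; lia.
- pose P (n : nat) k := (0 < k) && (k <= n%:Z).
  have h : negl P (fun n k => zsum n (fun m => psi m * p (- k - m)) - beta (- k)).
    move=> q; have [B B0 hB] := fd_ppsi fd q; exists B => // n k /andP[k0 kn].
    by apply: hB; rewrite /full; lia.
  apply: (negl_eq (neglN h)) => n k /andP[k0 kn].
  have e1 : tminus_psi n (k - 1) - tminus_psi n k =
      zsum n (fun m => psi m * p (- k - m)).
    rewrite /tminus_psi.
    have h0 (i : 'I_n) : i%:Z = 0 + i%:Z by rewrite add0r.
    under eq_bigr => i _ do rewrite h0.
    under [X in _ - X]eq_bigr => i _ do rewrite h0.
    have := window_parts p (tailsum psi n) n 0 (k - 1); rewrite subrK => ->.
    rewrite add0r tailsum_top mulr0 addr0 [p (0 - 1 - _)]p0; last by lia.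
    rewrite mul0r subr0 /zsum [p (- k - 0)]p0 ?mulr0 ?add0r; last by lia.
    apply: eq_bigr => i _; rewrite tailsum_step pe [p (- k - i.+1%:Z)]p0; last by lia.
    rewrite mulr0 [RHS]add0r mulrC; congr (psi _ * p _); lia.
  transitivity (- (tminus_psi n (k - 1) - tminus_psi n k) +
     (tailsum beta n (- k - 1) - tailsum beta n (- (k - 1) - 1))); first by ring.
  have -> : - (k - 1) - 1 = - k - 1 + 1 by lia.
  by rewrite e1 tailsum_step subrK; ring.
- have h : negl (between (fun n => 0) (fun n => n%:Z)) (fun n _ => zsum n beta - b).
    by apply: negl_sub (fd_betasum fd) _ => n k /andP[k0 kn]; rewrite /full; lia.
  apply: (negl_eq h) => n k _.
  have -> : - n%:Z - 1 = - n.+1%:Z by lia.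
  rewrite tailsum_bot /tminus_psi big1 => [|m _]; first by ring.
  by rewrite p0 ?mul0r//; have := ltn_ord m; lia.
Qed.

(** The window is cut at 0: its negative indices -j-1 give a Toeplitz row, the others a Hankel
    row. *)
Lemma tminus_split n k : 0 <= k -> k < n%:Z ->
  \sum_(j < n) p (k - j%:Z) * tailsum beta n (- j%:Z - 1) +
  \sum_(j < n) p (k + j%:Z + 1) * tailsum beta n j%:Z = tminus p beta n (- k - 1).
Proof.
move=> k0 kn; pose h m := p (m - (- k - 1)) * tailsum beta n m.
have -> : tminus p beta n (- k - 1) = zsum n (fun m => h (m - 1)).
  rewrite zsum_window; apply: eq_bigr => i _; rewrite /h.
  by have -> : i%:Z - n%:Z - 1 = i%:Z - n.+1%:Z by lia.
rewrite /zsum big_split /= addrCA addrC; congr (_ + _).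
  have -> : h (0 - 1) + \sum_(i < n) h (- i.+1%:Z - 1) = \sum_(i < n.+1) h (- i%:Z - 1).
    by rewrite [RHS]big_ord_recl /= oppr0.
  rewrite big_ord_recr /= [h (- n%:Z - 1)]/h p0 ?mul0r ?addr0; last by lia.
  apply: eq_bigr => j _; rewrite /h; congr (p _ * _); lia.
apply: eq_bigr => j _; rewrite /h.
have -> : j.+1%:Z - 1 = j%:Z by lia.
congr (p _ * _); lia.
Qed.

Definition range1 (n : nat) k := (0 <= k) && (k < n%:Z).

(** With b minus a tail of beta in place of [tminus_psi], the beta terms combine into [tminus] at
    -k-1, close to a tail of alpha. The tails of alpha at -k-1 and k add up to its full sum, close
    to b^2, which brings the argument back to k. *)
Lemma tplus_tminus_asymp : negl range1 (fun n k =>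
  \sum_(j < n) p (k - j%:Z) * tminus_psi n j%:Z -
  \sum_(j < n) p (k + j%:Z + 1) * tailsum beta n j%:Z -
  (tminus p beta n k + b * plus_sum k - b * b)).
Proof.
have [pp [D D0 hD]] := fd_pmod fd.
have s1 : negl range1 (fun n k => \sum_(j < n) p (k - j%:Z) *
    (tminus_psi n j%:Z - (b - tailsum beta n (- j%:Z - 1)))).
  apply: (@negl_weighted_sum _ _ range0
    (fun n k => tminus_psi n k - (b - tailsum beta n (- k - 1)))
    (fun n k j => p (k - j%:Z)) (fun k j => j%:Z) pp D D0) tminus_psi_asymp.
    by move=> n k j _ jn; rewrite /range0; lia.
  move=> n k j /andP[k0 kn] jn; apply: le_trans (hD _) _.
  rewrite ler_wpM2l// lerXn2r ?nnegrE// ler_nat; lia.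
have s2 : negl range1 (fun n k => tminus p beta n (- k - 1) - tailsum alpha n (- k - 1)).
  move=> q; have [B B0 hB] := tminus_asymp q; exists B => // n k /andP[k0 kn].
  by apply: hB; rewrite /symrange; lia.
have s3 : negl range1 (fun n k => tminus p beta n k - tailsum alpha n k).
  by apply: negl_sub tminus_asymp _ => n k /andP[k0 kn]; rewrite /symrange; lia.
have s4 : negl range1 (fun n _ => zsum n alpha - b * b).
  by apply: negl_sub (fd_alphasum fd) _ => n k /andP[k0 kn]; rewrite /full; lia.
apply: (negl_eq (neglB (neglB (neglB s1 s2) s3) s4)) => n k /andP[k0 kn].
rewrite -tminus_split//.
have -> : zsum n alpha = tailsum alpha n (- k - 1) + tailsum alpha n k.
  rewrite (antider_even _ (fd_alphaeven fd)) /tailsum (antider_reflect _ (fd_alphaeven fd)); ring.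
have -> : \sum_(j < n) p (k - j%:Z) * (tminus_psi n j%:Z - (b - tailsum beta n (- j%:Z - 1))) =
    \sum_(j < n) p (k - j%:Z) * tminus_psi n j%:Z - ((\sum_(j < n) p (k - j%:Z)) * b -
    \sum_(j < n) p (k - j%:Z) * tailsum beta n (- j%:Z - 1)).
  by rewrite mulr_suml -!sumrB; apply: eq_bigr => j _; ring.
rewrite plus_sumE//; ring.
Qed.

Definition altsum (n : nat) (f : nat -> C) : C := \sum_(j < n) (-1) ^+ j * f j.

Definition alt (f : int -> C) k : C := (-1) ^+ `|k|%N * f k.

(** Reduces alternating sums of partial sums to Fourier inversion at 1 and at -1. *)
Lemma altsum_zsum (f : int -> C) n :
  altsum n (fun j => zsum j f) *+ 2 = zsum n (alt f) - (-1) ^+ n * zsum n f.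
Proof.
rewrite /altsum; elim: n => [|n IH].
  by rewrite big_ord0 mul0rn !zsum0 /alt expr0 mul1r subrr.
rewrite big_ord_recr /= mulrnDl IH !zsumS /alt abszN !exprS; ring.
Qed.

Lemma altsum_const n (c : C) : ~~ odd n -> altsum n (fun=> c) = 0.
Proof.
have h N : altsum N.*2 (fun=> c) = 0.
  elim: N => [|N IH]; first exact: big_ord0.
  rewrite /altsum doubleS !big_ord_recr /= -/(altsum _ _) IH exprS; ring.
by move=> /even_halfK <-.
Qed.

Lemma altsumB n (f g : nat -> C) :
  altsum n (fun j => f j - g j) = altsum n f - altsum n g.
Proof. by rewrite /altsum -sumrB; apply: eq_bigr => j _; rewrite mulrBr. Qed.

(** The alternating tails of beta cancel and leave minus the alternating sum of its partial sums,
    which is close to b/2 because psi a_+ vanishes at -1. The tails of psi give -c/2 in the same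
    way. Here b is a_+(1), and [c] will be a_+(-1). *)
Lemma alternating_asymp (c : C) :
  negl full (fun n _ => zsum n (alt psi)) -> negl full (fun n _ => zsum n (alt beta)) ->
  negl (fun n _ => ~~ odd n) (fun n _ =>
    altsum n (fun j => tminus_psi n j%:Z) + altsum n (fun j => tailsum beta n j%:Z) -
    c *+ 2 * altsum n (fun j => tailsum psi n j%:Z) - (b - c) / 2).
Proof.
move=> hpsi hbeta; pose P (n : nat) (k : int) := ~~ odd n.
have s1 : negl P (fun n k => \sum_(j < n) (-1) ^+ j *
    (tminus_psi n j%:Z - (b - tailsum beta n (- j%:Z - 1)))).
  apply: (@negl_weighted_sum _ P range0
    (fun n k => tminus_psi n k - (b - tailsum beta n (- k - 1)))
    (fun n k j => (-1) ^+ j) (fun k j => j%:Z) 0 1 ler01) tminus_psi_asymp.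
    by move=> n k j _ jn; rewrite /range0; lia.
  by move=> n k j _ jn; rewrite ncX ncN nc1 expr1n expr0 mulr1.
have cst0 (e : nat -> C) : negl full (fun n _ => e n) -> negl P (fun n _ => e n).
  by move=> h q; have [B B0 hB] := h q; exists B => // n k _; apply: (hB n 0); rewrite /full; lia.
have s2 := cst0 _ (fd_betasum fd); have s3 := cst0 _ hbeta.
have s4 := cst0 _ (fd_psisum fd); have s5 := cst0 _ hpsi.
apply: (negl_eq (neglD s1 (neglB (neglZ (1 / 2) (neglB s2 s3)) (neglZ (c / 2) (neglB s4 s5))))).
move=> n k en; rewrite -/(altsum n (fun j => tminus_psi n j%:Z - (b - tailsum beta n (- j%:Z - 1)))).
rewrite [altsum n (fun j => tminus_psi n j%:Z - _)]altsumB.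
rewrite [altsum n (fun j => b - _)]altsumB altsum_const//.
have sgn : (-1) ^+ n = 1 :> C by rewrite -signr_odd (negPf en) expr0.
have e1 : altsum n (fun j => tailsum beta n (- j%:Z - 1)) =
    altsum n (fun j => tailsum beta n j%:Z) + altsum n (fun j => zsum j beta).
  rewrite /altsum -big_split; apply: eq_bigr => j _ /=; rewrite -mulrDr; congr (_ * _).
  rewrite zsum_antider /tailsum; have -> : - j%:Z - 1 = - j.+1%:Z by lia.
  ring.
have e2 : altsum n (fun j => tailsum psi n j%:Z) = - altsum n (fun j => zsum j psi) / 2.
  have -> : altsum n (fun j => tailsum psi n j%:Z) =
      altsum n (fun j => (antider psi n%:Z + psi 0 / 2) - zsum j psi / 2).
    apply: eq_bigr => j _; congr (_ * _); by rewrite antider_even// /tailsum; field.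
  rewrite altsumB altsum_const// sub0r mulNr; congr (- _).
  by rewrite /altsum mulr_suml; apply: eq_bigr => j _; rewrite mulrA.
have e3 := altsum_zsum beta n; have e4 := altsum_zsum psi n.
rewrite sgn !mul1r in e3 e4.
have e5 : altsum n (fun j => zsum j beta) = (zsum n (alt beta) - zsum n beta) / 2.
  by rewrite -e3; field.
have e6 : altsum n (fun j => zsum j psi) = (zsum n (alt psi) - zsum n psi) / 2.
  by rewrite -e4; field.
by rewrite e1 e2 e5 e6; field.
Qed.

End FactorAsymptotics.

(** * Local data at the points 1 and -1 *)

Section FactorInstances.
Context {R : realType}.
Local Notation C := R[i].
Local Notation nc := (@Normc.normc R).
Implicit Types (k m : int) (t : circle R) (f g psi : smoothfun R).

Lemma convolution_negl (A : distr R) f g : (forall k, A (f * char (- k)) = fc g k) ->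
  negl full (fun n k => zsum n (fun m => fc f m * fcoef A (k - m)) - fc g k).
Proof.
move=> Afg q; have [p hp] := distr_convolution A f.
have [B B0 hB] := hp (q + p)%N.
exists (B * 2 ^+ p); first by rewrite mulr_ge0 ?exprn_ge0.
move=> n k kn; rewrite -ncN opprB -Afg; apply: le_trans (hB n k) _.
have : (`|k|%N.+1)%:R ^+ p <= (2 * n.+1%:R) ^+ p :> R.
  rewrite lerXn2r ?nnegrE ?mulr_ge0// -natrM ler_nat.
  by move: kn; rewrite /full; lia.
move=> hk; apply: (@le_trans _ _ (B * (2 * n.+1%:R) ^+ p / n.+1%:R ^+ (q + p))).
  by rewrite ler_wpM2r ?invr_ge0 ?exprn_ge0// ler_wpM2l.
rewrite exprMn exprD le_eqVlt; apply/orP; left; apply/eqP; field.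
by rewrite !gt_eqF ?exprn_gt0.
Qed.

Lemma inversion_negl f t :
  negl full (fun n _ => zsum n (fun m => fc f m * val t ^ m) - f t).
Proof.
move=> q; have [B B0 hB] := fc_decay f q.+2.
exists (2 * B); first exact: mulr_ge0.
move=> n k _; rewrite -ncN opprB; apply: le_trans (fourier_rate t n hB) _.
rewrite ler_wpM2l ?mulr_ge0// lef_pV2 ?posrE ?exprn_gt0//.
by rewrite exprS ler_peMl ?exprn_ge0// ler1n.
Qed.

(** For e = 1 or -1 these are the coefficients after the rotation t -> e t, which carries the point
    1 to e; the absolute value keeps exponents natural. *)
Definition twist (e : C) (f : int -> C) k : C := e ^+ `|k|%N * f k.

Section Twist.
Context (e : C) (e1 : e = 1 \/ e = -1).

Lemma twist_exprz k : e ^+ `|k|%N = e ^ k.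
Proof.
case: k => n //; rewrite NegzE abszN absz_nat -exprnN.
have ee : e^-1 = e by case: e1 => ->; rewrite ?invr1 ?invrN1.
by rewrite -exprVn ee.
Qed.

Lemma twist_neq0 : e != 0.
Proof. by case: e1 => ->; rewrite ?oppr_eq0 oner_eq0. Qed.

Lemma twistM (u v : int -> C) k m : twist e u m * twist e v (k - m) =
  e ^+ `|k|%N * (u m * v (k - m)).
Proof.
rewrite /twist !twist_exprz mulrACA -expfzDr ?twist_neq0//.
by rewrite addrC subrK.
Qed.

Lemma twistM' (u v : int -> C) k m : twist e u m * twist e v (m - k) =
  e ^+ `|k|%N * (u m * v (m - k)).
Proof.
have ee : e ^ (m - k) = e ^ (k - m).
  by rewrite -!twist_exprz; congr (_ ^+ _); lia.
rewrite /twist !twist_exprz mulrACA ee -expfzDr ?twist_neq0//.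
by rewrite addrC subrK.
Qed.

Lemma nc_twist (u : int -> C) k : nc (twist e u k) = nc (u k).
Proof.
by rewrite ncM ncX; case: e1 => ->; rewrite ?ncN nc1 expr1n mul1r.
Qed.

Lemma twist_even (u : int -> C) : (forall k, u (- k) = u k) ->
  forall k, twist e u (- k) = twist e u k.
Proof. by move=> h k; rewrite /twist abszN h. Qed.

Lemma twist_rapid (u : int -> C) : rapid u -> rapid (twist e u).
Proof.
by move=> h q; have [B B0 hB] := h q; exists B => // k; rewrite nc_twist.
Qed.

Lemma twist_moderate (u : int -> C) : moderate u -> moderate (twist e u).
Proof.
by move=> [p [B B0 hB]]; exists p, B => // k; rewrite nc_twist.
Qed.

Lemma twist_negl (P : nat -> int -> bool) (x : nat -> int -> C) :
  negl P x -> negl P (fun n k => e ^+ `|k|%N * x n k).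
Proof.
move=> h q; have [B B0 hB] := h q; exists B => // n k Pk.
by have := nc_twist (x n) k; rewrite /twist => ->; exact: hB.
Qed.

End Twist.

Lemma fc_rapid f : rapid (fc f). Proof. by move=> q; exact: fc_decay. Qed.

Lemma factor_data_at (K : set (circle R)) (a ap : distr R) (s sp : circle R -> C)
    (t0 : circle R) psi (alpha beta : smoothfun R) :
  val t0 = 1 \/ val t0 = -1 -> dist_even a -> dist_plus ap ->
  (forall t, ~ K t -> s t = sp t * sp (circleV t)) -> ~ K t0 ->
  flip psi = psi -> psi t0 = 1 -> flip alpha = alpha ->
  (forall t, alpha t = s t * psi t) -> (forall t, beta t = sp t * psi t) ->
  (forall k, a (psi * char (- k)) = fc alpha k) ->
  (forall k, ap (psi * char (- k)) = fc beta k) ->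
  (forall k, dtilde ap (beta * char (- k)) = fc alpha k) ->
  let tw := twist (val t0) in
  factor_data (tw (fcoef a)) (tw (fcoef ap)) (tw (fc psi)) (tw (fc alpha)) (tw (fc beta)) (sp t0).
Proof.
move=> e1 aev pplus ssp nKt0 psiev psi1 alev alE beE apsi ppsi pbeta tw.
have t0V : circleV t0 = t0.
  by apply: val_inj; rewrite /=; case: e1 => /= ->; rewrite ?invr1 ?invrN1.
have fcev f : flip f = f -> forall k, fc f (- k) = fc f k.
  by move=> ff k; rewrite -fc_flip ff.
have sumE f : negl full (fun n _ => zsum n (tw (fc f)) - f t0).
  apply: (negl_eq (inversion_negl f t0)) => n k _; congr (_ - _); apply: eq_zsum => m.
  by rewrite /tw /twist twist_exprz// mulrC.
split.
- by apply: twist_even => k; rewrite -fcoef_tilde; exact: aev.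
- by move=> k k0; rewrite /tw /twist pplus// mulr0.
- exact/twist_even/fcev.
- exact/twist_even/fcev.
- exact/twist_moderate/fcoef_moderate.
- exact/twist_moderate/fcoef_moderate.
- exact/twist_rapid/fc_rapid.
- exact/twist_rapid/fc_rapid.
- exact/twist_rapid/fc_rapid.
- by have := sumE psi; rewrite psi1.
- by have := sumE beta; rewrite beE psi1 mulr1.
- by have := sumE alpha; rewrite alE psi1 mulr1 ssp// t0V.
- apply: (negl_eq (twist_negl e1 (convolution_negl apsi))) => n k _.
  rewrite mulrBr -zsumMl; congr (_ - _); apply: eq_zsum => m.
  exact: twistM.
- apply: (negl_eq (twist_negl e1 (convolution_negl ppsi))) => n k _.
  rewrite mulrBr -zsumMl; congr (_ - _); apply: eq_zsum => m.
  exact: twistM.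
- apply: (negl_eq (twist_negl e1 (convolution_negl pbeta))) => n k _.
  rewrite mulrBr -zsumMl; congr (_ - _); apply: eq_zsum => m.
  by rewrite fcoef_tilde opprB; exact: twistM'.
Qed.

Lemma zsum_exchange n (F : int -> int -> C) :
  zsum n (fun l => zsum n (fun m => F l m)) = zsum n (fun m => zsum n (fun l => F l m)).
Proof.
have h N (G : int -> int -> C) : zsum n (fun m => zsum N (fun l => G l m)) =
    zsum N (fun l => zsum n (fun m => G l m)).
  elim: N => [|N IH].
    by rewrite zsum0; apply: eq_zsum => m; rewrite zsum0.
  rewrite zsumS -IH -zsumD -zsumD; apply: eq_zsum => m.
  by rewrite zsumS.
by rewrite -h.
Qed.

Lemma plus_inverse_zsum (x y : distr R) n (l k : int) : plus_inverse x y ->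
  (`|l| <= n)%N -> (`|k| <= n)%N ->
  zsum n (fun m => fcoef x (m - l) * fcoef y (k - m)) = (k == l)%:R.
Proof.
move=> [xp yp xy] ln kn; rewrite zsum_window.
case: (ltP k l) => kl.
  rewrite big1 => [|i _]; first by rewrite lt_eqF.
  case: (ltP (i%:Z - n%:Z) l) => il; first by rewrite xp ?mul0r//; lia.
  by rewrite yp ?mulr0//; lia.
have [d dE] : exists d : nat, k = l + d%:Z by exists (absz (k - l)); lia.
have [u uE] : exists u : nat, l + n%:Z = u%:Z by exists (absz (l + n%:Z)); lia.
rewrite -(big_mkord xpredT (fun i => fcoef x (i%:Z - n%:Z - l) * fcoef y (k - (i%:Z - n%:Z)))).
rewrite (@big_cat_nat _ _ _ u) /=; [|lia|lia].
rewrite big_nat big1 => [|i /andP[_ iu]]; last by rewrite xp ?mul0r//; lia.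
rewrite add0r (@big_cat_nat _ _ _ (u + d.+1)%N) /=; [|lia|lia].
rewrite [X in _ + X]big_nat [X in _ + X]big1 => [|i /andP[iu _]]; last first.
  by rewrite yp ?mulr0//; lia.
rewrite addr0 -{1}[u]add0n big_addn addKn big_mkord.
have -> : (k == l) = (d == 0)%N by rewrite dE; lia.
rewrite -xy; apply: eq_bigr => i _; congr (fcoef x _ * fcoef y _); lia.
Qed.

(** Inverses are defined by convolving coefficients, so the pointwise relation between smooth parts
    has to be recovered. Associativity of truncated convolutions shows that psi, multiplied by both
    smooth parts, is psi again; evaluation at t0 gives the claim. *)
Lemma plus_inverse_smooth_part (K : set (circle R)) (x y : distr R)
    (sx sy : circle R -> C) psi (t0 : circle R) :
  open (~` K) -> plus_inverse x y -> smooth_part K x sx -> smooth_part K y sy ->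
  vanishes_near K psi -> psi t0 = 1 -> sx t0 != 0.
Proof.
move=> oK xy hx hy vpsi psi1.
have [beta betaE] := smooth_off_mul oK hx.1 vpsi.
have vbeta : vanishes_near K beta.
  have [U [oU KU h]] := vpsi; exists U; split; [exact: oU|exact: KU|].
  by move=> t /h; rewrite betaE => ->; rewrite mulr0.
have [gam gamE] := smooth_off_mul oK hy.1 vbeta.
have h1 := convolution_negl (fun k => smooth_part_fc k hx vpsi betaE).
have h2 := convolution_negl (fun k => smooth_part_fc k hy vbeta gamE).
suff e : gam = psi.
  apply/eqP => s0; have : gam t0 = 1 by rewrite e.
  rewrite gamE betaE s0 mul0r mulr0 => /eqP; by rewrite eq_sym oner_eq0.
apply: fc_inj => k; apply/eqP; rewrite -subr_eq0; apply/eqP/nc_eq0/eqP.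
rewrite eq_le nc_ge0 andbT.
have [p2 [D D0 hD]] := fcoef_moderate y.
have [B1 B10 hB1] := h1 (p2 + 2)%N; have [B2 B20 hB2] := h2 1%N.
pose E := B2 + 2 * B1 * (D * (`|k|%N.+1)%:R ^+ p2).
suff hn (n : nat) : (`|k| <= n)%N -> nc (fc gam k - fc psi k) <= E / n.+1%:R.
  apply: (@le0_of_decay _ _ (E * (`|k|%N.+1)%:R)) => n.
  apply: (le_trans (hn (n + `|k|)%N (leq_addl _ _))).
  have E0 : 0 <= E by rewrite addr_ge0 ?mulr_ge0 ?exprn_ge0.
  rewrite ler_pdivrMr// mulrAC ler_pdivlMr// -mulrA ler_wpM2l// -natrM ler_nat.
  by nia.
move=> kn; have fk : full n k by rewrite /full; lia.
have key : zsum n (fun m => zsum n (fun l => fc psi l * fcoef x (m - l)) * fcoef y (k - m)) =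
    fc psi k.
  rewrite (@eq_zsum _ n _ (fun m => zsum n (fun l => fc psi l * (fcoef x (m - l) * fcoef y (k - m))))); last first.
    by move=> m; rewrite -zsumMr; apply: eq_zsum => l; rewrite mulrA.
  rewrite zsum_exchange.
  have e (l : int) : (`|l| <= n)%N -> zsum n (fun m => fc psi l * (fcoef x (m - l) * fcoef y (k - m))) =
      fc psi l * (k == l)%:R.
    by move=> ln; rewrite zsumMl (plus_inverse_zsum xy).
  rewrite zsum_window (eq_bigr (fun i : 'I_n.*2.+1 => fc psi (i%:Z - n%:Z) * (k == i%:Z - n%:Z)%:R)); last first.
    by move=> i _; apply: e; have := ltn_ord i; lia.
  have [u uE] : exists u : nat, k + n%:Z = u%:Z by exists (absz (k + n%:Z)); lia.
  have un : (u < n.*2.+1)%N by lia.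
  rewrite (bigD1 (Ordinal un)) //= big1 ?addr0 => [|i iu].
    have <- : k = u%:Z - n%:Z by lia.
    by rewrite eqxx mulr1.
  have /negPf -> : k != i%:Z - n%:Z by apply: contra iu => /eqP ik; apply/eqP/val_inj => /=; lia.
  by rewrite mulr0.
have -> : fc gam k - fc psi k = - (zsum n (fun m => fc beta m * fcoef y (k - m)) - fc gam k) +
    zsum n (fun m => (fc beta m - zsum n (fun l => fc psi l * fcoef x (m - l))) * fcoef y (k - m)).
  rewrite (@eq_zsum _ n (fun m => (fc beta m - _) * _) (fun m => fc beta m * fcoef y (k - m) +
    (-1) * (zsum n (fun l => fc psi l * fcoef x (m - l)) * fcoef y (k - m)))); last by move=> m; ring.
  by rewrite zsumD zsumMl key mulN1r opprB addrA subrK.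
apply: le_trans (ncD _ _) _; rewrite ncN /E mulrDl; apply: lerD.
  by have := hB2 n k fk; rewrite expr1.
apply: le_trans (@nc_zsum _ n _ (B1 / n.+1%:R ^+ (p2 + 2) * (D * ((`|k|%N.+1)%:R * n.+1%:R) ^+ p2)) _) _.
  move=> m mn; have fm : full n m by rewrite /full; lia.
  rewrite ncM; apply: ler_pM; rewrite ?nc_ge0//; first by rewrite -ncN opprB; exact: hB1.
  apply: le_trans (hD _) _; rewrite ler_wpM2l// lerXn2r ?nnegrE ?mulr_ge0//.
  by rewrite -natrM ler_nat; nia.
have n2 : n.*2.+1%:R <= 2 * n.+1%:R :> R by rewrite -natrM ler_nat; lia.
apply: le_trans (ler_wpM2r _ n2) _.
  by rewrite !mulr_ge0 ?invr_ge0 ?exprn_ge0 ?mulr_ge0.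
rewrite exprMn exprD le_eqVlt; apply/orP; left; apply/eqP; field.
by rewrite !gt_eqF ?exprn_gt0.
Qed.

End FactorInstances.

(** * Determinants *)

Section DeterminantRatio.
Context {F : fieldType}.

(** Both sides are read off from two triangular factorizations of the block matrix with rows (1, -u)
    and (r, 1). *)
Lemma det_rank1_update n (u : 'cV[F]_n) (r : 'rV[F]_n) :
  \det (1%:M + u *m r) = 1 + (r *m u) 0 0.
Proof.
have e : block_mx 1%:M 0 r 1%:M *m block_mx 1%:M (- u) 0 (1%:M + r *m u) =
    block_mx 1%:M (- u) 0 1%:M *m block_mx (1%:M + u *m r) 0 r (1%:M : 'M[F]_1).
  rewrite !mulmx_block !mul0mx !mulmx0 !mul1mx !mulmx1 ?addr0 ?add0r.
  by rewrite mulNmx mulmxN addrK [- _ + _]addrC addrK.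
have := congr1 determinant e; rewrite !det_mulmx !det_lblock !det_ublock !det1 !mul1r !mulr1.
by rewrite det_mx11 !mxE eqxx => <-; congr (_ + _).
Qed.

Lemma det_unit_add_rank1 n (A : 'M[F]_n) (u : 'cV[F]_n) (r : 'rV[F]_n) :
  A \in unitmx -> \det (A + u *m r) = \det A * (1 + (r *m (invmx A *m u)) 0 0).
Proof.
move=> uA; rewrite -det_rank1_update -det_mulmx; congr (\det _).
by rewrite mulmxDr mulmx1 mulmxA mulKVmx.
Qed.

Lemma sum_delta n (i : nat) (f : nat -> F) :
  \sum_(l < n) (i == l)%:R * f l = if (i < n)%N then f i else 0.
Proof.
case: ltnP => [ii|ii].
  rewrite (bigD1 (Ordinal ii)) //= eqxx mul1r big1 ?addr0// => l li.
  have /negPf -> : i != l; last by rewrite mul0r.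
  by apply: contra li => /eqP il; apply/eqP/val_inj; rewrite /= il.
rewrite big1// => l _; have /negPf -> : i != l; last by rewrite mul0r.
by apply/eqP => il; move: (ltn_ord l); rewrite -il ltnNge ii.
Qed.

(** [D s] adds s times the previous row to each row. The recurrence thus equates [D (-1)] applied to
    the b-matrix with [D 1] applied to the a-matrix in every row but the first; as [D 1] maps v to
    the first basis vector, a multiple of v corrects that row alone. *)
Lemma toeplitz_det_ratio n (a b w : int -> F) (v : 'cV[F]_n) :
  (forall k, b k - b (k - 1) = a k + a (k - 1)) ->
  (forall k : nat, a (- k%:Z) - b (- k%:Z) = w k%:Z) ->
  (forall k : 'I_n, v k 0 = (-1) ^+ k) ->
  (\matrix_(j < n, k < n) a (j%:Z - k%:Z)) \in unitmx ->
  \det (\matrix_(j < n, k < n) b (j%:Z - k%:Z)) =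
  \det (\matrix_(j < n, k < n) a (j%:Z - k%:Z)) *
  (1 - ((\row_(k < n) w k%:Z) *m (invmx (\matrix_(j < n, k < n) a (j%:Z - k%:Z)) *m v)) 0 0).
Proof.
set A := \matrix_(j, k) a _; set B := \matrix_(j, k) b _ => ba wE vE uA.
pose D (s : F) : 'M[F]_n := \matrix_(j, k) ((j == k)%:R + s * (k.+1 == j)%:R).
have detD s : \det (D s) = 1.
  rewrite det_trig; first by rewrite big1// => i _; rewrite mxE eqxx gtn_eqF// mulr0 addr0.
  apply/is_trig_mxP => i j ij; rewrite mxE (_ : (i == j) = false); last first.
    by apply/eqP => e; move: ij; rewrite e ltnn.
  by rewrite gtn_eqF ?mulr0 ?addr0//; lia.
have DE s (X : nat -> F) (j : 'I_n) : \sum_(l < n) D s j l * X l =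
    X j + (if (j : nat) is j'.+1 then s * X j' else 0).
  under eq_bigr => l _ do rewrite mxE mulrDl -mulrA.
  rewrite big_split /= -mulr_sumr; congr (_ + _).
    rewrite -[RHS](_ : (if (j < n)%N then X j else 0) = _); last by rewrite ltn_ord.
    rewrite -sum_delta; apply: eq_bigr => l _; congr (_%:R * _).
  case: j => -[|j'] jn /=; first by rewrite big1 ?mulr0// => l _; rewrite mul0r.
  congr (_ * _); have -> : X j' = if (j' < n)%N then X j' else 0 by rewrite ltnW.
  rewrite -sum_delta; apply: eq_bigr => l _; congr (_%:R * _).
  by rewrite eqSS eq_sym.
have Dv : D 1 *m v = \col_j (j == 0%N :> nat)%:R.
  apply/matrixP => j z; rewrite !mxE ord1.
  under eq_bigr => l _ do rewrite vE.
  rewrite (DE 1 (fun l => (-1) ^+ l)); case: (j : nat) => [|j'] /=; first by rewrite addr0.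
  by rewrite exprS mulN1r mul1r addNr.
(* The recurrence for [b] away from the first row, and [wE] in the first row. *)
have key : D (-1) *m B = D 1 *m (A + v *m - (\row_(k < n) w k%:Z)).
  rewrite mulmxDr mulmxA Dv; apply/matrixP => j k; rewrite !mxE big_ord1 !mxE.
  under eq_bigr => l _ do rewrite [B _ _]mxE.
  under [X in _ = X + _]eq_bigr => l _ do rewrite [A _ _]mxE.
  rewrite (DE _ (fun l => b (l%:Z - k%:Z))) (DE _ (fun l => a (l%:Z - k%:Z))).
  case: (j : nat) => [|j'] /=.
    by rewrite sub0r !addr0 mul1r -wE; ring.
  rewrite mulN1r mul1r mul0r addr0.
  have -> : j'%:Z - k%:Z = j'.+1%:Z - k%:Z - 1 by lia.
  exact: ba.
have := congr1 determinant key; rewrite !det_mulmx !detD !mul1r => ->.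
rewrite det_unit_add_rank1//; congr (_ * (1 + _)).
by rewrite mulNmx mxE.
Qed.

End DeterminantRatio.

(** * The exact algebraic identity *)

Section ExactIdentity.
Context {F : fieldType} (n : nat).
Implicit Types (u w : 'cV[F]_n) (M N : 'M[F]_n).

(** Bilinear, without conjugation, so that a matrix crosses it as its transpose. *)
Definition dt u w : F := (u^T *m w) 0 0.

Lemma dtDl u u' w : dt (u + u') w = dt u w + dt u' w.
Proof. by rewrite /dt linearD mulmxDl mxE. Qed.

Lemma dtDr u w w' : dt u (w + w') = dt u w + dt u w'.
Proof. by rewrite /dt mulmxDr mxE. Qed.

Lemma dtNl u w : dt (- u) w = - dt u w.
Proof. by rewrite /dt linearN mulNmx mxE. Qed.

Lemma dtNr u w : dt u (- w) = - dt u w.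
Proof. by rewrite /dt mulmxN mxE. Qed.

Lemma dtZr u (c : F) w : dt u (c *: w) = c * dt u w.
Proof. by rewrite /dt -scalemxAr mxE. Qed.

Lemma dt_adj M u w : dt (M *m u) w = dt u (M^T *m w).
Proof. by rewrite /dt trmx_mul mulmxA. Qed.

Lemma dtE u w : dt u w = \sum_(j < n) u j 0 * w j 0.
Proof. by rewrite /dt mxE; apply: eq_bigr => j _; rewrite mxE. Qed.

Context (A H K J Tp Hp Tpi Tmi : 'M[F]_n) (v x y y' phi phi2 G G2 t1 t2 t3 t4 t5 : 'cV[F]_n)
  (b : F).
Context (symA : A^T = A) (symH : H^T = H) (symHp : Hp^T = Hp) (uA : A \in unitmx)
  (commJ : J *m A = A *m J) (TpiE : Tpi *m Tp = 1%:M) (TmiE : Tmi *m Tp^T = 1%:M).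
Context (Av : A *m v = (b * b) *: v + y - J *m y) (Hv : H *m v = y - y').
Let g := Tp^T *m G.
Let g2 := Tp^T *m G2.
Context (xE : x = A *m phi - H *m phi - g + t1)
  (yE : y = A *m phi2 + H *m phi2 - g2 + t2)
  (y'E : y' = K *m phi2 + H *m (J *m phi2) + t3)
  (r2 : Tp *m phi2 + Hp *m phi2 = G2 + Tp *m v - b *: v + t4)
  (r3 : Tp *m (Tp^T *m phi2) + Hp *m G2 = g2 + b *: (Tp *m v) - (b * b) *: v + t5).
Let Ai := invmx A.

(* [phi], [G] are tails of the cutoff at 1 and of its product with a_+, and [phi2],
   [G2] those at -1. *)
Definition ident_error : F :=
  - dt phi ((H *m Ai *m H - A + Tp *m Tp^T) *m phi2)
  + dt phi ((H *m Ai - Hp *m Tmi) *m g2)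
  + dt phi ((H *m Ai *m J *m H - K) *m phi2)
  - dt phi (H *m Ai *m J *m g2)
  - dt g ((Ai *m H - Tpi *m Hp) *m phi2)
  + dt g ((Ai - Tpi *m Tmi) *m g2)
  + dt g (Ai *m J *m H *m phi2)
  - dt g (Ai *m J *m g2)
  + dt g (J *m phi2)
  + dt phi (t5 + t2 - t3) - dt G t4
  - dt phi (H *m (Ai *m (t2 - J *m t2))) - dt g (Ai *m (t2 - J *m t2))
  - (b * b) * dt t1 (Ai *m v).

(** Write b^2 A^-1 v = v - q with q = A^-1 (y - J y) and expand x and y. Apart from defects, every
    remaining A^-1 sits between decaying vectors, possibly next to H, and [ident_error] subtracts
    its limit; [r2] and [r3] reassemble the subtracted limits into the main term. *)
Lemma exact_identity : - dt x (Ai *m ((b * b) *: v)) =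
  b * (dt phi (Tp *m v) + dt G v - b *+ 2 * dt phi v) + ident_error.
Proof.
have Av' : A *m v = (b * b) *: v + (y - J *m y) by rewrite Av addrA.
have commJi : Ai *m J = J *m Ai.
  by rewrite -[RHS]mul1mx -(mulVmx uA) -/Ai -mulmxA [A *m _]mulmxA -commJ -!mulmxA mulmxV ?mulmx1.
have AiA w : Ai *m (A *m w) = w by rewrite mulmxA mulVmx// mul1mx.
have AAi w : A *m (Ai *m w) = w by rewrite mulmxA mulmxV// mul1mx.
pose q := Ai *m (y - J *m y).
have qE : q = phi2 + Ai *m (H *m phi2) - Ai *m g2 - J *m phi2
    - Ai *m (J *m (H *m phi2)) + Ai *m (J *m g2) + Ai *m (t2 - J *m t2).
  rewrite /q yE !(mulmxDr, mulmxN) !AiA.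
  have -> : Ai *m (J *m (A *m phi2)) = J *m phi2.
    by rewrite [J *m (A *m _)]mulmxA commJ -mulmxA AiA.
  have abel (p1 p2 p3 p4 p5 p6 p7 p8 : 'cV[F]_n) :
      p1 + p2 - p3 + p4 - (p5 + p6 - p7 + p8) = p1 + p2 - p3 - p5 - p6 + p7 + (p4 - p8).
    by apply/matrixP => i k; rewrite !mxE; ring.
  exact: abel.
have vq : Ai *m ((b * b) *: v) = v - q.
  have -> : (b * b) *: v = A *m v - (y - J *m y) by rewrite Av' addrK.
  by rewrite mulmxBr AiA.
have e1 : dt (A *m phi) q = dt phi (A *m v) - (b * b) * dt phi v.
  by rewrite dt_adj symA /q AAi Av' !(dtDr, dtNr, dtZr); ring.
have e2 : dt t1 q = dt t1 v - (b * b) * dt t1 (Ai *m v).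
  have -> : q = v - (b * b) *: (Ai *m v).
    by rewrite scalemxAr vq opprB addrC subrK.
  by rewrite dtDr dtNr dtZr.
have gTpi w : dt g (Tpi *m w) = dt G w.
  by rewrite /g dt_adj trmxK mulmxA; congr (dt G _); rewrite -[RHS]mul1mx; congr (_ *m _); apply: mulmx1C.
have TmiG2 : Tmi *m g2 = G2 by rewrite /g2 mulmxA TmiE mul1mx.
have e3 := congr1 (dt G) r2; have e4 := congr1 (dt phi) r3.
rewrite !(dtDr, dtNr, dtZr) in e3 e4.
have e5 w : dt g w = dt G (Tp *m w) by rewrite /g dt_adj trmxK.
have e6 := congr1 (dt phi) yE; have e7 := congr1 (dt phi) y'E.
have e8 := congr1 (dt phi) Hv.
rewrite !(dtDr, dtNr, dtZr) in e6 e7 e8.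
rewrite vq dtDr dtNr xE /ident_error !(dtDl, dtNl) !mulmxBl !(dtDr, dtNr) e1 e2.
have hE w : dt (H *m phi) w = dt phi (H *m w) by rewrite dt_adj symH.
have aE w : dt (A *m phi) w = dt phi (A *m w) by rewrite dt_adj symA.
rewrite !hE !aE qE !(mulmxDl, mulmxDr, mulmxN, mulNmx, dtDr, dtNr) -!mulmxA !gTpi TmiG2.
rewrite e8 e7 e6.
have -> : dt g phi2 = dt G (Tp *m phi2) by rewrite e5.
have -> : dt g v = dt G (Tp *m v) by rewrite e5.
move: e3 e4.
set X1 := dt G (Tp *m phi2); set X2 := dt G (Hp *m phi2); move=> e3 e4.
have {}e3 : X1 = dt G G2 + dt G (Tp *m v) - b * dt G v + dt G t4 - X2 by rewrite -e3 addrK.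
have {}e4 : dt phi (Tp *m (Tp^T *m phi2)) = dt phi g2 + b * dt phi (Tp *m v) - b * b * dt phi v + dt phi t5 - dt phi (Hp *m G2) by rewrite -e4 addrK.
rewrite e3 e4; ring.
Qed.

End ExactIdentity.

(** * Growth classes of vectors and matrices *)

Section VectorAsymptotics.
Context {R : realType}.
Local Notation C := R[i].
Local Notation nc := (@Normc.normc R).
Context (S : nat -> bool).
Implicit Types (u w t : forall n : nat, 'cV[C]_n) (M E : forall n : nat, 'M[C]_n).

(* Only the [n] in [S] matter. Entries are beyond all orders in [n] ([vneg]), rapidly
   decreasing in the index uniformly in [n] ([vrap]), or polynomially bounded in [n]
   ([vmod], [mmod]); [mO r] allows polynomial growth in the indices. *)
Definition vneg t := forall q : nat, exists2 B : R, 0 <= B &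
  forall n, S n -> forall j, nc (t n j 0) <= B / n.+1%:R ^+ q.
Definition vrap u := forall q : nat, exists2 B : R, 0 <= B &
  forall n, S n -> forall j, nc (u n j 0) <= B / j.+1%:R ^+ q.
Definition vmod u := exists p : nat, exists2 B : R, 0 <= B &
  forall n, S n -> forall j, nc (u n j 0) <= B * n.+1%:R ^+ p.
Definition mmod M := exists p : nat, exists2 B : R, 0 <= B &
  forall n, S n -> forall j k, nc (M n j k) <= B * n.+1%:R ^+ p.
Definition mO (r : R) E := exists p : nat, exists2 B : R, 0 <= B &
  forall n, S n -> forall j k, nc (E n j k) <= B * n%:R `^ r * (j.+1%:R * k.+1%:R) ^+ p.
Definition sO (r : R) (e : nat -> C) := exists2 B : R, 0 <= B &
  forall n, S n -> nc (e n) <= B * n%:R `^ r.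

Lemma sOD r e e' : sO r e -> sO r e' -> sO r (fun n => e n + e' n).
Proof.
move=> [B B0 h] [B' B0' h']; exists (B + B'); first exact: addr_ge0.
move=> n Sn; rewrite mulrDl; apply: le_trans (ncD _ _) _.
by apply: lerD; [exact: h|exact: h'].
Qed.

Lemma sOZ r (c : C) e : sO r e -> sO r (fun n => c * e n).
Proof.
move=> [B B0 h]; exists (nc c * B); first by rewrite mulr_ge0 ?nc_ge0.
by move=> n Sn; rewrite ncM -mulrA; apply: ler_wpM2l (h _ Sn); exact: nc_ge0.
Qed.

Lemma sON r e : sO r e -> sO r (fun n => - e n).
Proof.
by move=> [B B0 h]; exists B => // n Sn; rewrite ncN; exact: h.
Qed.

Lemma sOB r e e' : sO r e -> sO r e' -> sO r (fun n => e n - e' n).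
Proof. by move=> h h'; exact: (sOD h (sON h')). Qed.

Lemma sO_small r e : (forall n, S n -> (0 < n)%N) ->
  (forall q : nat, exists2 B : R, 0 <= B & forall n, S n -> nc (e n) <= B / n.+1%:R ^+ q) ->
  sO r e.
Proof.
move=> S0 h; have [B B0 hB] := h (Num.bound `|r|); exists B => // n Sn.
apply: le_trans (hB n Sn) _; rewrite ler_wpM2l//.
have n0 : 0 < n%:R :> R by rewrite ltr0n S0.
apply: (@le_trans _ _ (n%:R ^- Num.bound `|r|)).
  by rewrite lef_pV2 ?posrE ?exprn_gt0// lerXn2r ?nnegrE// ler_nat.
have n1 : 1 <= n%:R :> R by rewrite ler1n S0.
rewrite -powR_mulrn ?(ltW n0)// -powRN; apply: (ler_powR n1).
rewrite lerNl; apply: le_trans (ltW (archi_boundP (normr_ge0 r))).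
by rewrite -normrN ler_norm.
Qed.

Lemma vrap_mod u : vrap u -> vmod u.
Proof.
move=> /(_ 0%N)[B B0 h]; exists 0%N, B => // n Sn j.
by have := h n Sn j; rewrite !expr0 divr1 mulr1.
Qed.

Lemma vneg_rap u : vneg u -> vrap u.
Proof.
move=> h q; have [B B0 hB] := h q; exists B => // n Sn j.
apply: le_trans (hB n Sn j) _; rewrite ler_wpM2l// lef_pV2 ?posrE//.
by rewrite lerXn2r ?nnegrE// ler_nat ltnS ltnW.
Qed.

Lemma vnegD u w : vneg u -> vneg w -> vneg (fun n => u n + w n).
Proof.
move=> h h' q; have [B B0 hB] := h q; have [B' B0' hB'] := h' q.
exists (B + B'); first exact: addr_ge0.
move=> n Sn j; rewrite mxE; apply: le_trans (ncD _ _) _; rewrite mulrDl.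
by apply: lerD; [exact: hB|exact: hB'].
Qed.

Lemma vnegN u : vneg u -> vneg (fun n => - u n).
Proof.
by move=> h q; have [B B0 hB] := h q; exists B => // n Sn j; rewrite mxE ncN; exact: hB.
Qed.

Lemma vrapD u w : vrap u -> vrap w -> vrap (fun n => u n + w n).
Proof.
move=> h h' q; have [B B0 hB] := h q; have [B' B0' hB'] := h' q.
exists (B + B'); first exact: addr_ge0.
move=> n Sn j; rewrite mxE; apply: le_trans (ncD _ _) _; rewrite mulrDl.
by apply: lerD; [exact: hB|exact: hB'].
Qed.

Lemma nc_sum_le n (f : 'I_n -> C) (B : R) : 0 <= B -> (forall j, nc (f j) <= B) ->
  nc (\sum_(j < n) f j) <= n.+1%:R * B.
Proof.
move=> B0 h; apply: le_trans (nc_sum _ _ _) _.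
apply: (@le_trans _ _ (\sum_(j < n) B)); first by apply: ler_sum => j _; exact: h.
by rewrite sumr_const card_ord -[leLHS]mulr_natl ler_wpM2r// ler_nat.
Qed.

Lemma mmod_vmod M u : mmod M -> vmod u -> vmod (fun n => M n *m u n).
Proof.
move=> [p [B B0 h]] [p' [B' B0' h']]; exists (p + p').+1, (B * B'); first exact: mulr_ge0.
move=> n Sn j; rewrite mxE.
apply: (@le_trans _ _ (n.+1%:R * (B * n.+1%:R ^+ p * (B' * n.+1%:R ^+ p')))).
  apply: nc_sum_le => [|k]; first by rewrite !mulr_ge0// ltW.
  by rewrite ncM; apply: ler_pM; rewrite ?nc_ge0//; [exact: h|exact: h'].
by rewrite exprS exprD le_eqVlt; apply/orP; left; apply/eqP; ring.
Qed.

Lemma mmod_vneg M u : mmod M -> vneg u -> vneg (fun n => M n *m u n).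
Proof.
move=> [p [B B0 h]] hu q; have [B' B0' h'] := hu (q + p).+1.
exists (B * B'); first exact: mulr_ge0.
move=> n Sn j; rewrite mxE.
apply: (@le_trans _ _ (n.+1%:R * (B * n.+1%:R ^+ p * (B' / n.+1%:R ^+ (q + p).+1)))).
  apply: nc_sum_le => [|k]; first by rewrite !mulr_ge0 ?invr_ge0// ltW.
  by rewrite ncM; apply: ler_pM; rewrite ?nc_ge0//; [exact: h|exact: h'].
rewrite exprS exprD le_eqVlt; apply/orP; left; apply/eqP; field.
by rewrite !gt_eqF.
Qed.

Lemma sO_dt_small r u w : (forall n, S n -> (0 < n)%N) -> vneg u -> vmod w ->
  sO r (fun n => dt (u n) (w n)).
Proof.
move=> S0 hu [p [B B0 h]]; apply: sO_small => // q.
have [B' B0' h'] := hu (q + p).+1; exists (B * B'); first exact: mulr_ge0.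
move=> n Sn; rewrite dtE.
apply: (@le_trans _ _ (n.+1%:R * (B' / n.+1%:R ^+ (q + p).+1 * (B * n.+1%:R ^+ p)))).
  apply: nc_sum_le => [|k]; first by rewrite !mulr_ge0 ?invr_ge0// ltW.
  by rewrite ncM; apply: ler_pM; rewrite ?nc_ge0//; [exact: h'|exact: h].
rewrite exprS exprD le_eqVlt; apply/orP; left; apply/eqP; field.
by rewrite !gt_eqF.
Qed.

Lemma dtC n (u w : 'cV[C]_n) : dt u w = dt w u.
Proof. by rewrite !dtE; apply: eq_bigr => j _; rewrite mulrC. Qed.

Lemma sO_dt_small_r r u w : (forall n, S n -> (0 < n)%N) -> vmod u -> vneg w ->
  sO r (fun n => dt (u n) (w n)).
Proof.
move=> S0 hu hw; have [B B0 h] := sO_dt_small r S0 hw hu.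
by exists B => // n Sn; rewrite dtC; exact: h.
Qed.

Lemma sum_invsq n : \sum_(j < n) (j.+1%:R ^+ 2)^-1 <= 2 :> R.
Proof.
case: n => [|n]; first by rewrite big_ord0.
suff h : \sum_(j < n.+1) (j.+1%:R ^+ 2)^-1 <= 2 - n.+1%:R^-1 :> R.
  by apply: le_trans h _; rewrite lerBlDr lerDl invr_ge0.
elim: n => [|n IH]; first by rewrite big_ord_recl big_ord0 addr0 expr1n invr1; lra.
rewrite big_ord_recr /=; apply: le_trans (lerD IH (lexx _)) _.
have n0 : 0 < n.+1%:R :> R by [].
have n1 : 0 < n.+2%:R :> R by [].
have e : n.+2%:R = n.+1%:R + 1 :> R by rewrite -natr1.
rewrite -subr_ge0.
have -> : 2 - n.+2%:R^-1 - (2 - n.+1%:R^-1 + (n.+2%:R ^+ 2)^-1) =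
    (n.+1%:R * n.+2%:R ^+ 2)^-1 :> R.
  have h (N : R) : 0 < N -> 2 - (N + 1)^-1 - (2 - N^-1 + (N + 1) ^- 2) = (N * (N + 1) ^+ 2)^-1.
    by move=> N0; field; rewrite !gt_eqF// addr_gt0.
  by rewrite e h.
by rewrite invr_ge0 mulr_ge0 ?exprn_ge0// ltW.
Qed.

(** Decay of order p + 2 on each side absorbs the growth of the entries and leaves two sums of
    inverse squares, each at most 2. *)
Lemma sO_dt_mO r u w E : vrap u -> vrap w -> mO r E ->
  sO r (fun n => dt (u n) (E n *m w n)).
Proof.
move=> hu hw [p [B B0 hE]]; have [Bu Bu0 hBu] := hu (p + 2)%N; have [Bw Bw0 hBw] := hw (p + 2)%N.
exists (4 * (Bu * Bw * B)); first by rewrite !mulr_ge0.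
move=> n Sn; rewrite dtE; apply: le_trans (nc_sum _ _ _) _.
have r0 : 0 <= n%:R `^ r by exact: powR_ge0.
apply: (@le_trans _ _ (\sum_(j < n) \sum_(k < n)
    (Bu * Bw * B * n%:R `^ r) * ((j.+1%:R ^+ 2)^-1 * (k.+1%:R ^+ 2)^-1))).
  apply: ler_sum => j _; rewrite mxE mulr_sumr; apply: le_trans (nc_sum _ _ _) _.
  apply: ler_sum => k _; rewrite !ncM.
  apply: (@le_trans _ _ (Bu / j.+1%:R ^+ (p + 2) * (B * n%:R `^ r * (j.+1%:R * k.+1%:R) ^+ p * (Bw / k.+1%:R ^+ (p + 2))))).
    apply: ler_pM; rewrite ?mulr_ge0 ?nc_ge0//; first exact: hBu.
    by apply: ler_pM; rewrite ?nc_ge0//; [exact: hE|exact: hBw].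
  rewrite exprMn !exprD le_eqVlt; apply/orP; left; apply/eqP; field.
  by rewrite !gt_eqF.
under eq_bigr => j _ do rewrite -mulr_sumr -mulr_sumr.
rewrite -mulr_sumr -mulr_suml.
have s2 := sum_invsq n; have s0 : 0 <= \sum_(j < n) (j.+1%:R ^+ 2)^-1 :> R.
  by apply: sumr_ge0 => j _; rewrite invr_ge0 ltW.
have c0 : 0 <= Bu * Bw * B * n%:R `^ r by rewrite !mulr_ge0.
have -> : 4 * (Bu * Bw * B) * n%:R `^ r = Bu * Bw * B * n%:R `^ r * (2 * 2) by ring.
by apply: ler_wpM2l => //; apply: ler_pM.
Qed.

End VectorAsymptotics.

(** * Toeplitz and Hankel matrices *)

Section StructuredMatrices.
Context {R : realType}.
Local Notation C := R[i].
Local Notation nc := (@Normc.normc R).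
Implicit Types (f : int -> C).

Definition mxT f n : 'M[C]_n := \matrix_(j, k) f (j%:Z - k%:Z).
Definition mxH f n : 'M[C]_n := \matrix_(j, k) f (j%:Z + k%:Z + 1).
(** The block of the Hankel matrix of a times [char (- n)] that is subtracted in [HRH_N]. *)
Definition mxK f n : 'M[C]_n := \matrix_(j, k) f (j%:Z + k%:Z + 1 + n%:Z).
Definition mxJ n : 'M[C]_n := \matrix_(j, k) ((j + k).+1 == n)%:R.

Lemma mxJE n (w : 'cV[C]_n) j : (mxJ n *m w) j 0 = w (rev_ord j) 0.
Proof.
rewrite mxE (bigD1 (rev_ord j)) //= big1 => [|k kj]; rewrite mxE /=.
  have -> : ((j + (n - j.+1)).+1 == n)%N by have := ltn_ord j; lia.
  by rewrite mul1r addr0.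
have /negPf -> : (j + k).+1 != n; last by rewrite mul0r.
apply: contra kj => /eqP e; apply/eqP/val_inj => /=; have := ltn_ord j; lia.
Qed.

Lemma mxT_sym f n : (forall k, f (- k) = f k) -> (mxT f n)^T = mxT f n.
Proof. by move=> fe; apply/matrixP => j k; rewrite !mxE -fe opprB. Qed.

Lemma mxH_sym f n : (mxH f n)^T = mxH f n.
Proof. by apply/matrixP => j k; rewrite !mxE [k%:Z + _]addrC. Qed.

Lemma mxJ_comm f n : (forall k, f (- k) = f k) ->
  mxJ n *m mxT f n = mxT f n *m mxJ n.
Proof.
move=> fe; apply/matrixP => j k.
have -> : (mxJ n *m mxT f n) j k = (mxJ n *m col k (mxT f n)) j 0.
  by rewrite mxE [RHS]mxE; apply: eq_bigr => l _; rewrite [col k _ l 0]mxE.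
have -> : (mxT f n *m mxJ n) j k = (mxJ n *m col j (mxT f n)^T) k 0.
  rewrite !mxE; apply: eq_bigr => l _.
  by rewrite !mxE mulrC [(l + k)%N]addnC.
rewrite !mxJE !mxE -fe; congr f; have := ltn_ord j; have := ltn_ord k; rewrite /=; lia.
Qed.

Context (e : C) (e1 : e = 1 \/ e = -1).

Lemma exp_sign_even (i k : int) (c : int) : i = k + c + c -> e ^ i = e ^ k.
Proof.
move=> ->; have e0 := twist_neq0 e1; rewrite -addrA expfzDr// expfzDr//.
have -> : e ^ c * e ^ c = 1.
  rewrite -expfzMl; have -> : e * e = 1 by case: e1 => ->; rewrite ?mulrNN mulr1.
  by rewrite exp1rz.
by rewrite mulr1.
Qed.

Lemma exp_nat_int (j : nat) : e ^+ j = e ^ j%:Z. Proof. by []. Qed.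

(** Conjugation by the signs e^j undoes the twist; [c] witnesses that j + l and m have the same
    parity. *)
Lemma twist_toeplitz f (j : nat) (l m : int) (c : int) : j%:Z + l = m + c + c ->
  e ^+ j * twist e f l = f l * e ^ m.
Proof.
move=> h; rewrite /twist twist_exprz// mulrA exp_nat_int -expfzDr ?twist_neq0//.
by rewrite (exp_sign_even h) mulrC.
Qed.

Lemma nc_sign (j : nat) : nc (e ^+ j) = 1.
Proof. by rewrite ncX; case: e1 => ->; rewrite ?ncN nc1 expr1n. Qed.

Definition sv n : 'cV[C]_n := \col_j e ^+ j.
Definition tv f n : 'cV[C]_n := \col_j (e ^+ j * tailsum f n j%:Z).

(** The Hankel index j + m + 1 carries one sign more than the Toeplitz index, so T - H at the point
    1 corresponds to T + H at the point -1. *)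
Lemma tmh_vec f psi n (j : 'I_n) : e ^+ j * tmh (twist e f) psi n j%:Z =
  (mxT f n *m tv psi n) j 0 - e * (mxH f n *m tv psi n) j 0.
Proof.
rewrite /tmh !mxE !mulr_sumr -sumrB; apply: eq_bigr => m _; rewrite !mxE.
rewrite mulrA [e ^+ j * (_ - _)]mulrBr (@twist_toeplitz f j (j%:Z - m%:Z) m%:Z (j%:Z - m%:Z)); last by lia.
rewrite (@twist_toeplitz f j (j%:Z + m%:Z + 1) (m%:Z + 1) j%:Z); last by lia.
rewrite expfzDr ?twist_neq0// expr1z exp_nat_int; ring.
Qed.

(** Reversing the summation index turns the Toeplitz block n rows further down into Hankel times
    flip; an even shift preserves the signs. *)
Lemma tmh_shift_vec f psi n (j : 'I_n) : ~~ odd n ->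
  e ^+ j * tmh (twist e f) psi n (j%:Z + n%:Z) =
  (mxH f n *m (mxJ n *m tv psi n)) j 0 - e * (mxK f n *m tv psi n) j 0.
Proof.
move=> en; have [N nE] : exists N, N.*2 = n by exists n./2; exact: even_halfK.
have -> : (mxH f n *m (mxJ n *m tv psi n)) j 0 =
    \sum_(m < n) f (j%:Z + n%:Z - m%:Z) * tv psi n m 0.
  rewrite mxE (reindex_inj rev_ord_inj); apply: eq_bigr => m _.
  by rewrite mxJE rev_ordK mxE; congr (f _ * _); have := ltn_ord m; rewrite /=; lia.
rewrite /tmh [X in _ - e * X]mxE !mulr_sumr -sumrB; apply: eq_bigr => m _; rewrite !mxE.
rewrite mulrA [e ^+ j * (_ - _)]mulrBr (@twist_toeplitz f j (j%:Z + n%:Z - m%:Z) m%:Z (j%:Z + N%:Z - m%:Z)); last by lia.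
rewrite (@twist_toeplitz f j (j%:Z + n%:Z + m%:Z + 1) (m%:Z + 1) (j%:Z + N%:Z)); last by lia.
have -> : j%:Z + n%:Z + m%:Z + 1 = j%:Z + m%:Z + 1 + n%:Z by lia.
rewrite expfzDr ?twist_neq0// expr1z exp_nat_int; ring.
Qed.

Lemma sv_toeplitz f n (j : 'I_n) : e ^+ j * (\sum_(m < n) twist e f (j%:Z - m%:Z)) =
  (mxT f n *m sv n) j 0.
Proof.
rewrite mxE mulr_sumr; apply: eq_bigr => m _; rewrite !mxE.
by rewrite (@twist_toeplitz f j (j%:Z - m%:Z) m%:Z (j%:Z - m%:Z))//; lia.
Qed.

Lemma twist_toeplitz_vec f n (x : nat -> C) (j : 'I_n) :
  e ^+ j * (\sum_(m < n) twist e f (j%:Z - m%:Z) * x m) =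
  (mxT f n *m \col_m (e ^+ m * x m)) j 0.
Proof.
rewrite mxE mulr_sumr; apply: eq_bigr => m _; rewrite !mxE mulrA.
by rewrite (@twist_toeplitz f j (j%:Z - m%:Z) m%:Z (j%:Z - m%:Z)) ?mulrA//; lia.
Qed.

Lemma twist_hankel_vec f n (x : nat -> C) (j : 'I_n) :
  e ^+ j * (\sum_(m < n) twist e f (j%:Z + m%:Z + 1) * x m) =
  e * (mxH f n *m \col_m (e ^+ m * x m)) j 0.
Proof.
rewrite mxE !mulr_sumr; apply: eq_bigr => m _; rewrite !mxE mulrA.
rewrite (@twist_toeplitz f j (j%:Z + m%:Z + 1) (m%:Z + 1) j%:Z); last by lia.
rewrite expfzDr ?twist_neq0// expr1z exp_nat_int; ring.
Qed.

Lemma twist_toeplitz_tr_vec f n (x : nat -> C) (j : 'I_n) :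
  e ^+ j * (\sum_(m < n) twist e f (m%:Z - j%:Z) * x m) =
  ((mxT f n)^T *m \col_m (e ^+ m * x m)) j 0.
Proof.
rewrite mxE mulr_sumr; apply: eq_bigr => m _; rewrite !mxE mulrA.
by rewrite (@twist_toeplitz f j (m%:Z - j%:Z) m%:Z 0) ?mulrA//; lia.
Qed.

End StructuredMatrices.

(** * From sequences to vectors *)

Section FactorVectors.
Context {R : realType}.
Local Notation C := R[i].
Context (e : C) (e1 : e = 1 \/ e = -1) (a p psi alpha beta : int -> C) (b : C)
  (fd : factor_data (twist e a) (twist e p) psi alpha beta b) (S : nat -> bool)
  (S_even : forall n, S n -> ~~ odd n).
Local Notation a' := (twist e a).
Local Notation p' := (twist e p).

Let fdp0 := fd_plus fd.

Lemma tminus_nonneg n (k : int) : 0 <= k ->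
  tminus p' beta n k = \sum_(m < n) p' (m%:Z - k) * tailsum beta n m%:Z.
Proof.
move=> k0; pose h m := p' (m - k) * tailsum beta n m.
have -> : tminus p' beta n k = zsum n (fun m => h (m - 1)).
  rewrite zsum_window; apply: eq_bigr => i _; rewrite /h.
  by have -> : i%:Z - n%:Z - 1 = i%:Z - n.+1%:Z by lia.
have h0 m : m < 0 -> h m = 0 by move=> m0; rewrite /h fdp0 ?mul0r//; lia.
rewrite /zsum h0 ?add0r//; apply: eq_bigr => m _.
rewrite [h (- _ - _)]h0 ?addr0 /h; last by lia.
by have -> : m.+1%:Z - 1 = m%:Z by lia.
Qed.

Definition xv n : 'cV[C]_n := \col_j (e ^+ j * xseq a' b j%:Z).
Definition xv_shift n : 'cV[C]_n := \col_j (e ^+ j * xseq a' b (j%:Z + n%:Z)).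

Definition phiv := tv e psi.
Definition gv := tv e beta.
(** This and the next three are the defects t1 to t5 of the relations assumed by [exact_identity],
    for either sign e. *)
Definition xv_err n := xv n - (mxT a n *m phiv n - e *: (mxH a n *m phiv n) - (mxT p n)^T *m gv n).
Definition xv_shift_err n := xv_shift n - (mxH a n *m (mxJ n *m phiv n) - e *: (mxK a n *m phiv n)).
Definition plus_err n := mxT p n *m phiv n - e *: (mxH p n *m phiv n)
  - (gv n + mxT p n *m sv e n - b *: sv e n).
Definition minus_err n := mxT p n *m ((mxT p n)^T *m phiv n) - e *: (mxH p n *m gv n)
  - ((mxT p n)^T *m gv n + b *: (mxT p n *m sv e n) - (b * b) *: sv e n).

Lemma vneg_of_negl (P : nat -> int -> bool) (x : nat -> int -> C) (i0 : nat -> nat -> int)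
    (t : forall n, 'cV[C]_n) : negl P x ->
  (forall n (j : 'I_n), S n -> P n (i0 n j)) ->
  (forall n (j : 'I_n), S n -> t n j 0 = e ^+ j * x n (i0 n j)) -> vneg S t.
Proof.
move=> h hP ht q; have [B B0 hB] := h q; exists B => // n Sn j.
by rewrite ht// ncM nc_sign// mul1r; apply: hB; exact: hP.
Qed.

Lemma phiv_rap : vrap S phiv.
Proof.
move=> q; have [B B0 hB] := tailsum_rapid q (fd_psirapid fd); exists B => // n Sn j.
by rewrite mxE ncM nc_sign// mul1r; apply: hB; exact: ltnW.
Qed.

Lemma gv_rap : vrap S gv.
Proof.
move=> q; have [B B0 hB] := tailsum_rapid q (fd_betarapid fd); exists B => // n Sn j.
by rewrite mxE ncM nc_sign// mul1r; apply: hB; exact: ltnW.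
Qed.

Lemma tminus_vec n (j : 'I_n) : e ^+ j * tminus p' beta n j%:Z = ((mxT p n)^T *m gv n) j 0.
Proof.
by rewrite tminus_nonneg// (twist_toeplitz_tr_vec e1 p (fun m => tailsum beta n m%:Z)).
Qed.

Lemma tminus_psi_vec n (j : 'I_n) :
  e ^+ j * tminus_psi p' psi n j%:Z = ((mxT p n)^T *m phiv n) j 0.
Proof.
by rewrite /tminus_psi (twist_toeplitz_tr_vec e1 p (fun m => tailsum psi n m%:Z)).
Qed.

(** Up to a negligible vector this is the tail of the smooth function alpha. *)
Lemma tpgv_rap : vrap S (fun n => (mxT p n)^T *m gv n).
Proof.
have h1 : vrap S (tv e alpha).
  move=> q; have [B B0 hB] := tailsum_rapid q (fd_alpharapid fd); exists B => // n Sn j.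
  by rewrite mxE ncM nc_sign// mul1r; apply: hB; exact: ltnW.
have h2 : vneg S (fun n => (mxT p n)^T *m gv n - tv e alpha n).
  apply: (vneg_of_negl (i0 := fun _ j => j%:Z) (tminus_asymp fd)) => n j Sn.
    by rewrite /symrange; have := ltn_ord j; lia.
  by rewrite mulrBr tminus_vec !mxE.
have := vrapD (vneg_rap h2) h1.
move=> h q; have [B B0 hB] := h q; exists B => // n Sn j.
by have := hB n Sn j; rewrite subrK.
Qed.

(** The same tail of alpha occurs in both asymptotic formulas and cancels. *)
Lemma xv_err_neg : vneg S xv_err.
Proof.
pose P (n : nat) k := (0 <= k) && (k < n%:Z).
have h1 : negl P (fun n k => tmh a' psi n k - (xseq a' b k + tailsum alpha n k)).
  by apply: negl_sub (toeplitz_minus_hankel_asymp fd) _ => n k /andP[k0 kn]; rewrite /between; lia.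
have h2 : negl P (fun n k => tminus p' beta n k - tailsum alpha n k).
  by apply: negl_sub (tminus_asymp fd) _ => n k /andP[k0 kn]; rewrite /symrange; lia.
apply: (vneg_of_negl (i0 := fun _ j => j%:Z) (neglB h2 h1)) => n j Sn.
  by rewrite /P; have := ltn_ord j; lia.
transitivity (e ^+ j * xseq a' b j%:Z - e ^+ j * tmh a' psi n j%:Z + e ^+ j * tminus p' beta n j%:Z); last by ring.
rewrite tminus_vec tmh_vec//.
have eE (x A H G : 'cV[C]_n) : (x - (A - e *: H - G)) j 0 = x j 0 - (A j 0 - e * H j 0) + G j 0.
  by rewrite !mxE; ring.
by rewrite /xv_err eE [xv n j 0]mxE.
Qed.

Lemma xv_shift_err_neg : vneg S xv_shift_err.
Proof.
pose P (n : nat) k := (n%:Z <= k) && (k <= (n.*2)%:Z).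
have h1 : negl P (fun n k => tmh a' psi n k - (xseq a' b k + tailsum alpha n k)).
  by apply: negl_sub (toeplitz_minus_hankel_asymp fd) _ => n k /andP[k0 kn]; rewrite /between; lia.
(* Past n the tail of alpha is itself negligible, so no transposed Toeplitz term is needed here. *)
have h2 : negl P (fun n k => tailsum alpha n k).
  apply: (@negl_telescope _ (fun n => n%:Z) (fun n => (n.*2)%:Z) (fun n => n%:Z)) => [n|n|n||].
  - lia.
  - lia.
  - by rewrite /between; lia.
  - have h : negl (fun (n : nat) k => (n%:Z < k) && (k <= (n.*2)%:Z)) (fun n k => alpha k).
      move=> q; have [B B0 hB] := fd_alpharapid fd q; exists B => // n k /andP[nk _].
      rewrite ler_pdivlMr ?exprn_gt0//; apply: le_trans (hB k).
      rewrite ler_wpM2l ?nc_ge0// lerXn2r ?nnegrE// ler_nat; lia.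
    by apply: (negl_eq (neglN h)) => n k _; rewrite tailsumB.
  - by move=> q; exists 0 => // n k _; rewrite tailsum_top nc0 mul0r.
apply: (vneg_of_negl (i0 := fun n j => j%:Z + n%:Z) (neglN (neglD h1 h2))) => n j Sn.
  by rewrite /P; have := ltn_ord j; lia.
transitivity (e ^+ j * xseq a' b (j%:Z + n%:Z) - e ^+ j * tmh a' psi n (j%:Z + n%:Z)); last by ring.
rewrite tmh_shift_vec ?S_even//.
have eE (x A K : 'cV[C]_n) : (x - (A - e *: K)) j 0 = x j 0 - (A j 0 - e * K j 0).
  by rewrite !mxE.
by rewrite /xv_shift_err eE [xv_shift n j 0]mxE.
Qed.

Lemma plus_err_neg : vneg S plus_err.
Proof.
apply: (vneg_of_negl (i0 := fun _ j => j%:Z) (tmh_plus_asymp fd)) => n j Sn.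
  by rewrite /symrange; have := ltn_ord j; lia.
have eE (A H G T s : 'cV[C]_n) : (A - e *: H - (G + T - b *: s)) j 0 =
    A j 0 - e * H j 0 - (G j 0 + T j 0 - b * s j 0).
  by rewrite !mxE.
rewrite /plus_err eE -tmh_vec// -(sv_toeplitz e1) -(plus_sumE fd (n := n)); [|lia|have := ltn_ord j; lia].
by rewrite [gv n j 0]mxE [sv e n j 0]mxE; ring.
Qed.

Lemma minus_err_neg : vneg S minus_err.
Proof.
apply: (vneg_of_negl (i0 := fun _ j => j%:Z) (tplus_tminus_asymp fd)) => n j Sn.
  by rewrite /range1; have := ltn_ord j; lia.
have eE (A H G T s : 'cV[C]_n) : (A - e *: H - (G + b *: T - (b * b) *: s)) j 0 =
    A j 0 - e * H j 0 - (G j 0 + b * T j 0 - b * b * s j 0).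
  by rewrite !mxE.
rewrite /minus_err eE -tminus_vec -(sv_toeplitz e1) -(plus_sumE fd (n := n)); [|lia|have := ltn_ord j; lia].
have -> : (mxT p n)^T *m phiv n = \col_m (e ^+ m * tminus_psi p' psi n m%:Z).
  by apply/matrixP => m z; rewrite ord1 -tminus_psi_vec mxE.
rewrite -(twist_toeplitz_vec e1 p (fun m => tminus_psi p' psi n m%:Z)).
rewrite -(twist_hankel_vec e1 p (fun m => tailsum beta n m%:Z)).
by rewrite [sv e n j 0]mxE; ring.
Qed.

End FactorVectors.

(** * Entries of R-convergence *)

Section OperatorEntries.
Context {R : realType}.
Local Notation C := R[i].
Local Notation nc := (@Normc.normc R).
Implicit Types (A B : @imx R) (j k l N : nat) (x : nat -> C).

Lemma series_eventually x N n : (forall l, (N <= l)%N -> x l = 0) ->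
  (N <= n)%N -> series x n = \sum_(l < N) x l.
Proof.
move=> x0 Nn; rewrite /series /= (@big_cat_nat _ _ _ N)//= big_mkord.
rewrite [X in _ + X]big_nat_cond [X in _ + X]big1 ?addr0// => l /andP[/andP[Nl _] _].
exact: x0.
Qed.

Lemma imx_mul_finite A B j k N : (forall l, (N <= l)%N -> A j l * B l k = 0) ->
  imx_mul A B j k = \sum_(l < N) A j l * B l k.
Proof.
move=> h; rewrite /imx_mul; apply: lim_near_cst; first exact: norm_hausdorff.
exists N => // n /= Nn; exact: (series_eventually h).
Qed.

Definition restr N A : 'M[C]_N := \matrix_(j, k) A j k.
Definition rfin N B := forall l k, (N <= l)%N -> B l k = 0.
Definition cfin N B := forall l k, (N <= k)%N -> B l k = 0.

Lemma cfin_mul N A B : cfin N B -> cfin N (imx_mul A B).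
Proof.
move=> cB l k Nk; rewrite (@imx_mul_finite _ _ _ _ 0) ?big_ord0// => m _.
by rewrite cB// mulr0.
Qed.

Lemma restr_mul N A B :
  (forall j k l, (j < N)%N -> (k < N)%N -> (N <= l)%N -> A j l * B l k = 0) ->
  restr N (imx_mul A B) = restr N A *m restr N B.
Proof.
move=> h; apply/matrixP => j k; rewrite !mxE (@imx_mul_finite _ _ _ _ N).
  by apply: eq_bigr => l _; rewrite !mxE.
by move=> l Nl; exact: h.
Qed.

Lemma restr_mulr N A B : rfin N B -> restr N (imx_mul A B) = restr N A *m restr N B.
Proof. by move=> rB; apply: restr_mul => j k l _ _ Nl; rewrite rB// mulr0. Qed.

Lemma restr_mull N A B : cfin N A -> restr N (imx_mul A B) = restr N A *m restr N B.
Proof. by move=> cA; apply: restr_mul => j k l _ _ Nl; rewrite cA// mul0r. Qed.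

Lemma restrB N A B : restr N (A - B) = restr N A - restr N B.
Proof. by apply/matrixP => j k; rewrite !mxE. Qed.

Lemma restrN N A : restr N (- A) = - restr N A.
Proof. by apply/matrixP => j k; rewrite !mxE. Qed.

Lemma projP_rfin N : rfin N (@projP R N).
Proof. by move=> l k Nl; rewrite /projP ltnNge Nl. Qed.

Lemma projP_cfin N : cfin N (@projP R N).
Proof.
move=> l k Nk; rewrite /projP; case: ltnP => //= lN.
by have /negPf -> : l != k by apply: contraL lN => /eqP ->; rewrite -leqNgt.
Qed.

Lemma flipW_rfin N : rfin N (@flipW R N).
Proof. by move=> l k Nl; rewrite /flipW; have -> : ((l + k).+1 == N) = false by lia. Qed.

Lemma flipW_cfin N : cfin N (@flipW R N).
Proof. by move=> l k Nl; rewrite /flipW; have -> : ((l + k).+1 == N) = false by lia. Qed.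

Lemma imx_of_mx_rfin N (M : 'M[C]_N) : rfin N (imx_of_mx M).
Proof. by move=> l k Nl; rewrite /imx_of_mx insubN// -leqNgt. Qed.

Lemma imx_of_mx_cfin N (M : 'M[C]_N) : cfin N (imx_of_mx M).
Proof.
move=> l k Nk; rewrite /imx_of_mx; case: insubP => // u _ _.
by rewrite insubN// -leqNgt.
Qed.

Lemma restr_imx_of_mx N (M : 'M[C]_N) : restr N (imx_of_mx M) = M.
Proof. by apply/matrixP => j k; rewrite !mxE /imx_of_mx !valK. Qed.

Lemma restr_projP N : restr N (@projP R N) = 1%:M.
Proof. by apply/matrixP => j k; rewrite !mxE /projP ltn_ord. Qed.

Lemma restr_flipW N : restr N (@flipW R N) = mxJ N.
Proof. by apply/matrixP => j k; rewrite !mxE. Qed.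

Lemma restr_toeplitz N (a : distr R) : restr N (toeplitz a) = mxT (fcoef a) N.
Proof. by apply/matrixP => j k; rewrite !mxE. Qed.

Lemma restr_hankel N (a : distr R) : restr N (hankel a) = mxH (fcoef a) N.
Proof. by apply/matrixP => j k; rewrite !mxE /hankel; congr (fcoef a _); lia. Qed.

Lemma restr_hankel_shift N (a : distr R) :
  restr N (hankel (dmul (char (- N%:Z)) a)) = mxK (fcoef a) N.
Proof.
apply/matrixP => j k; rewrite !mxE /hankel fcoef_dmul_char; congr (fcoef a _); lia.
Qed.


Let term_ge0 mu (x : nat -> C) n : (0 <= ((1 + n%:R) `^ (2 * mu) * nc (x n) ^+ 2)%:E)%E.
Proof. by rewrite lee_fin mulr_ge0 ?powR_ge0 ?sqr_ge0. Qed.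

Let half_power (mu c : R) j : 0 <= c ->
  ((1 + j%:R) `^ (2 * mu) * c ^+ 2) `^ 2^-1 = (1 + j%:R) `^ mu * c.
Proof.
move=> c0; rewrite powRM ?powR_ge0 ?sqr_ge0// -powRrM.
have -> : 2 * mu * 2^-1 = mu by field.
congr (_ * _); rewrite -powR_mulrn// -powRrM.
by rewrite mulfV ?pnatr_eq0// powRr1.
Qed.

Lemma l2norm_delta (mu : R) k :
  @l2norm R mu (fun l => (l == k)%:R) = ((1 + k%:R) `^ mu)%:E.
Proof.
rewrite /l2norm (@nneseriesD1 _ _ k)//; last by move=> n _; exact: (term_ge0 mu (fun l => (l == k)%:R) n).
rewrite eseries0 => [|i _ /= ik]; last first.
  by rewrite (negPf ik) nc0 expr0n mulr0.
by rewrite adde0 poweR_EFin eqxx half_power ?nc1 ?mulr1.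
Qed.

Lemma l2norm_ge (mu : R) x j : (((1 + j%:R) `^ mu * nc (x j))%:E <= l2norm mu x)%E.
Proof.
rewrite -half_power ?nc_ge0// -poweR_EFin /l2norm.
apply: gt0_ler_poweR => //.
- by rewrite in_itv /= leey andbT; exact: (term_ge0 mu x j).
- by rewrite in_itv /= leey andbT; apply: nneseries_ge0 => n _ _; exact: term_ge0.
- rewrite (@nneseriesD1 _ _ j)//.
  by rewrite leeDl//; apply: nneseries_ge0 => n _ _; exact: term_ge0.
Qed.

(** The operator is applied to the k-th unit vector, and one coordinate of the image is bounded by
    its norm. *)
Lemma op_bounded_entry (mu1 mu2 M : R) A j k : op_bounded mu1 mu2 M A ->
  (1 + j%:R) `^ mu2 * nc (A j k) <= M * (1 + k%:R) `^ mu1.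
Proof.
move=> /(_ (fun l => (l == k)%:R)); rewrite l2norm_delta => /(_ (ltry _))[y hy].
have -> : A j k = y j.
  have hj := hy j; apply: (@cvg_unique _ (@norm_hausdorff _ C) _ _ _ _ _ hj).
  apply: cvg_near_cst; exists k.+1 => // n /= kn.
  rewrite (@series_eventually _ k.+1)// => [|l kl].
    rewrite big_ord_recr /= eqxx mulr1 big1 ?add0r// => i _.
    by rewrite ltn_eqF ?mulr0.
  by rewrite gtn_eqF ?mulr0.
move=> h; have := le_trans (l2norm_ge mu2 y j) h.
by rewrite -EFinM lee_fin.
Qed.

Lemma op_bigO_entry (mu1 mu2 rho : R) (X : nat -> @imx R) : 0 <= mu1 -> mu2 <= 0 ->
  op_bigO mu1 mu2 rho X -> exists p : nat, exists2 B : R, 0 <= B &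
  \forall N \near \oo, forall j k,
    nc (X N j k) <= B * N%:R `^ rho * (j.+1%:R * k.+1%:R) ^+ p.
Proof.
move=> m1 m2 [M hM].
pose p := maxn (Num.bound `|mu1|) (Num.bound `|mu2|).
exists p, `|M| => //.
have pw (mu : R) j : 0 <= mu -> (Num.bound `|mu| <= p)%N -> (1 + j%:R) `^ mu <= j.+1%:R ^+ p.
  move=> mu0 mup; have j1 : 1 <= 1 + j%:R :> R by rewrite lerDl.
  have -> : j.+1%:R = 1 + j%:R :> R by rewrite -natr1 addrC.
  rewrite -powR_mulrn//; apply: (ler_powR j1).
  have := archi_boundP (normr_ge0 mu); rewrite ger0_norm// => h.
  by apply: le_trans (ltW h) _; rewrite ler_nat -{1}[mu]ger0_norm.
near=> N => j k.
have hN : op_bounded mu1 mu2 (M * N%:R `^ rho) (X N) by near: N; exact: hM.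
have := op_bounded_entry j k hN.
have b0 : 0 < (1 + j%:R) `^ mu2 by rewrite powR_gt0// ltr_pwDl.
rewrite mulrC -ler_pdivlMr// => h; apply: le_trans h _.
rewrite -powRN.
have r0 : 0 <= N%:R `^ rho by exact: powR_ge0.
apply: (@le_trans _ _ (`|M| * N%:R `^ rho * (1 + k%:R) `^ mu1 * (1 + j%:R) `^ (- mu2))).
  by rewrite !ler_wpM2r ?powR_ge0// ler_norm.
rewrite exprMn -mulrA; apply: ler_wpM2l; first by rewrite mulr_ge0.
rewrite mulrC; apply: ler_pM; rewrite ?powR_ge0//; apply: pw; rewrite ?oppr_ge0//.
  by rewrite normrN leq_maxr.
by rewrite leq_maxl.
Unshelve. all: by end_near. Qed.

End OperatorEntries.

(** * R-convergence on finite blocks *)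

Section RConvergence.
Context {R : realType}.
Local Notation C := R[i].
Local Notation nc := (@Normc.normc R).
Local Notation "A ** B" := (imx_mul A B) (at level 40, left associativity).

Let entry_bigO (r : R) (E : forall n, 'M[C]_n) := exists p : nat, exists2 B : R, 0 <= B &
  \forall N \near \oo, forall j k, nc (E N j k) <= B * N%:R `^ r * (j.+1%:R * k.+1%:R) ^+ p.

Lemma restr_family (mu1 mu2 rho r : R) (X : nat -> @imx R) (E : forall n, 'M[C]_n) :
  0 <= mu1 -> mu2 <= 0 -> rho <= r -> op_bigO mu1 mu2 rho X ->
  (forall N, restr N (X N) = E N) ->
  entry_bigO r E.
Proof.
move=> m1 m2 rr hX XE; have [p [B B0 h]] := op_bigO_entry m1 m2 hX.
exists p, B => //; near=> N => j k; rewrite -XE mxE.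
have hN : forall j k, nc (X N j k) <= B * N%:R `^ rho * (j.+1%:R * k.+1%:R) ^+ p by near: N; exact: h.
have N1 : 1 <= N%:R :> R by rewrite ler1n; near: N; exact: nbhs_infty_gt.
apply: le_trans (hN j k) _; rewrite ler_wpM2r ?exprn_ge0 ?mulr_ge0// ler_wpM2l//.
exact: (ler_powR N1).
Unshelve. all: by end_near. Qed.

Lemma tri_conv_mx (x y : int -> C) n : (forall k, k < 0 -> x k = 0) ->
  (forall k, k < 0 -> y k = 0) ->
  (forall m : nat, \sum_(k < m.+1) x k%:Z * y (m%:Z - k%:Z) = (m == 0)%:R) ->
  mxT x n *m mxT y n = 1%:M.
Proof.
move=> x0 y0 xy; apply/matrixP => j k; rewrite !mxE.
have e (l : 'I_n) : mxT x n j l * mxT y n l k = x (j%:Z - l%:Z) * y (l%:Z - k%:Z) by rewrite !mxE.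
under eq_bigr => l _ do rewrite e.
have jn := ltn_ord j; case: (ltnP j k) => jk.
  rewrite big1 => [|l _]; last first.
    case: (ltnP j l) => jl; first by rewrite x0 ?mul0r//; lia.
    by rewrite y0 ?mulr0//; lia.
  by have -> : (j == k) = false by apply/eqP => /(congr1 val) /=; lia.
have -> : (j == k)%:R = ((j - k)%N == 0%N)%:R :> C.
  by congr (_%:R); rewrite subn_eq0 -(inj_eq val_inj) eqn_leq jk andbT.
rewrite -xy -(big_mkord xpredT (fun l => x (j%:Z - l%:Z) * y (l%:Z - k%:Z))).
rewrite (@big_cat_nat _ _ _ k) /=; [|lia|lia].
rewrite big_nat big1 ?add0r => [|l /andP[_ lk]]; last by rewrite y0 ?mulr0//; lia.
rewrite (@big_cat_nat _ _ _ j.+1) /=; [|lia|lia].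
rewrite [X in _ + X]big_nat [X in _ + X]big1 ?addr0 => [|l /andP[jl _]]; last by rewrite x0 ?mul0r//; lia.
rewrite -{1}[nat_of_ord k]add0n big_addn subSn// big_mkord (reindex_inj rev_ord_inj) /=.
apply: eq_bigr => l _; have := ltn_ord l => ll.
have -> : ((j - k).+1 - l.+1 + k)%N = (j - l)%N by lia.
by congr (x _ * y _); lia.
Qed.

Lemma invmx_comm n (A J : 'M[C]_n) : J *m A = A *m J -> J *m invmx A = invmx A *m J.
Proof.
move=> JA; have [uA|nuA] := boolP (A \in unitmx); last by rewrite invmx_out.
by rewrite -[LHS]mul1mx -(mulVmx uA) -mulmxA [A *m (_ *m _)]mulmxA -JA -!mulmxA mulmxV ?mulmx1.
Qed.

Context (a ap : distr R) (rho0 rho : R).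
Context (a_even : dist_even a) (hR : R_convergence a ap (dtilde ap) rho0 rho rho).

Let ca := fcoef a.
Let cp := fcoef ap.

(** Evenness identifies the matrices of a and its flip and makes the flip matrix commute with A^-1;
    a_- being the flip of a_+, T(a_-) is the transpose of T(a_+). Each infinite product restricts to
    a product of blocks because a triangular or finitely supported factor cuts off the inner sum. *)
Lemma R_convergence_entries : exists (pi mi : int -> C) (n0 : nat),
  [/\ moderate pi, moderate mi,
      forall n, mxT pi n *m mxT cp n = 1%:M /\ mxT mi n *m (mxT cp n)^T = 1%:M &
  let S n := (0 < n)%N && (n0 <= n)%N && ~~ odd n in
  let r := Num.max rho0 rho in
  let A := mxT ca in let Ai n := invmx (A n) in let H := mxH ca in
  let J n : 'M[C]_n := mxJ n in
  [/\ forall n, S n -> A n \in unitmx,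
   [/\ mO S r (fun n => H n *m Ai n *m H n - A n + mxT cp n *m (mxT cp n)^T),
       mO S r (fun n => H n *m Ai n - mxH cp n *m mxT mi n),
       mO S r (fun n => H n *m Ai n *m J n *m H n - mxK ca n) &
       mO S r (fun n => H n *m Ai n *m J n)] &
   [/\ mO S r (fun n => Ai n *m H n - mxT pi n *m mxH cp n),
       mO S r (fun n => Ai n - mxT pi n *m mxT mi n),
       mO S r (fun n => Ai n *m J n *m H n) &
       mO S r (fun n => Ai n *m J n)]]].
Proof.
have [api [ami [hpi hmi hunit [mu1 [mu2 [m1 m2 [hRN hRH hHR hHRH]]]]]]] := hR.
have tlE : fcoef (dtilde a) = ca.
  by apply/funext => k; rewrite fcoef_tilde -fcoef_tilde; exact: a_even.
have ttE : fcoef (dtilde (dtilde ap)) = cp.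
  by apply/funext => k; rewrite !fcoef_tilde opprK.
have tpT n : mxT (fcoef (dtilde ap)) n = (mxT cp n)^T.
  by apply/matrixP => j k; rewrite !mxE fcoef_tilde opprB.
have tmxE N : toeplitz_mx N (dtilde a) = mxT ca N.
  by apply/matrixP => j k; rewrite !mxE tlE.
have TiE N : restr N (toeplitz_inv N a) = invmx (mxT ca N) by exact: restr_imx_of_mx.
have TitE N : restr N (toeplitz_inv N (dtilde a)) = invmx (mxT ca N).
  by rewrite restr_imx_of_mx tmxE.
have r0 N (b : distr R) : rfin N (toeplitz_inv N b) by exact: imx_of_mx_rfin.
have c0 N (b : distr R) : cfin N (toeplitz_inv N b) by exact: imx_of_mx_cfin.
have pr N := @projP_rfin R N; have pc N := @projP_cfin R N.
have wr N := @flipW_rfin R N; have wc N := @flipW_cfin R N.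
have [p1 p2 p3] := hpi; have [q1 q2 q3] := hmi.
have D0 N : restr N (0 : @imx R) = 0 by apply/matrixP => j k; rewrite !mxE.
have lowT N (x y : distr R) : (forall k : int, k < 0 -> fcoef x k = 0) ->
    restr N (toeplitz x ** toeplitz y) = mxT (fcoef x) N *m mxT (fcoef y) N.
  move=> x0; rewrite restr_mul ?restr_toeplitz// => j k l jN kN Nl.
  by rewrite /toeplitz x0 ?mul0r//; lia.
have lowH N (x y : distr R) : (forall k : int, k < 0 -> fcoef x k = 0) ->
    restr N (toeplitz x ** hankel y) = mxT (fcoef x) N *m mxH (fcoef y) N.
  move=> x0; rewrite restr_mul ?restr_toeplitz ?restr_hankel// => j k l jN kN Nl.
  by rewrite /toeplitz x0 ?mul0r//; lia.
have upH N (x y : distr R) : (forall k : int, 0 < k -> fcoef y k = 0) ->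
    restr N (hankel x ** toeplitz y) = mxH (fcoef x) N *m mxT (fcoef y) N.
  move=> y0; rewrite restr_mul ?restr_toeplitz ?restr_hankel// => j k l jN kN Nl.
  by rewrite /toeplitz y0 ?mulr0//; lia.
have le0 : rho0 <= Num.max rho0 rho by rewrite le_max lexx.
have le1 : rho <= Num.max rho0 rho by rewrite le_max lexx orbT.
have [E1 E5] : entry_bigO (Num.max rho0 rho)
    (fun N => mxH ca N *m invmx (mxT ca N) *m mxH ca N - mxT ca N + mxT cp N *m (mxT cp N)^T) /\
  entry_bigO (Num.max rho0 rho)
    (fun N => mxH ca N *m invmx (mxT ca N) *m mxJ N *m mxH ca N - mxK ca N).
  have [h1 h2 _ _] := hHRH; split.
    apply: (restr_family m1 m2 le0 h1) => N.
    rewrite [(@ul _ \o _) N]/= !restrB restrN opprK lowT; last by rewrite ttE; exact: p1.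
    rewrite ttE tpT restr_toeplitz tlE; congr (_ - _ + _).
    rewrite restr_mull; last exact: cfin_mul.
    rewrite restr_mulr// restr_mulr// restr_mulr// !restr_hankel TiE restr_projP !mulmx1.
    by rewrite tlE.
  apply: (restr_family m1 m2 le1 h2) => N.
  rewrite [(@ur _ \o _) N]/= !restrB restr_hankel_shift restrN D0 oppr0 subr0 tlE; congr (_ - _).
  rewrite restr_mull; last exact: cfin_mul.
  rewrite restr_mulr// restr_mulr// restr_mulr// !restr_hankel TiE restr_projP restr_flipW !mulmx1.
  by rewrite tlE.
have [E2 E7] : entry_bigO (Num.max rho0 rho)
    (fun N => mxH ca N *m invmx (mxT ca N) - mxH cp N *m mxT (fcoef ami) N) /\
  entry_bigO (Num.max rho0 rho)
    (fun N => mxH ca N *m invmx (mxT ca N) *m mxJ N).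
  have [h1 h2 _ _] := hHR; split.
    apply: (restr_family m1 m2 le0 h1) => N.
    rewrite [(@ul _ \o _) N]/= !restrB upH; last exact: q2.
    by rewrite ttE restr_mulr// restr_mulr// restr_hankel TiE restr_projP !mulmx1 tlE.
  apply: (restr_family m1 m2 le1 h2) => N.
  rewrite [(@ur _ \o _) N]/= !restrB D0 subr0 restr_mulr// restr_mulr// restr_hankel TitE restr_flipW tlE.
  rewrite -!mulmxA invmx_comm//; apply: mxJ_comm => k; rewrite /ca -fcoef_tilde; exact: a_even.
have [E3 E6] : entry_bigO (Num.max rho0 rho)
    (fun N => invmx (mxT ca N) *m mxH ca N - mxT (fcoef api) N *m mxH cp N) /\
  entry_bigO (Num.max rho0 rho)
    (fun N => invmx (mxT ca N) *m mxJ N *m mxH ca N).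
  have [h1 h2 _ _] := hRH; split.
    apply: (restr_family m1 m2 le0 h1) => N.
    rewrite [(@ul _ \o _) N]/= !restrB lowH; last exact: p2.
    rewrite restr_mull; last exact: cfin_mul.
    by rewrite (restr_mulr _ (pr N)) restr_hankel TiE restr_projP mulmx1.
  apply: (restr_family m1 m2 le1 h2) => N.
  rewrite [(@ur _ \o _) N]/= !restrB D0 subr0 restr_mull; last exact: cfin_mul.
  by rewrite (restr_mulr _ (wr N)) restr_hankel TiE restr_flipW tlE.
have [E4 E8] : entry_bigO (Num.max rho0 rho)
    (fun N => invmx (mxT ca N) - mxT (fcoef api) N *m mxT (fcoef ami) N) /\
  entry_bigO (Num.max rho0 rho)
    (fun N => invmx (mxT ca N) *m mxJ N).
  have [h1 h2 _ _] := hRN; split.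
    apply: (restr_family m1 m2 le0 h1) => N.
    by rewrite [(@ul _ \o _) N]/= !restrB lowT ?TiE//; exact: p2.
  apply: (restr_family m1 m2 le1 h2) => N.
  by rewrite [(@ur _ \o _) N]/= !restrB D0 subr0 restr_mulr// TiE restr_flipW.
move: E1 E2 E3 E4 => [x1 [B1 B10 N1]] [x2 [B2 B20 N2]] [x3 [B3 B30 N3]] [x4 [B4 B40 N4]].
move: E5 E6 E7 E8 => [x5 [B5 B50 N5]] [x6 [B6 B60 N6]] [x7 [B7 B70 N7]] [x8 [B8 B80 N8]].
have [n0 _ hn0] := filterI hunit (filterI (filterI (filterI N1 N2) (filterI N3 N4)) (filterI (filterI N5 N6) (filterI N7 N8))).
exists (fcoef api), (fcoef ami), n0; split.
- exact: fcoef_moderate.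
- exact: fcoef_moderate.
- move=> n; split; first by apply: mulmx1C; apply: tri_conv_mx; [exact: p1|exact: p2|exact: p3].
  apply: (can_inj (@trmxK _ _ _)); rewrite trmx_mul trmxK trmx1.
  have -> : (mxT (fcoef ami) n)^T = mxT (fun k => fcoef ami (- k)) n.
    by apply/matrixP => j k; rewrite !mxE opprB.
  apply: tri_conv_mx; [exact: p1| |].
    by move=> k k0; apply: q2; rewrite oppr_gt0.
  move=> m; rewrite -q3; apply: eq_bigr => k _; by rewrite fcoef_tilde opprK opprB.
- split.
  + by move=> n /andP[/andP[_ n0n] _]; have [] := hn0 n n0n.
  + split; [exists x1, B1|exists x2, B2|exists x5, B5|exists x7, B7] => // n /andP[/andP[_ n0n] _];
    by have [_ [[[]]]] := hn0 n n0n; move=> ? ? [] ? ? [[]] ? ? [].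
  + split; [exists x3, B3|exists x4, B4|exists x6, B6|exists x8, B8] => // n /andP[/andP[_ n0n] _];
    by have [_ [[[]]]] := hn0 n n0n; move=> ? ? [] ? ? [[]] ? ? [].
Qed.

End RConvergence.

(** * Conclusion *)

Section MatrixBounds.
Context {R : realType}.
Local Notation C := R[i].
Context (S : nat -> bool).
Implicit Types (M E : forall n : nat, 'M[C]_n) (f : int -> C).

Lemma mmodD M M' : mmod S M -> mmod S M' -> mmod S (fun n => M n + M' n).
Proof.
move=> [p [B B0 h]] [p' [B' B0' h']]; exists (p + p')%N, (B + B'); first exact: addr_ge0.
move=> n Sn j k; rewrite mxE; apply: le_trans (ncD _ _) _; rewrite mulrDl exprD.
have N1 q : 1 <= n.+1%:R ^+ q :> R by rewrite exprn_ege1// ler1n.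
have N0 q : 0 <= n.+1%:R ^+ q :> R by exact: exprn_ge0.
apply: lerD; [apply: le_trans (h _ Sn j k) _|apply: le_trans (h' _ Sn j k) _].
  by rewrite ler_wpM2l// ler_peMr.
by rewrite ler_wpM2l// ler_peMl.
Qed.

Lemma mmodM M M' : mmod S M -> mmod S M' -> mmod S (fun n => M n *m M' n).
Proof.
move=> [p [B B0 h]] [p' [B' B0' h']]; exists (p + p').+1, (B * B'); first exact: mulr_ge0.
move=> n Sn j k; rewrite mxE.
have N0 q : 0 <= n.+1%:R ^+ q :> R by exact: exprn_ge0.
apply: (@le_trans _ _ (n.+1%:R * (B * n.+1%:R ^+ p * (B' * n.+1%:R ^+ p')))).
  apply: nc_sum_le => [|l]; first by rewrite !mulr_ge0.
  by rewrite ncM; apply: ler_pM; rewrite ?nc_ge0//; [exact: h|exact: h'].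
by rewrite exprS exprD le_eqVlt; apply/orP; left; apply/eqP; ring.
Qed.

Lemma mmod_mO (r : R) E : (forall n, S n -> (0 < n)%N) -> r <= 0 -> mO S r E -> mmod S E.
Proof.
move=> S0 r0 [p [B B0 h]]; exists (p + p)%N, B => // n Sn j k.
apply: le_trans (h n Sn j k) _.
have n1 : 1 <= n%:R :> R by rewrite ler1n S0.
have {}n1 : n%:R `^ r <= 1 by have := ler_powR n1 r0; rewrite powRr0.
have le m : (m < n)%N -> m.+1%:R <= n.+1%:R :> R by move=> mn; rewrite ler_nat ltnS ltnW.
apply: (@le_trans _ _ (B * 1 * (n.+1%:R * n.+1%:R) ^+ p)); last by rewrite mulr1 exprMn exprD.
rewrite ler_pM ?mulr_ge0 ?powR_ge0 ?exprn_ge0 ?mulr_ge0 ?ler_wpM2l//.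
by rewrite lerXn2r ?nnegrE ?mulr_ge0// ler_pM ?le.
Qed.

Lemma mmod_mxT f : moderate f -> mmod S (mxT f).
Proof.
move=> [p [B B0 h]]; exists p, B => // n _ j k; rewrite mxE; apply: le_trans (h _) _.
by rewrite ler_wpM2l// lerXn2r ?nnegrE// ler_nat; have := ltn_ord j; have := ltn_ord k; lia.
Qed.

Lemma mmod_mxH f : moderate f -> mmod S (mxH f).
Proof.
move=> [p [B B0 h]]; exists p, (B * 2 ^+ p); first by rewrite mulr_ge0 ?exprn_ge0.
move=> n _ j k; rewrite mxE; apply: le_trans (h _) _.
rewrite -mulrA -exprMn -natrM ler_wpM2l// lerXn2r ?nnegrE// ler_nat.
by have := ltn_ord j; have := ltn_ord k; lia.
Qed.

Lemma mmod_mxJ : mmod S (@mxJ R).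
Proof.
exists 0%N, 1 => // n _ j k; rewrite mxE expr0 mulr1.
by case: (_ == _); rewrite ?nc1 ?nc0.
Qed.

(** The flip pairs j with n - 1 - j, and 2 (j + 1)(n - j) >= n + 1, so decay in the indices becomes
    decay in n. *)
Lemma sO_dt_mxJ (r : R) (u w : forall n : nat, 'cV[C]_n) : (forall n, S n -> (0 < n)%N) ->
  vrap S u -> vrap S w -> sO S r (fun n => dt (u n) (mxJ n *m w n)).
Proof.
move=> S0 hu hw; apply: sO_small => // q.
have [B B0 h] := hu q.+1; have [B' B0' h'] := hw q.+1.
exists (B * B' * 2 ^+ q.+1); first by rewrite !mulr_ge0 ?exprn_ge0.
have N0 (m q' : nat) : 0 < m.+1%:R ^+ q' :> R by exact: exprn_gt0.
move=> n Sn; rewrite dtE.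
apply: (@le_trans _ _ (n.+1%:R * (B * B' * 2 ^+ q.+1 / n.+1%:R ^+ q.+1))); last first.
  by rewrite [n.+1%:R ^+ q.+1]exprS le_eqVlt; apply/orP; left; apply/eqP; field; rewrite !gt_eqF.
apply: nc_sum_le => [|j]; first by rewrite !mulr_ge0 ?invr_ge0 ?exprn_ge0// ltW.
rewrite mxJE ncM.
apply: le_trans (ler_pM (nc_ge0 _) (nc_ge0 _) (h n Sn j) (h' n Sn (rev_ord j))) _.
rewrite mulrACA -invfM -[leRHS]mulrA ler_wpM2l ?mulr_ge0// -exprMn.
rewrite ler_pdivlMr// mulrC ler_pdivrMr ?exprn_gt0 ?mulr_gt0// -exprMn.
rewrite lerXn2r ?nnegrE ?mulr_ge0// -!natrM ler_nat /=.
move: (nat_of_ord j) (ltn_ord j) => m mn; rewrite -(subnK mn); move: (n - m.+1)%N => i.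
by rewrite addnK; nia.
Qed.

End MatrixBounds.

(** * Limit of the determinant ratio *)

Section RatioAsymptotics.
Context {R : realType}.
Local Notation C := R[i].
Implicit Types (f : int -> C).

Lemma sum_antider f n (k : int) :
  \sum_(m < n) f (k + m%:Z + 1) = antider f (k + n%:Z) - antider f k.
Proof.
elim: n => [|n IH]; first by rewrite big_ord0 addr0 subrr.
rewrite big_ord_recr IH /=; have -> : k + n.+1%:Z = k + n%:Z + 1 by lia.
by rewrite antiderS; ring.
Qed.

Lemma sum_antider_down f n (k : int) :
  \sum_(m < n) f (k - m%:Z) = antider f k - antider f (k - n%:Z).
Proof.
elim: n => [|n IH]; first by rewrite big_ord0 subr0 subrr.
rewrite big_ord_recr IH /=; have -> : k - n.+1%:Z = k - n%:Z - 1 by lia.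
by rewrite antider_prev; ring.
Qed.

Context (S : nat -> bool) (r : R) (S0 : forall n, S n -> (0 < n)%N)
  (S_even : forall n, S n -> ~~ odd n) (r0 : r <= 0).
Context (a p c pi mi : int -> C).
Local Notation A := (mxT a).
Local Notation Ai := (fun n => invmx (A n)).
Local Notation H := (mxH a).
Local Notation J := (@mxJ R).
Context (pi_mod : moderate pi) (mi_mod : moderate mi)
  (piE : forall n, mxT pi n *m mxT p n = 1%:M)
  (miE : forall n, mxT mi n *m (mxT p n)^T = 1%:M)
  (uA : forall n, S n -> A n \in unitmx)
  (E1 : mO S r (fun n => H n *m Ai n *m H n - A n + mxT p n *m (mxT p n)^T))
  (E2 : mO S r (fun n => H n *m Ai n - mxH p n *m mxT mi n))
  (E5 : mO S r (fun n => H n *m Ai n *m J n *m H n - mxK a n))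
  (E7 : mO S r (fun n => H n *m Ai n *m J n))
  (E3 : mO S r (fun n => Ai n *m H n - mxT pi n *m mxH p n))
  (E4 : mO S r (fun n => Ai n - mxT pi n *m mxT mi n))
  (E6 : mO S r (fun n => Ai n *m J n *m H n))
  (E8 : mO S r (fun n => Ai n *m J n)).
Context (psi al be psi2 al2 be2 : int -> C) (b1 b : C) (b_neq0 : b != 0)
  (fd1 : factor_data (twist 1 a) (twist 1 p) psi al be b1)
  (fd2 : factor_data (twist (-1) a) (twist (-1) p) psi2 al2 be2 b)
  (psi_alt : negl full (fun n _ => zsum n (alt psi)))
  (be_alt : negl full (fun n _ => zsum n (alt be))).
Context (c_rec : forall k, c k - c (k - 1) = a k + a (k - 1)) (c0 : c 0 = 0)
  (c_odd : forall n : nat, c (- n%:Z) = - c n%:Z).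

Let ep : (1 : C) = 1 \/ (1 : C) = -1. Proof. by left. Qed.
Let em : (-1 : C) = 1 \/ (-1 : C) = -1. Proof. by right. Qed.

Let twist1 f : twist 1 f = f.
Proof. by apply/funext => k; rewrite /twist expr1n mul1r. Qed.

Let a_even k : a (- k) = a k.
Proof. by have := fd_aeven fd1 k; rewrite twist1. Qed.

Let a'_even k : twist (-1) a (- k) = twist (-1) a k.
Proof. exact: fd_aeven fd2 k. Qed.

Let a_mod : moderate a.
Proof. by have := fd_amod fd1; rewrite twist1. Qed.

Local Notation v := (@sv R (-1)).
Local Notation x := (xv 1 a b1).
Local Notation y := (xv (-1) a b).
Local Notation y' := (xv_shift (-1) a b).
Local Notation phi := (phiv 1 psi).
Local Notation phi2 := (phiv (-1) psi2).
Local Notation G := (gv 1 be).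
Local Notation G2 := (gv (-1) be2).

Let main n := dt (phi n) (mxT p n *m v n) + dt (G n) (v n) - b *+ 2 * dt (phi n) (v n).
Let t1 := xv_err 1 a p psi be b1.
Let t2 := xv_err (-1) a p psi2 be2 b.
Let t3 := xv_shift_err (-1) a psi2 b.
Let t4 := plus_err (-1) p psi2 be2 b.
Let t5 := minus_err (-1) p psi2 be2 b.
Let err n := ident_error (A n) (H n) (mxK a n) (J n) (mxT p n) (mxH p n) (mxT pi n) (mxT mi n)
  (v n) (phi n) (phi2 n) (G n) (G2 n) (t1 n) (t2 n) (t3 n) (t4 n) (t5 n) b.

(** A twisted row sum is a difference of antiderivatives at j and j - n. Reflection turns the second
    into an entry of J y, with a sign because n is even; the two centring constants b^2/2 account
    for the multiple of v. *)
Lemma toeplitz_sv n : ~~ odd n -> A n *m v n = (b * b) *: v n + y n - J n *m y n.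
Proof.
move=> en; apply/matrixP => j z; rewrite ord1 -(sv_toeplitz em) sum_antider_down.
have eE (x1 x2 x3 : 'cV[C]_n) : ((b * b) *: x1 + x2 - x3) j 0 = b * b * x1 j 0 + x2 j 0 - x3 j 0.
  by rewrite !mxE.
rewrite eE mxJE !mxE /xseq -[nat_of_ord (rev_ord j)]/(n - j.+1)%N.
have jn := ltn_ord j.
have -> : (n - j.+1)%:Z = - (j%:Z - n%:Z) - 1 by lia.
rewrite antider_reflect//.
have -> : (-1) ^+ (n - j.+1) = - (-1) ^+ j :> C.
  rewrite -[LHS]signr_odd -[in RHS]signr_odd -signrN; congr (_ ^+ _).
  by rewrite oddB// (negPf en) /=; case: (odd j).
by field.
Qed.

Lemma hankel_sv n : ~~ odd n -> H n *m v n = y n - y' n.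
Proof.
move=> en; apply/matrixP => j z; rewrite ord1.
have := twist_hankel_vec em a (fun=> 1) j.
have -> : \col_m ((-1) ^+ m * 1) = v n by apply/matrixP => i k; rewrite !mxE mulr1.
under eq_bigr do rewrite mulr1.
rewrite sum_antider mulN1r => /(congr1 -%R); rewrite opprK => <-.
by rewrite !mxE /xseq; ring.
Qed.

Lemma sign_moderate : vmod S v.
Proof. by exists 0%N, 1 => // n _ j; rewrite mxE nc_sign ?mulr1//; right. Qed.

Lemma exact_identity_sequences n : S n ->
  - dt (x n) (Ai n *m ((b * b) *: v n)) = b * main n + err n.
Proof.
move=> Sn; have en := S_even Sn.
apply: (exact_identity (y := y n) (y' := y' n)).
- exact: mxT_sym.
- exact: mxH_sym.
- exact: uA.
- exact: mxJ_comm.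
- exact: piE.
- exact: miE.
- exact: toeplitz_sv.
- exact: hankel_sv.
- by rewrite /t1 /xv_err scale1r [RHS]addrC subrK.
- by rewrite /t2 /xv_err scaleN1r opprK [RHS]addrC subrK.
- by rewrite /t3 /xv_shift_err scaleN1r opprK [RHS]addrC [X in _ - X]addrC subrK.
- by rewrite /t4 /plus_err scaleN1r opprK [RHS]addrC subrK.
- by rewrite /t5 /minus_err scaleN1r opprK [RHS]addrC subrK.
Qed.

Lemma main_asymp : sO S r (fun n => main n - (b1 - b) / 2).
Proof.
apply: sO_small => // q; have [B B0 h] := alternating_asymp fd1 b psi_alt be_alt q.
exists B => // n Sn.
suff -> : main n = altsum n (fun j => tminus_psi (twist 1 p) psi n j%:Z)
    + altsum n (fun j => tailsum be n j%:Z) - b *+ 2 * altsum n (fun j => tailsum psi n j%:Z).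
  exact: (h n 0 (S_even Sn)).
have tvE f : dt (tv 1 f n) (v n) = altsum n (fun j => tailsum f n j%:Z).
  by rewrite dtE; apply: eq_bigr => j _; rewrite !mxE expr1n mul1r mulrC.
rewrite /main !tvE; congr (_ + _ - _).
rewrite -[mxT p n]trmxK -dt_adj dtE; apply: eq_bigr => j _.
by rewrite -(tminus_psi_vec ep) expr1n mul1r mulrC [v n _ _]mxE.
Qed.

Lemma err_small : sO S r err.
Proof.
have p1 := phiv_rap ep fd1 S; have p2 := phiv_rap em fd2 S.
have g1 := tpgv_rap ep fd1 S; have g2 := tpgv_rap em fd2 S.
have s1 : vneg S t1 := xv_err_neg ep fd1 S.
have s2 : vneg S t2 := xv_err_neg em fd2 S.
have s3 : vneg S t3 := xv_shift_err_neg em fd2 S_even.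
have s4 : vneg S t4 := plus_err_neg em fd2 S.
have s5 : vneg S t5 := minus_err_neg em fd2 S.
have mH : mmod S H := mmod_mxH S a_mod.
have mAi : mmod S Ai.
  have := mmodD (mmod_mO S0 r0 E4) (mmodM (mmod_mxT S pi_mod) (mmod_mxT S mi_mod)).
  by move=> [q [B B0 h]]; exists q, B => // n Sn j k; have := h n Sn j k; rewrite subrK.
have s2' : vneg S (fun n => Ai n *m (t2 n - J n *m t2 n)).
  exact: (mmod_vneg mAi (vnegD s2 (vnegN (mmod_vneg (mmod_mxJ S) s2)))).
have z1 := sO_dt_mO p1 p2 E1; have z2 := sO_dt_mO p1 g2 E2.
have z3 := sO_dt_mO p1 p2 E5; have z4 := sO_dt_mO p1 g2 E7.
have z5 := sO_dt_mO g1 p2 E3; have z6 := sO_dt_mO g1 g2 E4.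
have z7 := sO_dt_mO g1 p2 E6; have z8 := sO_dt_mO g1 g2 E8.
have z9 := sO_dt_mxJ r S0 g1 p2.
have z10 := sO_dt_small_r r S0 (vrap_mod p1) (vnegD (vnegD s5 s2) (vnegN s3)).
have z11 := sO_dt_small_r r S0 (vrap_mod (gv_rap ep fd1 S)) s4.
have z12 := sO_dt_small_r r S0 (vrap_mod p1) (mmod_vneg mH s2').
have z13 := sO_dt_small_r r S0 (vrap_mod g1) s2'.
have z14 := sOZ (b * b) (sO_dt_small r S0 s1 (mmod_vmod mAi sign_moderate)).
exact (sOB (sOB (sOB (sOB (sOD (sOD (sOB (sOD (sOD (sOB (sOB (sOD (sOD (sON z1) z2)
  z3) z4) z5) z6) z7) z8) z9) z10) z11) z12) z13) z14).
Qed.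

(* The vector of ones is fixed by the flip J, while v is negated by it. *)
Lemma ones_orthogonal n : ~~ odd n -> dt (sv 1 n) (Ai n *m v n) = 0.
Proof.
move=> en.
have Jv : J n *m v n = - v n.
  apply/matrixP => j z; rewrite ord1 mxJE !mxE /= -[LHS]signr_odd -[in RHS]signr_odd -signrN.
  congr (_ ^+ _); have jn := ltn_ord j.
  by rewrite oddB// (negPf en) /=; case: (odd j).
have uJ : (J n)^T *m sv 1 n = sv 1 n.
  have -> : (J n)^T = J n by apply/matrixP => j k; rewrite !mxE addnC.
  by apply/matrixP => j z; rewrite ord1 mxJE !mxE !expr1n.
have e : dt (sv 1 n) (Ai n *m v n) = - dt (sv 1 n) (Ai n *m v n).
  rewrite -{1}uJ dt_adj trmxK mulmxA invmx_comm; last exact: mxJ_comm.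
  by rewrite -mulmxA Jv mulmxN dtNr.
by apply/eqP; move/eqP: e; rewrite -subr_eq0 opprK -mulr2n mulrn_eq0.
Qed.

Lemma det_ratio_asymp : sO S r (fun n => \det (mxT c n) / \det (A n) - b1 / b).
Proof.
have h := sOZ (2 / (b * b)) (sOD (sOZ b main_asymp) err_small).
case: h => B B0 h; exists B => // n Sn.
suff -> : \det (mxT c n) / \det (A n) - b1 / b =
    2 / (b * b) * (b * (main n - (b1 - b) / 2) + err n) by exact: h.
have e := exact_identity_sequences Sn.
pose w k := zsum (absz k) a.
(* Summing the recurrence from c(0) = 0 gives a_m + c_m; evenness of a and oddness of c make this
   the first row a_-m - c_-m. *)
have wS (m : nat) : a m%:Z + c m%:Z = w m%:Z.
  rewrite /w absz_nat; elim: m => [|m IH]; first by rewrite c0 addr0 zsum0.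
  rewrite zsumS -IH; have := c_rec m.+1%:Z.
  have -> : m.+1%:Z - 1 = m%:Z by lia.
  by move=> /eqP; rewrite subr_eq => /eqP ->; rewrite a_even; ring.
have detE : \det (mxT c n) = \det (A n) * (1 - dt (\col_(k < n) w k%:Z) (Ai n *m v n)).
  have h1 (k : nat) : a (- k%:Z) - c (- k%:Z) = w k%:Z by rewrite a_even c_odd opprK.
  have h2 (k : 'I_n) : v n k 0 = (-1) ^+ k by rewrite mxE.
  apply: etrans (toeplitz_det_ratio c_rec h1 h2 (uA Sn)) _.
  congr (_ * (1 - _)); rewrite /dt; congr ((_ *m _) 0 0).
  by apply/matrixP => i k; rewrite !mxE.
have wE : \col_(k < n) w k%:Z = x n + x n + (b1 * b1) *: sv 1 n.
  apply/matrixP => k z; rewrite !mxE expr1n /w absz_nat antider_even// /xseq twist1.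
  by field.
have nA : \det (A n) != 0 by rewrite -unitfE -unitmxE uA.
rewrite detE mulrAC mulfV// mul1r wE !dtDl.
have -> : dt ((b1 * b1) *: sv 1 n) (Ai n *m v n) = 0.
  by rewrite dtC dtZr dtC ones_orthogonal ?mulr0// S_even.
move: e; rewrite -scalemxAr dtZr => e.
have {}e : dt (x n) (Ai n *m v n) = - (b * main n + err n) / (b * b).
  by rewrite -e opprK mulrC mulKf// mulf_neq0.
by rewrite e; field.
Qed.

End RatioAsymptotics.

Unset Implicit Arguments.
Set Strict Implicit.
Set Printing Implicit Defensive.

Theorem theorem4p2 (R : realType) (K : set (circle R))
    (a ap sigma asigma : distr R) (s sp : circle R -> R[i]) (rho0 rho : R) :
  compact K ->
  (forall t, K t <-> K (circleV t)) ->
  ~ K circle1 -> ~ K (circleN circle1) ->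
  smooth_part K a s -> dist_even a ->
  unit_plus_off K ap -> smooth_part K ap sp ->
  (forall t, ~ K t -> s t = sp t * sp (circleV t)) ->
  rho0 < 0 -> rho < 0 ->
  R_convergence a ap (dtilde ap) rho0 rho rho ->
  is_sigma sigma ->
  dist_product K [set circle1] a sigma asigma ->
  exists M : R, \forall N \near \oo,
    Normc.normc (\det (toeplitz_mx (2 * N) asigma) / \det (toeplitz_mx (2 * N) a)
                 - sp circle1 / sp (circleN circle1))
      <= M * N%:R `^ Num.max rho0 rho.
Proof.
move=> cK symK nK1 nKN sa aev [_ [ap' [sp' sap'] apinv]] sap ssp rho0N rhoN hR hs hc.
have [apP _ _] := apinv.
have oK := open_setC_compact cK.
pose tN : circle R := circleN circle1.
have at1 t : val t = 1%:C%C -> t = circle1 by move=> e; exact: val_inj.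
have atN t : val t = (-1)%:C%C -> t = tN by move=> e; apply: val_inj; rewrite e rmorphN1.
(* The value 0 at -1 makes the alternating Fourier sums of psi and psi a_+ negligible, as the main
   term requires. *)
have [psi [vpsi psiV psi1 psiN]] : exists psi : smoothfun R, [/\ vanishes_near K psi,
    forall t, psi (circleV t) = psi t, psi circle1 = 1 & psi tN = 0].
  have [|psi [h1 h2 h3 h4]] := exists_bump oK (or_introl (erefl 1)).
    by move=> t /at1 ->.
  exists psi; split; [exact: h1|exact: h2|exact: h3|].
  by apply: h4; rewrite rmorphN1.
have [psi2 [vpsi2 psi2V psi2N]] : exists psi2 : smoothfun R, [/\ vanishes_near K psi2,
    forall t, psi2 (circleV t) = psi2 t & psi2 tN = 1].
  have [|psi2 [h1 h2 h3 _]] := exists_bump oK (or_intror (erefl (-1))).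
    by move=> t /atN ->.
  exists psi2; split; [exact: h1|exact: h2|].
  by apply: h3; rewrite rmorphN1.
have epsi := flip_evenP psiV; have epsi2 := flip_evenP psi2V.
have [al [be [alE beE alV [apsi ppsi pbe]]]] := factor_local_data oK symK sa sap ssp vpsi epsi.
have [al2 [be2 [al2E be2E al2V [apsi2 ppsi2 pbe2]]]] :=
  factor_local_data oK symK sa sap ssp vpsi2 epsi2.
have fd1 := factor_data_at (t0 := circle1) (or_introl erefl) aev apP ssp nK1 epsi psi1 alV
  alE beE apsi ppsi pbe.
have fd2 := factor_data_at (t0 := tN) (or_intror erefl) aev apP ssp nKN epsi2 psi2N al2V
  al2E be2E apsi2 ppsi2 pbe2.
have alt0 (f : smoothfun R) : f tN = 0 ->
    negl full (fun n _ => zsum n (alt (twist (1 : R[i]) (fc f)))).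
  move=> f0; apply: (negl_eq (inversion_negl f tN)) => n k _.
  rewrite f0 subr0; apply: eq_zsum => m.
  by rewrite /alt /twist expr1n mul1r mulrC twist_exprz//; right.
have psiA := alt0 _ psiN.
have beA : negl full (fun n _ => zsum n (alt (twist (1 : R[i]) (fc be)))).
  by apply: alt0; rewrite beE psiN mulr0.
have spN : sp tN != 0 := plus_inverse_smooth_part oK apinv sap sap' vpsi2 psi2N.
have c0 : fcoef asigma 0 = 0.
  apply: (sigma_product_0 sa hs hc aev oK vpsi epsi psi1) => u uE.
  have -> : u = al by apply: val_inj; apply/funext => t; exact: etrans (uE t) (esym (alE t)).
  exact: alV.
have c_odd (n : nat) : fcoef asigma (- n%:Z) = - fcoef asigma n%:Z.
  by apply/eqP; rewrite -addr_eq0 addrC (sigma_product_sym hs hc aev) c0 mul0rn.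
have [pi [mi [n0 [pim mim piE [uA [E1 E2 E5 E7] [E3 E4 E6 E8]]]]]] :=
  R_convergence_entries aev hR.
pose S n := (0 < n)%N && (n0 <= n)%N && ~~ odd n.
pose r := Num.max rho0 rho.
have r0 : r <= 0 by rewrite /r ge_max !ltW.
have S0 n : S n -> (0 < n)%N by move=> /andP[/andP[]].
have Se n : S n -> ~~ odd n by move=> /andP[].
have [B B0 h] := det_ratio_asymp S0 Se r0 pim mim (fun n => (piE n).1) (fun n => (piE n).2)
  uA E1 E2 E5 E7 E3 E4 E6 E8 spN fd1 fd2 psiA beA (sigma_product_rec hs hc) c0 c_odd.
exists B, (maxn 1 n0) => // N /=; rewrite geq_max => /andP[N1 N0].
have SN : S (2 * N)%N by rewrite /S oddM andbT; lia.
(* The estimate is taken at size 2N; since r <= 0, (2N)^r <= N^r. *)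
apply: le_trans (h _ SN) _; rewrite ler_wpM2l// natrM powRM//.
have le1 : 2 `^ r <= 1 :> R by have := ler_powR (ler1n R 2) r0; rewrite powRr0.
by rewrite ler_piMl ?powR_ge0.
Qed.
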